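(* Fix $\ell\ge 2$ and $\mathbf m$ with $\sigma:=\sum_{S\in\binom{[\ell]}{2}}\mathbf m_S>0$. As $n\to\infty$, $$s^*(n,\ell,\mathbf m)=\Bigl(1+O\bigl(\tfrac1n\bigr)\Bigr)\,2^n\prod_{S\in\binom{[\ell]}{2}}\frac{1}{\mathbf m_S!}\Bigl(\frac{\mathbf m_S\, n}{\sigma}\Bigr)^{\mathbf m_S}.$$ Moreover, for all sufficiently large $n$ and every extremal example $\mathcal F_1,\dots,\mathcal F_\ell$, there exist an oriented graph $T=([\ell],E)$ and sets $A_e\subseteq[n]$, $e\in E$, such that: (1) for distinct $k_1,k_2\in[\ell]$ there is an edge between $k_1$ and $k_2$ (in exactly one direction) if and only if $\mathbf m_{\{k_1,k_2\}}>0$; (2) the sets $A_e$, $e\in E$, form a partition of $[n]$, and $|A_{(k,k')}|=(1+O(n^{-1}))\,\mathbf m_{\{k,k'\}}\,n/\sigma$ for every $(k,k')\in E$; (3) for every $k\in[\ell]$, writing $In_k=\{k':(k',k)\in E\}$ and $Out_k=\{k':(k,k')\in E\}$, $$2^{\bigsqcup_{k'\in In_k}A_{(k',k)}}\vee\bigvee_{k'\in Out_k}\binom{A_{(k,k')}}{\le \mathbf m_{\{k,k'\}}}\subseteq\mathcal F_k .$$ The implied constants depend only on $\ell$ and $\mathbf m$.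
   Context: $[n]=\{1,\dots,n\}$; $2^X$ is the power set of $X$ and $\binom{X}{\le t}$ the family of subsets of $X$ with at most $t$ elements. For families $\mathcal A,\mathcal B$, $\mathcal A\vee\mathcal B=\{A\cup B: A\in\mathcal A,B\in\mathcal B\}$; an empty $\vee$-product is $\{\emptyset\}$ and $2^{\emptyset}=\{\emptyset\}$. Let $\mathbf m=(\mathbf m_S)_{S\in\binom{[\ell]}{2}}$ be non-negative integers indexed by unordered pairs, with $\mathbf m_{k,k'}=\mathbf m_{\{k,k'\}}$. Families $\mathcal F_1,\dots,\mathcal F_\ell\subseteq 2^{[n]}$ have the $\mathbf m$-overlapping property if $|F\cap F'|\le\mathbf m_{k,k'}$ whenever $k\neq k'$, $F\in\mathcal F_k$, $F'\in\mathcal F_{k'}$. $s^*(n,\ell,\mathbf m)$ denotes the maximum of $|\mathcal F_1|\cdots|\mathcal F_\ell|$ over all $\mathbf m$-overlapping families, and an extremal example is a tuple of $\mathbf m$-overlapping families attaining this maximum. Asymptotic notation refers to $\ell,\mathbf m$ fixed and $n\to\infty$. *)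

(* Defs.v *)
From mathcomp Require Import all_boot all_order all_algebra.
Set Implicit Arguments. Unset Strict Implicit. Unset Printing Implicit Defensive.
Import Order.TTheory GRing.Theory Num.Theory.

(* The vector m = (m_S)_{S in binom([l],2)} is represented by a function
   m : {set 'I_l} -> nat; only its values on 2-element sets matter, and
   m_{k,k'} := m [set k; k']. *)

Definition overlapping (l n : nat) (m : {set 'I_l} -> nat)
    (F : {ffun 'I_l -> {set {set 'I_n}}}) : bool :=
  [forall k : 'I_l, forall k' : 'I_l, (k != k') ==>
     [forall A in F k, forall B in F k', #|A :&: B| <= m [set k; k']]].

Definition s_star (l n : nat) (m : {set 'I_l} -> nat) : nat :=
  \max_(F : {ffun 'I_l -> {set {set 'I_n}}} | overlapping m F) \prod_(k < l) #|F k|.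

Definition sigma (l : nat) (m : {set 'I_l} -> nat) : nat :=
  \sum_(S : {set 'I_l} | #|S| == 2) m S.

Local Open Scope ring_scope.

Definition main_term (l : nat) (m : {set 'I_l} -> nat) (n : nat) : rat :=
  2%:R ^+ n * \prod_(S : {set 'I_l} | #|S| == 2)
     (((m S)`!)%:R^-1 * (((m S * n)%N)%:R / (sigma m)%:R) ^+ m S).

Definition extremal (l n : nat) (m : {set 'I_l} -> nat)
    (F : {ffun 'I_l -> {set {set 'I_n}}}) : Prop :=
  overlapping m F /\ \prod_(k < l) #|F k| = s_star n m.

(* Main.v *)
Require Import Defs.
From mathcomp Require Import all_boot all_order all_algebra.
From mathcomp Require Import ring lra zify.
Import Order.TTheory GRing.Theory Num.Theory.

(** Write p_k(x) for the proportion of the members of F_k that contain x, and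
    let F be extremal.  Flipping an element in the first family that allows it
    matches tuples of sets in which x is covered an odd number of times with
    tuples in which it is covered an even number of times; hence
    prod_k |F_k| <= 2^n O(n^sigma), and more precisely prod_k p_k(Y_k) is
    O(n^-e) where e counts the coincidences of the sets Y_k.
    Extremality gives lower bounds: deleting x everywhere and adding it back in
    a suitable way cannot increase the product.  This shows that exactly one
    family is "hot" at x (p_k(x) close to 1/2) and exactly one other family
    is "warm" (p_k(x) of order 1/n), all the other p_k(x) being O(n^-2).
    Let A_(k,k') be the zone of the x with warm index k and hot index k'.  Two
    independent variables with an almost surely constant sum are almost surely
    constant, so |B n A_(k,k')| takes a single value j(k,k') for all but O(1/n)
    of the members B of F_k, with j(k,k') + j(k',k) = m_{k,k'}.  Counting gives
    (1 - O(1/n)) prod_k |F_k| <= 2^n prod 'C(|A_q|, j q), which weighted AM-GM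
    compares with the main term; a strict gap occurs unless j(k,k') or j(k',k)
    vanishes, and this orients the graph.  Finally, an exchange argument puts
    the product families inside F_k, and moving an element from one zone to
    another determines the zone sizes up to a factor 1 + O(1/n). *)

Set Implicit Arguments. Unset Strict Implicit. Unset Printing Implicit Defensive.

(** * Parity of covering multiplicities *)

(** Two scales of smallness carry the argument. Up to a polynomial factor, each [F k] is as large as
    the power set of its hot set, so members avoiding linearly many disjoint bounded subsets of that
    hot set are exponentially rare; such events survive union bounds over sets of bounded size.
    Other events only have probability O(1/n), which is already the precision of the theorem. The
    exchange is the delicate step: the proportion [beta] of missing members may be as small as a
    power of 1/n, so the conflicts caused by adding them must be O(beta/n), not merely O(1/n). They
    are therefore charged to missing members: a small configuration creating conflicts makes a large
    part of its star in the product family missing. A member of a product family is deficient when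
    its trace on a zone is below the maximum; such members accept any further element of that zone.
    Their proportion is about j / |zone|, so moving one element between zones compares these ratios,
    and nearly equal ratios fix the zone sizes. *)

Notation fam l n := {ffun 'I_l -> {set {set 'I_n}}}.

Lemma card_inj_le (T U : finType) (A : {set T}) (B : {set U}) (f : T -> U) :
  {in A &, injective f} -> (forall x, x \in A -> f x \in B) -> #|A| <= #|B|.
Proof.
move=> fI fAB; rewrite -(card_in_imset fI); apply/subset_leq_card/subsetP.
by move=> _ /imsetP[x xA ->]; exact: fAB.
Qed.

Lemma card_small_subsets (X : finType) s :
  #|[set Z : {set X} | #|Z| <= s]| <= #|X|.+1 ^ s.
Proof.
have <- : #|{: {ffun 'I_s -> option X}}| = #|X|.+1 ^ s by rewrite card_ffun card_option card_ord.
pose f (g : {ffun 'I_s -> option X}) := [set x | Some x \in codom g].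
apply: leq_trans (leq_imset_card f predT); apply/subset_leq_card/subsetP => Z.
rewrite inE => Zs; apply/imsetP.
exists [ffun i : 'I_s => nth None [seq Some x | x <- enum Z] i] => //.
apply/setP => x; rewrite inE; apply/idP/codomP => [xZ|[i]].
  have xi : index x (enum Z) < size (enum Z) by rewrite index_mem mem_enum.
  have xs : index x (enum Z) < s by apply: leq_trans Zs; rewrite cardE.
  by exists (Ordinal xs); rewrite ffunE /= (nth_map x) // nth_index // mem_enum.
rewrite ffunE; case: (ltnP i (size (enum Z))) => iZ.
  by rewrite (nth_map x) // => -[->]; rewrite -mem_enum mem_nth.
by rewrite nth_default ?size_map.
Qed.

Section Flip.
Context {T : finType}.
Implicit Types (x : T) (A : {set T}).

Definition flip x A := if x \in A then A :\ x else x |: A.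

Lemma in_flip x A y : (y \in flip x A) = (if y == x then x \notin A else y \in A).
Proof.
by rewrite /flip; case: ifP => xA; rewrite !inE; case: eqVneq => [->|_] //=; rewrite xA.
Qed.

Lemma flipK x : involutive (flip x).
Proof.
move=> A; apply/setP => y; rewrite !in_flip eqxx negbK.
by case: eqVneq => [->|].
Qed.

Lemma setU1_flip x A : x |: flip x A = x |: A.
Proof. by apply/setP => y; rewrite !inE in_flip; case: eqVneq. Qed.

Lemma odd_card_flip x A : odd #|flip x A| = ~~ odd #|A|.
Proof.
rewrite /flip; case: ifP => xA; last by rewrite cardsU1 xA.
by rewrite (cardsD1 x A) xA /= negbK.
Qed.

End Flip.

Definition downset (T : finType) (F : {set {set T}}) :=
  forall A B : {set T}, A \subset B -> B \in F -> A \in F.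

Section Parity.
Variables (l n : nat) (F : fam l n).
Hypothesis Fdown : forall k, downset (F k).
Implicit Types (t : {ffun 'I_l -> {set 'I_n}}) (x : 'I_n).

Definition tuples := [set t : {ffun 'I_l -> {set 'I_n}} | [forall k, t k \in F k]].

Lemma tuplesP t : reflect (forall k, t k \in F k) (t \in tuples).
Proof. by rewrite inE; exact: forallP. Qed.

Lemma card_tuples : #|tuples| = \prod_(k < l) #|F k|.
Proof.
rewrite -(cardsXn (fun k => F k)); apply: eq_card => t; rewrite in_setXn [LHS]inE.
by [].
Qed.

Definition cover_at (t : 'I_l -> {set 'I_n}) x := [set k | x \in t k].

Definition even_on (Z : {set 'I_n}) :=
  [set t in tuples | [forall x in Z, ~~ odd #|cover_at t x|]].

Definition flip_first x t : {ffun 'I_l -> {set 'I_n}} :=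
  if [pick k | x |: t k \in F k] is Some k0
  then [ffun k => if k == k0 then flip x (t k) else t k] else t.

Lemma flip_firstK x : involutive (flip_first x).
Proof.
move=> t; rewrite {1}/flip_first /=.
have -> : [pick k | x |: flip_first x t k \in F k] = [pick k | x |: t k \in F k].
  apply: eq_pick => k; rewrite /flip_first; case: pickP => // k0 _.
  by rewrite ffunE; case: eqP => [->|//]; rewrite setU1_flip.
rewrite /flip_first; case: pickP => // k0 _; apply/ffunP => k; rewrite !ffunE.
by case: eqP => // ->; rewrite flipK.
Qed.

(* The index flipped by [flip_first] depends only on the sets outside [x], and
   it exists as soon as [x] is covered: flipping pairs odd tuples with even ones. *)
Lemma even_on_step (Z : {set 'I_n}) x : x \notin Z ->
  #|even_on Z| <= 2 * #|even_on (x |: Z)|.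
Proof.
move=> xZ; pose O := even_on Z :\: even_on (x |: Z).
have sub : even_on (x |: Z) \subset even_on Z.
  apply/subsetP => t; rewrite !inE => /andP[-> /forall_inP H] /=.
  by apply/forall_inP => y yZ; apply: H; rewrite !inE yZ orbT.
rewrite -(cardsID (even_on (x |: Z)) (even_on Z)) (setIidPr sub) mul2n -addnn leq_add2l.
apply: (card_inj_le (f := flip_first x)); first exact: in2W (inv_inj (flip_firstK x)).
move=> t; rewrite !inE => /andP[H /andP[/forallP tF /forall_inP Zev]].
have xodd : odd #|cover_at t x|.
  apply: contraNT H => xev; apply/andP; split; first exact/forallP.
  by apply/forall_inP => y; rewrite !inE => /orP[/eqP->|/Zev].
rewrite /flip_first; case: pickP => [k0 k0F|none]; last first.
  have [k kc] : exists k, k \in cover_at t x.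
    by apply/set0Pn; apply: contraTneq xodd => ->; rewrite cards0.
  have := none k; rewrite (_ : x |: t k = t k) ?tF //.
  by apply/setUidPr; rewrite sub1set; move: kc; rewrite inE.
apply/andP; split.
  apply/forallP => k; rewrite ffunE; case: eqP => [->|_]; last exact: tF.
  apply: Fdown k0F; rewrite -setU1_flip; exact: subsetUr.
apply/forall_inP => y; rewrite !inE => /orP[/eqP->|yZ].
  rewrite (_ : cover_at _ x = flip k0 (cover_at t x)) ?odd_card_flip ?xodd //.
  apply/setP => k; rewrite in_flip !inE ffunE; case: eqP => // ->.
  by rewrite in_flip eqxx.
rewrite (_ : cover_at _ y = cover_at t y) ?Zev //.
apply/setP => k; rewrite !inE ffunE; case: eqP => // ->; rewrite in_flip.
by case: eqP => // yx; rewrite yx (negPf xZ) in yZ.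
Qed.

(** Evenness is imposed on the elements one after the other, at the cost of a factor 2 each time. *)
Lemma card_tuples_even : #|tuples| <= 2 ^ n * #|even_on setT|.
Proof.
suff H s : uniq s -> #|tuples| <= 2 ^ size s * #|even_on [set x in s]|.
  have := H _ (enum_uniq 'I_n); rewrite size_enum_ord.
  by rewrite (_ : [set x in enum 'I_n] = setT) //; apply/setP => x; rewrite !inE mem_enum.
elim: s => [_|x s IHs /= /andP[xs /IHs H]].
  rewrite mul1n; apply/subset_leq_card/subsetP => t tF; rewrite inE tF /=.
  by apply/forall_inP => x; rewrite inE.
apply: leq_trans H _; rewrite expnSr -mulnA leq_mul2l.
rewrite (_ : [set y in x :: s] = x |: [set y in s]); last by apply/setP => y; rewrite !inE.
by rewrite even_on_step ?orbT // inE.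
Qed.

End Parity.

(** * Polynomial bounds for overlapping tuples and for their stars *)

Section Rough.
Variables (l : nat).
Implicit Types (m : {set 'I_l} -> nat).

Lemma overlapP n m (F : fam l n) :
  reflect (forall k k' : 'I_l, k != k' -> forall A B, A \in F k -> B \in F k' ->
     #|A :&: B| <= m [set k; k']) (overlapping m F).
Proof.
apply: (iffP forallP) => [H k k' kk' A B AF BF|H k].
  by move/forallP: (H k) => /(_ k') /implyP/(_ kk') /forall_inP/(_ A AF) /forall_inP/(_ B BF).
apply/forallP => k'; apply/implyP => kk'; apply/forall_inP => A AF; apply/forall_inP => B BF.
exact: H.
Qed.

(** In an even tuple a covered element is covered at least twice, so it lies in one of the pairwise
    intersections, which have at most [sigma m] elements altogether. The tuple is thus encoded by at
    most [sigma m] pairs of an element and the nonempty set of indices covering it. *)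
Lemma card_even_le n m (F : fam l n) : overlapping m F ->
  #|even_on F setT| <= (n * 2 ^ l).+1 ^ sigma m.
Proof.
move=> /overlapP ov.
pose code (t : {ffun 'I_l -> {set 'I_n}}) :=
  [set p : 'I_n * {set 'I_l} | (p.2 == cover_at t p.1) && (p.2 != set0)].
have -> : n * 2 ^ l = #|{: 'I_n * {set 'I_l}}|.
  by rewrite card_prod card_ord -cardsT -powersetT card_powerset cardsT card_ord.
apply: leq_trans (card_small_subsets _ _).
apply: (card_inj_le (f := code)) => [t u _ _ /setP tu|t].
  apply/ffunP => k; apply/setP => x; apply/idP/idP => xk.
    have := tu (x, cover_at t x); rewrite !inE /= eqxx.
    have -> : cover_at t x != set0 by apply/set0Pn; exists k; rewrite inE.
    by rewrite !andbT => /esym/eqP/setP/(_ k); rewrite !inE xk.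
  have := tu (x, cover_at u x); rewrite !inE /= eqxx.
  have -> : cover_at u x != set0 by apply/set0Pn; exists k; rewrite inE.
  by rewrite !andbT => /eqP/setP/(_ k); rewrite !inE xk.
rewrite !inE => /andP[/forallP tF /forall_inP ev].
pose supp := [set x | cover_at t x != set0].
have -> : #|code t| = #|supp|.
  rewrite -(card_imset (mem supp) (f := fun x => (x, cover_at t x))); last by move=> x y [].
  apply: eq_card => -[x S]; rewrite inE /=; apply/andP/imsetP => [[/eqP -> S0]|[y]].
    by exists x => //; rewrite inE.
  by rewrite inE => H [-> ->].
have sub : supp \subset \bigcup_(S : {set 'I_l} | #|S| == 2) [set x | S \subset cover_at t x].
  apply/subsetP => x; rewrite inE => /set0Pn[k kx].
  have /set0Pn[k'] : cover_at t x :\ k != set0.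
    rewrite -card_gt0; have := ev x (in_setT x); rewrite (cardsD1 k) kx.
    by case: #|_|.
  rewrite !inE => /andP[kk' k'x]; apply/bigcupP; exists [set k; k'].
    by rewrite cards2 [k == _]eq_sym kk'.
  by rewrite inE subUset !sub1set kx inE.
apply: leq_trans (subset_leq_card sub) _.
apply: leq_trans (_ : \sum_(S : {set 'I_l} | #|S| == 2) #|[set x | S \subset cover_at t x]| <= _).
  elim/big_rec2: _ => [|S a B _ IH]; first by rewrite cards0.
  by apply: leq_trans (leq_card_setU _ _) _; rewrite leq_add2l.
apply: leq_sum => S /cards2P[k [k' [kk' ->]]].
apply: leq_trans (ov k k' kk' (t k) (t k') (tF k) (tF k')).
by apply/subset_leq_card/subsetP => x; rewrite !inE subUset !sub1set !inE.
Qed.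

Definition down_closure (T : finType) (A : {set {set T}}) :=
  [set B : {set T} | [exists C in A, B \subset C]].

(** The parity argument needs downsets; passing to down-closures preserves the overlap bounds and
    can only enlarge the families. *)
Lemma prod_card_le n m (F : fam l n) : overlapping m F ->
  \prod_(k < l) #|F k| <= 2 ^ n * (n * 2 ^ l).+1 ^ sigma m.
Proof.
move=> /overlapP ov; pose G : fam l n := [ffun k => down_closure (F k)].
have Gdown k : downset (G k).
  move=> A B AB; rewrite ffunE !inE => /exists_inP[C CF BC].
  by apply/exists_inP; exists C => //; exact: subset_trans BC.
have Gov : overlapping m G.
  apply/overlapP => k k' kk' A B; rewrite !ffunE !inE.
  move=> /exists_inP[A' AF AA'] /exists_inP[B' BF BB'].
  exact: leq_trans (subset_leq_card (setISS AA' BB')) (ov _ _ kk' _ _ AF BF).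
apply: leq_trans (_ : \prod_(k < l) #|G k| <= _).
  apply: leq_prod => k _; apply/subset_leq_card/subsetP => A AF; rewrite ffunE inE.
  by apply/exists_inP; exists A.
rewrite -card_tuples; apply: leq_trans (card_tuples_even Gdown) _.
by rewrite leq_mul2l card_even_le ?orbT.
Qed.

Definition star (T : finType) (A : {set {set T}}) (Y : {set T}) := [set B : {set T} in A | Y \subset B].

Lemma sum_cap_cover n (Y : 'I_l -> {set 'I_n}) :
  \sum_(S : {set 'I_l} | #|S| == 2) #|[set x | S \subset cover_at Y x]|
    = \sum_x 'C(#|cover_at Y x|, 2).
Proof.
transitivity (\sum_(S : {set 'I_l} | #|S| == 2) \sum_x (S \subset cover_at Y x : nat)).
  by apply: eq_bigr => S _; rewrite -sum1dep_card big_mkcond.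
rewrite exchange_big /=; apply: eq_bigr => x _.
rewrite -cards_draws -sum1dep_card [RHS]big_mkcond [LHS]big_mkcond /=.
by apply: eq_bigr => S _; rewrite andbC; case: (#|S| == 2); case: (S \subset _).
Qed.

(** Deleting [Y k] from the members that contain it leaves families whose overlap bounds are smaller
    by [#|Y k :&: Y k'|]. The crude bound then has a smaller exponent, so each coincidence saves a
    factor [n]. *)
Lemma prod_star_le n m (F : fam l n) (Y : 'I_l -> {set 'I_n}) (e : nat) :
  overlapping m F -> 0 < n -> e <= \sum_x 'C(#|cover_at Y x|, 2) ->
  (\prod_(k < l) #|star (F k) (Y k)|) * n ^ e <= 2 ^ n * (n * 2 ^ l.+1) ^ sigma m.
Proof.
move=> /overlapP ov n0; rewrite -sum_cap_cover => He.
(* If the product is nonzero, every star has a member; this gives [c S <= m S], which makes the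
   natural-number subtraction in [Gov] exact. *)
have [->|P0] := posnP (\prod_(k < l) #|star (F k) (Y k)|); first by [].
have ex k : exists B, B \in star (F k) (Y k).
  apply/set0Pn; rewrite -card_gt0; apply: contraTT P0; rewrite -!leqNgt !leqn0.
  by move=> H; rewrite (bigD1 k) //= (eqP H).
pose c (S : {set 'I_l}) := #|[set x | S \subset cover_at Y x]|.
have cE (k k' : 'I_l) : c [set k; k'] = #|Y k :&: Y k'|.
  by apply: eq_card => x; rewrite !inE subUset !sub1set !inE.
have cm (S : {set 'I_l}) : #|S| == 2 -> c S <= m S.
  move=> /cards2P[k [k' [kk' ->]]]; rewrite cE.
  have [B] := ex k; have [B'] := ex k'; rewrite !inE => /andP[BF' YB'] /andP[BF YB].
  exact: leq_trans (subset_leq_card (setISS YB YB')) (ov _ _ kk' _ _ BF BF').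
pose G : fam l n := [ffun k => [set B :\: Y k | B in star (F k) (Y k)]].
have Gov : overlapping (fun S => m S - c S) G.
  apply/overlapP => k k' kk' A A'; rewrite !ffunE.
  move=> /imsetP[B + ->] /imsetP[B' + ->]; rewrite !inE => /andP[BF YB] /andP[BF' YB'].
  rewrite leq_subRL ?cm ?cards2 ?kk' // cE; apply: leq_trans (ov _ _ kk' _ _ BF BF').
  rewrite -leq_subRL ?(subset_leq_card (setISS YB YB')) // -cardsDS ?setISS //.
  apply/subset_leq_card/subsetP => x; rewrite !inE => /and3P[/andP[a b] c' d].
  by rewrite b d (negPf a).
have cardG k : #|G k| = #|star (F k) (Y k)|.
  rewrite ffunE card_in_imset // => B B'; rewrite !inE => /andP[_ YB] /andP[_ YB'].
  by move=> E; rewrite -(setID B (Y k)) -(setID B' (Y k)) E (setIidPr YB) (setIidPr YB').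
have -> : \prod_(k < l) #|star (F k) (Y k)| = \prod_(k < l) #|G k|.
  by apply: eq_bigr => k _; rewrite cardG.
have sE : sigma (fun S => m S - c S) + \sum_(S : {set 'I_l} | #|S| == 2) c S = sigma m.
  by rewrite /sigma -big_split /=; apply: eq_bigr => S /cm ?; rewrite subnK.
apply: leq_trans (leq_mul (prod_card_le Gov) (leq_pexp2l n0 He)) _.
rewrite -mulnA leq_mul2l -sE expnD orbC; apply/orP; left; apply: leq_mul.
  case: (sigma _) => [//|s]; rewrite leq_exp2r //.
  by rewrite expnS [2 * _]mulnC mulnA muln2 -addnn -addn1 leq_add2l muln_gt0 n0 expn_gt0.
case: (\sum_(_ | _) _) => [//|s]; rewrite leq_exp2r //.
by rewrite -{1}[n]muln1 leq_mul2l expn_gt0 orbT.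
Qed.

End Rough.

Local Open Scope ring_scope.

(** * Proportions in an extremal tuple; hot indices *)

Section Proportion.
Context {X : finType}.
Implicit Types (A : {set X}) (Q : pred X).

Definition pr A Q : rat := #|[set B in A | Q B]|%:R / #|A|%:R.

Lemma pr_ge0 A Q : 0 <= pr A Q.
Proof. exact: divr_ge0. Qed.

Lemma pr_mul A Q : pr A Q * #|A|%:R = #|[set B in A | Q B]|%:R.
Proof.
rewrite /pr; have [->|A0] := eqVneq A set0.
  by rewrite cards0 mulr0 (_ : [set _ in _ | _] = set0) ?cards0 //; apply/setP => x; rewrite !inE.
by rewrite divfK // pnatr_eq0 cards_eq0.
Qed.

Lemma pr_sub A Q Q' : (forall B, B \in A -> Q B -> Q' B) -> pr A Q <= pr A Q'.
Proof.
move=> H; rewrite ler_wpM2r ?invr_ge0 // ler_nat; apply/subset_leq_card/subsetP => B.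
by rewrite !inE => /andP[BA /(H _ BA) ->]; rewrite BA.
Qed.

Lemma eq_pr A Q Q' : (forall B, B \in A -> Q B = Q' B) -> pr A Q = pr A Q'.
Proof. by move=> H; apply/eqP; rewrite eq_le !pr_sub // => B BA; rewrite H. Qed.

Lemma pr_le1 A Q : pr A Q <= 1.
Proof.
have [->|A0] := eqVneq A set0; first by rewrite /pr cards0 invr0 mulr0.
rewrite ler_pdivrMr ?mul1r ?ler_nat ?ltr0n ?card_gt0 //.
by apply/subset_leq_card/subsetP => B; rewrite inE => /andP[].
Qed.

Lemma pr_or A Q Q' : pr A (fun B => Q B || Q' B) <= pr A Q + pr A Q'.
Proof.
rewrite /pr -mulrDl ler_wpM2r ?invr_ge0 // -natrD ler_nat.
apply: leq_trans (leq_card_setU _ _); apply/subset_leq_card/subsetP => B.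
by rewrite !inE => /andP[-> /=].
Qed.

Lemma pr0 A : pr A pred0 = 0.
Proof.
rewrite /pr (_ : [set _ in _ | _] = set0) ?cards0 ?mul0r //.
by apply/setP => x; rewrite !inE andbF.
Qed.

Lemma pr_exists (J : finType) (Z : pred J) A (Q : J -> pred X) :
  pr A (fun B => [exists j, Z j && Q j B]) <= \sum_(j | Z j) pr A (Q j).
Proof.
rewrite /pr -mulr_suml ler_wpM2r ?invr_ge0 // -natr_sum ler_nat.
apply: leq_trans (_ : (#|\bigcup_(j | Z j) [set B in A | Q j B]| <= _)%N).
  apply/subset_leq_card/subsetP => B; rewrite inE => /andP[BA /existsP[j /andP[jZ jB]]].
  by apply/bigcupP; exists j => //; rewrite inE BA.
elim/big_rec2: _ => [|j a C _ IH]; first by rewrite cards0.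
by apply: leq_trans (leq_card_setU _ _) _; rewrite leq_add2l.
Qed.

Lemma prC A Q : A != set0 -> pr A (fun B => ~~ Q B) = 1 - pr A Q.
Proof.
move=> A0; apply/eqP; rewrite eq_sym subr_eq eq_sym /pr -mulrDl -natrD addnC.
rewrite (_ : (#|_| + #|_|)%N = #|A|) ?divff ?pnatr_eq0 ?cards_eq0 //.
rewrite -(cardsID [set B | Q B] A); congr (_ + _)%N; apply: eq_card => B; rewrite !inE //.
exact: andbC.
Qed.

Lemma pr_gt0_ex A Q : 0 < pr A Q -> exists2 B, B \in A & Q B.
Proof.
move=> H; have /set0Pn[B] : [set B in A | Q B] != set0.
  by apply: contraTneq H => E; rewrite /pr E cards0 mul0r ltxx.
by rewrite inE => /andP[BA QB]; exists B.
Qed.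

Lemma pr_gt0 A Q B : B \in A -> Q B -> 0 < pr A Q.
Proof.
move=> BA QB; apply: divr_gt0; rewrite ltr0n card_gt0; apply/set0Pn; exists B => //.
by rewrite inE BA.
Qed.

Lemma pr_lt1_ex A Q : A != set0 -> pr A Q < 1 -> exists2 B, B \in A & ~~ Q B.
Proof. by move=> A0 H; apply: pr_gt0_ex; rewrite prC // subr_gt0. Qed.

Lemma pr_le_card A Q Q' (c : nat) :
  (#|[set B in A | Q B]| <= c * #|[set B in A | Q' B]|)%N -> pr A Q <= c%:R * pr A Q'.
Proof. by move=> H; rewrite /pr mulrA ler_wpM2r ?invr_ge0 // -natrM ler_nat. Qed.

End Proportion.

(** The Weierstrass product inequality; the induction also carries that the product stays in
    [0,1]. *)
Lemma prod_1sub (I : finType) (P : pred I) (p : I -> rat) :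
  (forall i, P i -> 0 <= p i <= 1) -> 1 - \sum_(i | P i) p i <= \prod_(i | P i) (1 - p i).
Proof.
move=> p01; suff: 0 <= \prod_(i | P i) (1 - p i) <= 1 /\
   1 - \sum_(i | P i) p i <= \prod_(i | P i) (1 - p i) by case.
elim/big_rec2: _ => [|i a b Pi [IH1 IH2]]; first by rewrite subr0 ler01 lexx.
move/andP: (p01 i Pi) IH1 => [p0 p1] /andP[b0 b1]; split; nra.
Qed.

(** [B] is recovered from [B :|: U] and [B :&: U], so adjoining [U] is at most [2 ^ #|U|]-to-one. *)
Lemma card_setU_preim (T : finType) (A : {set {set T}}) (Q : pred {set T}) (U : {set T}) :
  (#|[set B in A | (B :|: U \in A) && Q (B :|: U)]| <= 2 ^ #|U| * #|[set B in A | Q B]|)%N.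
Proof.
rewrite mulnC -card_powerset -cardsX.
apply: (card_inj_le (f := fun B => (B :|: U, B :&: U))) => [B C _ _ [E1 E2]|B].
  apply/setP => x; move/setP: E1 => /(_ x); move/setP: E2 => /(_ x); rewrite !inE.
  by case: (x \in U); rewrite ?andbT ?andbF ?orbF.
by rewrite !inE => /and3P[_ -> ->]; rewrite subsetIr.
Qed.

Lemma le_sigma (l : nat) (m : {set 'I_l} -> nat) (S : {set 'I_l}) :
  #|S| == 2 -> (m S <= sigma m)%N.
Proof. by move=> S2; rewrite /sigma (bigD1 S) //= leq_addr. Qed.

Section Extremal.
Variables (l n : nat) (m : {set 'I_l} -> nat) (F : fam l n).
Hypothesis ext : extremal m F.

Lemma ext_overlap (k k' : 'I_l) A B : k != k' -> A \in F k -> B \in F k' ->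
  (#|A :&: B| <= m [set k; k'])%N.
Proof. by move=> kk' AF BF; case: ext => /overlapP ov _; exact: ov. Qed.

Lemma ext_max (G : fam l n) :
  overlapping m G -> (\prod_(k < l) #|G k| <= \prod_(k < l) #|F k|)%N.
Proof. by move=> ov; case: ext => _ ->; exact: (leq_bigmax_cond (F := fun G : fam l n => \prod_(k < l) #|G k|)%N). Qed.

Lemma ext_card_gt0 k : (0 < #|F k|)%N.
Proof.
pose G : fam l n := [ffun _ => [set set0]].
have Gov : overlapping m G.
  apply/overlapP => j j' _ A B; rewrite !ffunE !inE => /eqP -> _.
  by rewrite set0I cards0.
have : (0 < \prod_(k < l) #|F k|)%N.
  apply: leq_trans (ext_max Gov); apply: prodn_gt0 => j; by rewrite ffunE cards1.
by rewrite (bigD1 k) //= muln_gt0 => /andP[].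
Qed.

Lemma ext_neq0 k : F k != set0.
Proof. by rewrite -card_gt0 ext_card_gt0. Qed.

(** Otherwise adding [B] to [F k] would strictly increase the product, the other factors being
    positive. *)
Lemma ext_add k B :
  (forall k' C, k' != k -> C \in F k' -> (#|B :&: C| <= m [set k; k'])%N) -> B \in F k.
Proof.
move=> H; apply/negPn/negP => BF.
pose G : fam l n := [ffun j => if j == k then B |: F j else F j].
have Gov : overlapping m G.
  apply/overlapP => j j' jj' A C; rewrite !ffunE.
  case: (eqVneq j k) => [jk|jk]; case: (eqVneq j' k) => [j'k|j'k].
  - by move: jj'; rewrite jk j'k eqxx.
  - rewrite jk !inE => /orP[/eqP -> CF|AF CF]; first exact: H.
    by apply: ext_overlap => //; rewrite eq_sym.
  - rewrite j'k !inE => AF /orP[/eqP ->|CF]; last exact: ext_overlap.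
    by rewrite setIC setUC; exact: H.
  - exact: ext_overlap.
have := ext_max Gov; apply/negP; rewrite -ltnNge.
rewrite (bigD1 k) //= [X in (_ < X)%N](bigD1 k) //= ffunE eqxx cardsU1 BF.
have -> : (\prod_(j < l | j != k) #|G j| = \prod_(j < l | j != k) #|F j|)%N.
  by apply: eq_bigr => j /negPf jk; rewrite ffunE jk.
by rewrite ltn_pmul2r // prodn_cond_gt0 // => j _; exact: ext_card_gt0.
Qed.

Lemma ext_down k : downset (F k).
Proof.
move=> A B AB BF; apply: ext_add => k' C kk' CF.
apply: leq_trans (ext_overlap _ BF CF); last by rewrite eq_sym.
exact: subset_leq_card (setSI _ AB).
Qed.

Lemma ext_prod (G : fam l n) : overlapping m G ->
  \prod_(k < l) (#|G k|%:R / #|F k|%:R) <= 1 :> rat.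
Proof.
move=> /ext_max H; rewrite big_split /= prodfV -!natr_prod ler_pdivrMr ?mul1r ?ler_nat //.
by rewrite ltr0n prodn_gt0 // => k; exact: ext_card_gt0.
Qed.

Definition p k x := pr (F k) (fun B => x \in B).
Notation eps := (n%:R^-1 : rat).

(** Deleting [x] maps the members containing it injectively to members that avoid [x] and accept it;
    the members rejecting [x] come on top of these. *)
Lemma card_in_notin k x :
  (#|[set B in F k | x \in B]| + #|[set B in F k | x |: B \notin F k]| <=
   #|[set B in F k | x \notin B]|)%N.
Proof.
rewrite -[X in (_ <= X)%N](cardsID [set B | x |: B \notin F k]) addnC; apply: leq_add.
  apply/subset_leq_card/subsetP => B; rewrite !inE => /andP[BF xB]; rewrite BF xB !andbT.
  by apply: contraNN xB => xB; rewrite (setUidPr _) // sub1set.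
apply: (card_inj_le (f := fun B => B :\ x)) => [B C|B].
  by rewrite !inE => /andP[_ xB] /andP[_ xC] E; rewrite -(setD1K xB) -(setD1K xC) E.
rewrite !inE eqxx negbK /= => /andP[BF xB]; rewrite setD1K // BF andbT.
by apply: ext_down BF; rewrite subsetDl.
Qed.

Lemma p_notin k x : pr (F k) (fun B => x \notin B) = 1 - p k x.
Proof. by rewrite prC // ext_neq0. Qed.

Lemma p_le_half k x : p k x <= 1/2.
Proof.
have : p k x <= pr (F k) (fun B => x \notin B).
  rewrite ler_wpM2r ?invr_ge0 // ler_nat; apply: leq_trans (card_in_notin k x).
  exact: leq_addr.
by rewrite p_notin; lra.
Qed.

(** For hot [x] the right-hand side is O(1/n): almost every member of the hot family remains a
    member when [x] is added. *)
Lemma not_full1 k x : pr (F k) (fun B => x |: B \notin F k) <= 1 - 2 * p k x.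
Proof.
have : p k x + pr (F k) (fun B => x |: B \notin F k) <= pr (F k) (fun B => x \notin B).
  by rewrite /p /pr -mulrDl ler_wpM2r ?invr_ge0 // -natrD ler_nat card_in_notin.
by rewrite p_notin; lra.
Qed.

(* Removing [x] from all the sets and then adding it freely to one family. *)
Lemma prod_notin_le_half x : (0 < l)%N -> \prod_(k < l) (1 - p k x) <= 1/2.
Proof.
move=> l0; pose k0 := Ordinal l0.
pose G : fam l n := [ffun k => if k == k0 then [set B | B :\ x \in F k]
                               else [set B in F k | x \notin B]].
have Gov : overlapping m G.
  apply/overlapP => j j' jj' A C; rewrite !ffunE.
  case: (eqVneq j k0) => [jk|jk]; case: (eqVneq j' k0) => [j'k|j'k].
  - by move: jj'; rewrite jk j'k eqxx.
  - rewrite !inE => AF /andP[CF xC]; apply: leq_trans (ext_overlap jj' AF CF).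
    apply/subset_leq_card/subsetP => y; rewrite !inE; case: eqP => [->|_] //=.
    by rewrite (negPf xC) andbF.
  - rewrite !inE => /andP[AF xA] CF; apply: leq_trans (ext_overlap jj' AF CF).
    apply/subset_leq_card/subsetP => y; rewrite !inE; case: eqP => [->|_] //=.
    by rewrite (negPf xA).
  - by rewrite !inE => /andP[AF _] /andP[CF _]; exact: ext_overlap.
have := ext_prod Gov; rewrite (bigD1 k0) //= [in X in _ -> X](bigD1 k0) //=.
rewrite (eq_bigr (fun k => 1 - p k x)); last first.
  by move=> k /negPf kk0; rewrite ffunE kk0 -p_notin.
have : 2 * (1 - p k0 x) <= #|G k0|%:R / #|F k0|%:R.
  rewrite -p_notin /pr mulrA ler_wpM2r ?invr_ge0 // -natrM ler_nat ffunE eqxx mul2n -addnn.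
  rewrite -[X in (_ <= X)%N](cardsID [set B : {set 'I_n} | x \in B]); apply: leq_add.
    apply: (card_inj_le (f := fun B => x |: B)) => [B C|B].
      by rewrite !inE => /andP[_ xB] /andP[_ xC] E; rewrite -(setU1K xB) -(setU1K xC) E.
    by rewrite !inE eqxx andbT => /andP[BF xB]; rewrite setU1K.
  apply/subset_leq_card/subsetP => B; rewrite !inE => /andP[BF xB]; rewrite xB /=.
  by apply: ext_down BF; rewrite subsetDl.
have : 0 <= \prod_(i < l | i != k0) (1 - p i x).
  by apply: prodr_ge0 => k _; have := p_le_half k x; lra.
set a := \prod_(_ < _ | _) _; set b := 1 - p k0 x; set c := _ / _ => a0 bc ca.
nra.
Qed.

Variables (C1 : rat).
Hypothesis l0 : (0 < l)%N.
Hypothesis C1_ge0 : 0 <= C1.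
Hypothesis star_bound : forall (Y : 'I_l -> {set 'I_n}) e,
  (e <= \sum_x 'C(#|cover_at Y x|, 2))%N ->
  \prod_(k < l) pr (F k) (fun B => Y k \subset B) <= C1 * eps ^+ e.

Lemma pr_set0 k : pr (F k) (fun B => set0 \subset B) = 1.
Proof.
rewrite /pr (_ : [set _ in _ | _] = F k) ?divff ?pnatr_eq0 ?cards_eq0 ?ext_neq0 //.
by apply/setP => B; rewrite inE sub0set andbT.
Qed.

(** The star bound for [Y k = [set x]] when [k] is in [K], and empty otherwise; all coincidences
    occur at [x]. *)
Lemma prod_p_le (K : {set 'I_l}) x : \prod_(k in K) p k x <= C1 * eps ^+ 'C(#|K|, 2).
Proof.
pose Y k := if k \in K then [set x] else set0.
have cx : cover_at Y x = K.
  by apply/setP => k; rewrite !inE /Y; case: ifP; rewrite !inE ?eqxx.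
have := @star_bound Y 'C(#|K|, 2); rewrite (bigID (mem K)) /= [X in _ * X]big1 => [|k kK].
  rewrite mulr1 (eq_bigr (fun k => p k x)) => [|k kK].
    by apply; rewrite (bigD1 x) //= cx leq_addr.
  by rewrite /Y kK; apply: eq_pr => B _; rewrite sub1set.
by rewrite /Y (negPf kK) pr_set0.
Qed.

Lemma pp_le k k' x : k != k' -> p k x * p k' x <= C1 * eps.
Proof.
move=> kk'; have := prod_p_le [set k; k'] x.
rewrite cards2 kk' expr1 (big_setD1 k) ?inE ?eqxx //= (_ : _ :\ k = [set k']) ?big_set1 //.
by apply/setP => j; rewrite !inE; case: eqVneq => // ->; rewrite (negPf kk').
Qed.

Lemma ppp_le k k' k'' x : k != k' -> k != k'' -> k' != k'' ->
  p k x * p k' x * p k'' x <= C1 * eps ^+ 3.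
Proof.
move=> kk' kk'' k'k''; have := prod_p_le (k |: [set k'; k'']) x.
rewrite cardsU1 cards2 k'k'' !inE negb_or kk' kk'' /= (big_setD1 k) ?inE ?eqxx //=.
rewrite (_ : _ :\ k = [set k'; k'']) => [|]; last first.
  by apply/setP => j; rewrite !inE; case: eqVneq => // ->; rewrite (negPf kk') (negPf kk'').
rewrite (big_setD1 k') ?inE ?eqxx //= (_ : _ :\ k' = [set k'']) ?big_set1 ?mulrA //.
by apply/setP => j; rewrite !inE; case: eqVneq => // ->; rewrite (negPf k'k'').
Qed.

Lemma eps_ge0 : 0 <= eps.
Proof. by rewrite invr_ge0. Qed.

(** The factor [2 * l] inverts the pigeonhole lower bound [1 / (2 * l)] for the hot index; the other
    factor [l] pays for the sum over the remaining indices. *)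
Let C2 : rat := 2 * l%:R ^+ 2 * C1.

(** By [prod_notin_le_half] the [p k x] sum to at least 1/2, so one of them is at least
    [1 / (2 * l)], and [pp_le] makes the others O(1/n). Feeding this back into the product
    inequality lifts the large one to nearly 1/2. *)
Lemma exists_hot : exists kappa : 'I_n -> 'I_l, forall x,
  1/2 - C2 * eps <= p (kappa x) x /\ forall k, k != kappa x -> p k x <= C2 * eps.
Proof.
apply: (@fin_all_exists 'I_n (fun _ => 'I_l) (fun x kx =>
  1/2 - C2 * eps <= p kx x /\ forall k, k != kx -> p k x <= C2 * eps)) => x.
have e0 := eps_ge0; have l1 : 1 <= l%:R :> rat by rewrite ler1n.
have [k pk] : exists k, 1 / (2 * l%:R) <= p k x.
  apply/existsP; apply: contraLR (prod_notin_le_half x l0).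
  rewrite negb_exists -ltNge => /forallP H.
  apply: lt_le_trans (prod_1sub _) => [|i _]; last first.
    by rewrite pr_ge0 pr_le1.
  suff : \sum_(i < l) p i x < 1/2 by lra.
  have -> : 1/2 = \sum_(i < l) (1 / (2 * l%:R)) :> rat.
    rewrite sumr_const card_ord -mulr_natr; field.
    by rewrite pnatr_eq0 -lt0n.
  apply: ltr_sum => [|i _]; first by apply/hasP; exists (Ordinal l0); rewrite ?mem_index_enum.
  by rewrite ltNge H.
have small k' : k' != k -> p k' x <= 2 * l%:R * C1 * eps.
  move=> kk'; have := pp_le x kk'.
  rewrite ler_pdivrMr ?mulr_gt0 ?ltr0n // in pk.
  have : 0 <= p k' x by exact: pr_ge0.
  set a := p k' x in kk' *; set b := p k x in pk *; set L := l%:R in l1 pk * => a0 H.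
  have : a <= a * (b * (2 * L)) by rewrite ler_peMr.
  have : a * b * (2 * L) <= C1 * eps * (2 * L) by rewrite ler_wpM2r // mulr_ge0 //; lra.
  by rewrite !mulrA; lra.
have lC : 2 * l%:R * C1 * eps <= C2 * eps.
  rewrite /C2 ler_wpM2r // ler_wpM2r // expr2 !mulrA ler_peMr //; lra.
exists k; split; last by move=> k' /small H; exact: le_trans lC.
have := prod_notin_le_half x l0; rewrite (bigD1 k) //=.
have := @prod_1sub _ (fun i => i != k) (fun i : 'I_l => p i x).
move=> /(_ (fun i _ => introT andP (conj (pr_ge0 _ _) (pr_le1 _ _)))).
have : \sum_(i < l | i != k) p i x <= C2 * eps.
  apply: le_trans (_ : \sum_(i < l | i != k) 2 * l%:R * C1 * eps <= _).
    by apply: ler_sum => i; exact: small.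
  apply: le_trans (_ : \sum_(i < l) 2 * l%:R * C1 * eps <= _).
    rewrite [X in _ <= X](bigD1 k) //= lerDr !mulr_ge0 //.
  by rewrite sumr_const card_ord -mulr_natr /C2 expr2 le_eqVlt; apply/orP; left; apply/eqP; ring.
have := p_le_half k x; have : 0 <= p k x by exact: pr_ge0.
have : 0 <= C2 * eps by rewrite /C2 !mulr_ge0 ?exprn_ge0.
set a := \sum_(_ < _ | _) _; set b := \prod_(_ < _ | _) _; nra.
Qed.

End Extremal.

(** * Random tuples *)

Section OrderedPairs.
Variables (l : nat) (R : Type) (idx : R) (op : Monoid.com_law idx).

Lemma big_ordered_pairs (g : 'I_l * 'I_l -> R) :
  \big[op/idx]_(q : 'I_l * 'I_l | q.1 != q.2) g q =
  \big[op/idx]_(S : {set 'I_l} | #|S| == 2)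
     \big[op/idx]_(q : 'I_l * 'I_l | (q.1 != q.2) && ([set q.1; q.2] == S)) g q.
Proof.
by apply: partition_big => q; rewrite cards2 => ->.
Qed.

Lemma big_two_orders (g : 'I_l * 'I_l -> R) (k k' : 'I_l) : k != k' ->
  \big[op/idx]_(q : 'I_l * 'I_l | (q.1 != q.2) && ([set q.1; q.2] == [set k; k'])) g q
   = op (g (k, k')) (g (k', k)).
Proof.
move=> kk'; have k'k : k' != k by rewrite eq_sym.
rewrite (bigD1 (k, k')) /= ?kk' ?eqxx //; congr (op _ _).
rewrite (big_pred1 (k', k)) // => -[a b] /=; rewrite !xpair_eqE.
apply/idP/idP => [/andP[/andP[ab /eqP E] nab]|/andP[/eqP -> /eqP ->]]; last first.
  by rewrite k'k setUC eqxx (negPf kk') andbF.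
have : a \in [set k; k'] by rewrite -E !inE eqxx.
have : b \in [set k; k'] by rewrite -E !inE eqxx orbT.
rewrite !inE => /orP[] /eqP Eb /orP[] /eqP Ea; subst a b; rewrite ?eqxx //.
- by rewrite eqxx in ab.
- by rewrite !eqxx in nab.
- by rewrite eqxx in ab.
Qed.

End OrderedPairs.

Section Tuples.
Variables (l n : nat) (F : fam l n).
Hypothesis F0 : forall k, F k != set0.
Local Notation tuple := {ffun 'I_l -> {set 'I_n}}.
Implicit Types (t : tuple) (k : 'I_l) (B : {set 'I_n}).

Definition upd t k B : tuple := [ffun j => if j == k then B else t j].

Lemma upd_same t k B : upd t k B k = B. Proof. by rewrite ffunE eqxx. Qed.

Lemma upd_other t k B j : j != k -> upd t k B j = t j.
Proof. by rewrite ffunE => /negPf ->. Qed.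

Lemma upd_in_tuples t k B : t \in tuples F -> (upd t k B \in tuples F) = (B \in F k).
Proof.
move=> /tuplesP tF; apply/tuplesP/idP => [/(_ k)|BF j]; first by rewrite upd_same.
by have [->|jk] := eqVneq j k; rewrite ?upd_same ?upd_other.
Qed.

Lemma tuples_neq0 : tuples F != set0.
Proof.
have /fin_all_exists[t tF] : forall k, exists B, B \in F k by move=> k; apply/set0Pn.
by apply/set0Pn; exists [ffun k => t k]; apply/tuplesP => k; rewrite ffunE.
Qed.

(* Resampling one coordinate preserves the uniform measure on tuples. *)
Lemma sum_pr_upd k (Q : pred tuple) :
  \sum_(t in tuples F) pr (F k) (fun B => Q (upd t k B)) =
  #|[set t in tuples F | Q t]|%:R.
Proof.
pose swap (tB : tuple * {set 'I_n}) := (upd tB.1 k tB.2, tB.1 k).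
have swapK : involutive swap.
  move=> [t B]; rewrite /swap /= upd_same; congr (_, _).
  by apply/ffunP => j; rewrite !ffunE; case: eqP => [->|].
have fk0 : #|F k|%:R != 0 :> rat by rewrite pnatr_eq0 cards_eq0.
apply: (mulIf fk0); rewrite mulr_suml.
under eq_bigr do rewrite pr_mul -sum1dep_card natr_sum.
rewrite pair_big_dep /= (reindex_inj (inv_inj swapK)) /=.
rewrite (eq_bigl (fun tB : tuple * {set 'I_n} =>
    (tB.1 \in tuples F) && Q tB.1 && (tB.2 \in F k))) => [|[t B]] /=.
  rewrite -(pair_big_dep (fun t => (t \in tuples F) && Q t) (fun _ B => B \in F k)
                         (fun _ _ => 1)) /=.
  under eq_bigr do rewrite sumr_const.
  by rewrite -natr_sum sum_nat_cond_const natrM.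
have E : upd (upd t k B) k (t k) = t.
  by apply/ffunP => j; rewrite !ffunE; case: eqP => [->|].
rewrite E; apply/and3P/andP => [[a b c]|[/andP[a b] c]].
  have tF : t \in tuples F by rewrite -E upd_in_tuples.
  by rewrite tF c; move/tuplesP: a => /(_ k); rewrite upd_same.
by split=> //; [rewrite upd_in_tuples | move/tuplesP: a].
Qed.

Lemma pr_tuples_le k (Q : pred tuple) d :
  (forall t, t \in tuples F -> pr (F k) (fun B => Q (upd t k B)) <= d) ->
  pr (tuples F) Q <= d.
Proof.
move=> H; rewrite /pr ler_pdivrMr ?ltr0n ?card_gt0 ?tuples_neq0 //.
rewrite -(sum_pr_upd k); apply: le_trans (_ : \sum_(t in tuples F) d <= _); first exact: ler_sum.
by rewrite sumr_const mulr_natr.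
Qed.

Lemma pr_tuples_ge k (Q : pred tuple) d :
  (forall t, t \in tuples F -> d <= pr (F k) (fun B => Q (upd t k B))) ->
  d <= pr (tuples F) Q.
Proof.
move=> H; rewrite /pr ler_pdivlMr ?ltr0n ?card_gt0 ?tuples_neq0 //.
rewrite -(sum_pr_upd k); apply: le_trans (_ : \sum_(t in tuples F) d <= _); last exact: ler_sum.
by rewrite sumr_const mulr_natr.
Qed.

Lemma pr_tuples_marginal k (Q : pred {set 'I_n}) :
  pr (tuples F) (fun t => Q (t k)) = pr (F k) Q.
Proof.
by apply/eqP; rewrite eq_le (pr_tuples_le (k := k)) ?(pr_tuples_ge (k := k)) // => t _;
  apply: pr_sub => B _; rewrite upd_same.
Qed.

End Tuples.

(** By disjointness, adding [U] to a set that avoids the other members of the list keeps it avoiding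
    them. Hence a proportion at least [2 ^- w] of the sets avoiding the others contains [U], and
    each [U] removes that proportion. *)
Lemma card_avoid (T : finType) (H : {set T}) (Us : seq {set T}) w :
  (forall U, U \in Us -> U \subset H /\ (#|U| <= w)%N) ->
  pairwise (fun U V : {set T} => [disjoint U & V]) Us ->
  #|[set B : {set T} | (B \subset H) && all (fun U : {set T} => ~~ (U \subset B)) Us]|%:R
    <= 2 ^+ #|H| * (1 - 2 ^- w) ^+ size Us :> rat.
Proof.
elim: Us => [_ _|U Us IH HU /= /andP[/allP dU pU]].
  rewrite mulr1 -natrX ler_nat -card_powerset; apply/subset_leq_card/subsetP => B.
  by rewrite !inE => /andP[].
pose A := [set B : {set T} | (B \subset H) && all (fun U : {set T} => ~~ (U \subset B)) Us].
rewrite -/A in IH.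
have [UH Uw] := HU U (mem_head _ _).
have AU B : B \in A -> B :|: U \in A.
  rewrite !inE => /andP[BH /allP Ball]; rewrite subUset BH UH /=; apply/allP => V VUs.
  apply: contra (Ball V VUs) => /subsetP VB; apply/subsetP => x xV.
  move: (VB x xV); rewrite inE => /orP[//|xU].
  by have /pred0P/(_ x) := dU V VUs; rewrite /= xU xV.
have w0 : 0 < 2 ^- w :> rat by rewrite invr_gt0 exprn_gt0.
have w1 : 2 ^- w <= 1 :> rat by rewrite invf_le1 ?exprn_gt0 // exprn_ege1.
have up : #|A|%:R <= 2 ^+ w * #|[set B in A | U \subset B]|%:R :> rat.
  rewrite -natrX -natrM ler_nat; apply: leq_trans (_ : 2 ^ #|U| * #|[set B in A | U \subset B]| <= _)%N; last first.
    by rewrite leq_mul2r leq_exp2l // Uw orbT.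
  apply: leq_trans (card_setU_preim A _ U); apply/subset_leq_card/subsetP => B BA.
  by rewrite in_set BA AU //= subsetUr.
have -> : [set B : {set T} | (B \subset H) && (~~ (U \subset B) && all (fun V : {set T} => ~~ (V \subset B)) Us)]
    = A :\: [set B in A | U \subset B].
  by apply/setP => B; rewrite !inE; case: (B \subset H); case: (U \subset B); case: (all _ _).
have [IHA p1] : #|A|%:R <= 2 ^+ #|H| * (1 - 2 ^- w) ^+ size Us :> rat /\ true.
  by split=> //; apply: IH pU => V VUs; apply: HU; rewrite inE VUs orbT.
have -> : #|A :\: [set B in A | U \subset B]|%:R = #|A|%:R - #|[set B in A | U \subset B]|%:R :> rat.
  rewrite cardsDS ?natrB //; first by apply/subset_leq_card/subsetP => B; rewrite inE => /andP[].
  by apply/subsetP => B; rewrite inE => /andP[].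
rewrite exprSr mulrA; apply: le_trans (_ : #|A|%:R * (1 - 2 ^- w) <= _); last first.
  by rewrite ler_wpM2r // subr_ge0.
rewrite mulrBr mulr1 lerD2l lerN2 -[_ * _]/(#|A|%:R / 2 ^+ w) ler_pdivrMr ?exprn_gt0 //.
by rewrite mulrC; exact: up.
Qed.

(** * Intersections with the hot sets *)

Lemma sum_other_le (l : nat) (m : {set 'I_l} -> nat) k :
  (\sum_(k' < l | k' != k) m [set k; k'] <= sigma m)%N.
Proof.
have inj : {in [set k' | k' != k] &, injective (fun k' => [set k; k'])}.
  move=> a b; rewrite !inE => ak bk /setP/(_ a); rewrite !inE eqxx orbT (negPf ak) /=.
  by move=> /esym/eqP.
rewrite -(eq_bigl _ _ (fun k' => in_set (fun k' => k' != k) k')) -(big_imset m inj) /=.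
rewrite /sigma [X in (_ <= X)%N](bigID (mem [set [set k; k'] | k' in [set k' | k' != k]])) /=.
rewrite [X in (_ <= X + _)%N](eq_bigl (mem [set [set k; k'] | k' in [set k' | k' != k]])).
  exact: leq_addr.
move=> S; rewrite /= andbC; case: imsetP => // -[k' + ->]; rewrite inE => k'k.
by rewrite cards2 [k == _]eq_sym k'k.
Qed.

Section Hot.
Variables (l n : nat) (m : {set 'I_l} -> nat) (F : fam l n).
Hypothesis ext : extremal m F.
Notation eps := (n%:R^-1 : rat).
Variables (kappa : 'I_n -> 'I_l) (C0 C2 : rat).
Hypothesis n0 : (0 < n)%N.
Hypothesis C0_ge0 : 0 <= C0.
Hypothesis C2_ge0 : 0 <= C2.
Hypothesis hot_ge : forall x, 1/2 - C2 * eps <= p F (kappa x) x.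
Hypothesis card_low : 2 ^+ n * n%:R ^+ sigma m <= C0 * (\prod_(k < l) #|F k|)%:R.

Implicit Types (U B : {set 'I_n}) (k : 'I_l) (x : 'I_n).

(* In all applications [kappa x] is the index of the hot family at [x]. *)
Definition hot k := [set x | kappa x == k].

Local Notation delta := (2 * C2 * eps).
Local Notation sg := (sigma m).

Let eps_ge0 : 0 <= eps. Proof. by rewrite invr_ge0. Qed.
Let delta_ge0 : 0 <= delta. Proof. by rewrite !mulr_ge0. Qed.

(** The elements of [U] are added one at a time. A set reached after [s] additions comes from at
    most [2 ^ s] members, so the failure probabilities add up to a geometric sum. *)
Lemma not_full k U : U \subset hot k ->
  pr (F k) (fun B => B :|: U \notin F k) <= 2 ^+ #|U| * delta.
Proof.
move Es : #|U| => s; elim: s U Es => [|s IH] U.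
  move/eqP; rewrite cards_eq0 => /eqP -> _; rewrite mul1r; apply: le_trans delta_ge0.
  rewrite (eq_pr (Q' := pred0)) ?pr0 // => B BF; by rewrite setU0 BF.
move=> Us UH; have /set0Pn[x xU] : U != set0 by rewrite -card_gt0 Us.
have cV : #|U :\ x| = s by move: Us; rewrite (cardsD1 x) xU => -[].
have VH : U :\ x \subset hot k by rewrite (subset_trans _ UH) // subsetDl.
have kx : kappa x = k by move/subsetP: UH => /(_ x xU); rewrite inE => /eqP.
apply: le_trans (_ : pr (F k) (fun B => (B :|: (U :\ x) \notin F k) ||
    ((B :|: (U :\ x) \in F k) && (x |: (B :|: (U :\ x)) \notin F k))) <= _).
  apply: pr_sub => B BF; rewrite setUCA setD1K //.
  by case: (B :|: U :\ x \in F k).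
apply: le_trans (pr_or _ _ _) _; rewrite exprS.
have : pr (F k) (fun B => (B :|: (U :\ x) \in F k) && (x |: (B :|: (U :\ x)) \notin F k))
   <= 2 ^+ s * delta.
  apply: le_trans (pr_le_card (c := 2 ^ s) (Q' := fun B => x |: B \notin F k) _) _.
    rewrite -cV; exact: (card_setU_preim (F k) (fun B => x |: B \notin F k)).
  rewrite natrX ler_wpM2l ?exprn_ge0 //; apply: le_trans (not_full1 ext k x) _.
  by have := hot_ge x; rewrite kx; lra.
by have := IH _ cV VH; lra.
Qed.

Lemma pr_superset k U : U \subset hot k ->
  1 - 2 ^+ #|U| * delta <= 2 ^+ #|U| * pr (F k) (fun B => U \subset B).
Proof.
move=> /not_full; rewrite prC ?(ext_neq0 ext) // => H.
suff : pr (F k) (fun B => B :|: U \in F k) <= 2 ^+ #|U| * pr (F k) (fun B => U \subset B) by lra.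
rewrite -natrX; apply: pr_le_card.
apply: leq_trans (card_setU_preim (F k) (fun B => U \subset B) U).
by apply/subset_leq_card/subsetP => B; rewrite !inE subsetUr andbT.
Qed.

Hypothesis delta_small : 2 ^+ sg.+1 * delta <= 1/2.

Lemma pow_delta_small s : (s <= sg.+1)%N -> 2 ^+ s * delta <= 1/2.
Proof.
by move=> ss; apply: le_trans delta_small; rewrite ler_wpM2r // ler_eXn2l // ltr1n.
Qed.

(** If [B] had a set [U] of [m + 1] elements in [hot k'], then [not_full] would provide a member of
    [F k'] that stays a member after adding [U] and then meets [B] too much. This is why
    [delta_small] allows the exponent [sg + 1]. *)
Lemma cap_hot k k' B : k != k' -> B \in F k -> (#|B :&: hot k'| <= m [set k; k'])%N.
Proof.
move=> kk' BF; rewrite leqNgt; apply/negP => big.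
have [U [US Um]] : exists U : {set 'I_n}, U \subset B :&: hot k' /\ #|U| = (m [set k; k']).+1.
  have /card_gt0P[U] : (0 < #|[set U : {set 'I_n} | (U \subset B :&: hot k') && (#|U| == (m [set k; k']).+1)]|)%N.
    by rewrite cards_draws bin_gt0.
  by rewrite inE => /andP[a /eqP b]; exists U.
have [UB UH] : U \subset B /\ U \subset hot k' by apply/andP; rewrite -subsetI.
have [|C CF] := pr_lt1_ex (ext_neq0 ext k') (Q := fun C => C :|: U \notin F k').
  apply: le_lt_trans (not_full UH) _; apply: le_lt_trans (pow_delta_small _) _; last by lra.
  by rewrite Um ltnS le_sigma // cards2 kk'.
rewrite negbK => CUF; have := ext_overlap ext kk' BF CUF; apply/negP; rewrite -ltnNge -Um.
by apply/subset_leq_card; rewrite subsetI UB subsetUr.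
Qed.

Lemma card_cold_sum k B : #|B :\: hot k| = (\sum_(k' < l | k' != k) #|B :&: hot k'|)%N.
Proof.
rewrite -sum1_card (partition_big kappa (fun k' => k' != k)) => [|x]; last first.
  by rewrite !inE => /andP[].
apply: eq_bigr => k' k'k; rewrite -sum1_card; apply: eq_bigl => x; rewrite !inE.
by rewrite andbC; case: eqP => [->|]; rewrite ?andbF // andbT /= k'k.
Qed.

Lemma card_cold k B : B \in F k -> (#|B :\: hot k| <= sg)%N.
Proof.
move=> BF; rewrite card_cold_sum; apply: leq_trans (sum_other_le m k).
by apply: leq_sum => k' k'k; apply: cap_hot => //; rewrite eq_sym.
Qed.

Lemma card_fam_pred k (Q : pred {set 'I_n}) (D : {set {set 'I_n}}) :
  (forall B, B \in F k -> Q B -> B :&: hot k \in D) ->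
  (#|[set B in F k | Q B]| <= #|D| * n.+1 ^ sg)%N.
Proof.
move=> H; have := card_small_subsets 'I_n sg; rewrite card_ord => Hs.
apply: leq_trans (_ : #|D| * #|[set Z : {set 'I_n} | (#|Z| <= sg)%N]| <= _)%N; last by rewrite leq_mul2l Hs orbT.
rewrite -cardsX; apply: (card_inj_le (f := fun B => (B :&: hot k, B :\: hot k))).
  by move=> B C _ _ [E1 E2]; rewrite -(setID B (hot k)) E1 E2 setID.
by move=> B; rewrite inE => /andP[BF QB]; rewrite in_setX H //= inE card_cold.
Qed.

Lemma card_fam k : (#|F k| <= 2 ^ #|hot k| * n.+1 ^ sg)%N.
Proof.
have := @card_fam_pred k predT (powerset (hot k)); rewrite card_powerset.
rewrite (_ : [set B in F k | predT B] = F k) => [|]; last by apply/setP => B; rewrite !inE andbT.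
by apply=> B _ _; rewrite inE subsetIr.
Qed.

Lemma sum_hot : (\sum_(k < l) #|hot k| = n)%N.
Proof.
rewrite -[RHS](card_ord n) -sum1_card (partition_big kappa predT) //=.
by apply: eq_bigr => k _; rewrite -sum1dep_card.
Qed.

(** The lower bound on the whole product is divided by the upper bounds [card_fam] of the other
    families. *)
Lemma hot_card_le k : 2 ^+ #|hot k| <= C0 * #|F k|%:R * n.+1%:R ^+ (sg * l).
Proof.
have X0 : 0 < \prod_(k' < l | k' != k) (2 ^ #|hot k'|)%:R :> rat.
  by apply: prodr_gt0 => k' _; rewrite ltr0n expn_gt0.
rewrite -(ler_pM2r X0).
have <- : 2 ^+ n = 2 ^+ #|hot k| * \prod_(k' < l | k' != k) (2 ^ #|hot k'|)%:R :> rat.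
  rewrite -{1}sum_hot expr_sum (bigD1 k) //=; congr (_ * _).
  by apply: eq_bigr => k' _; rewrite natrX.
apply: le_trans (_ : 2 ^+ n * n%:R ^+ sg <= _).
  by rewrite ler_peMr ?exprn_ge0 // exprn_ege1 // ler1n.
apply: le_trans card_low _; rewrite -!mulrA ler_wpM2l // (bigD1 k) //= natrM ler_wpM2l //.
apply: le_trans (_ : (\prod_(k' < l | k' != k) (2 ^ #|hot k'| * n.+1 ^ sg))%:R <= _).
  by rewrite ler_nat; apply: leq_prod => k' _; exact: card_fam.
rewrite big_split /= natrM natr_prod mulrC ler_wpM2r ?(ltW X0) // prod_nat_const -expnM natrX.
rewrite ler_eXn2l ?ltr1n ?ltnS //.
by rewrite leq_mul2l (leq_trans (max_card _)) ?card_ord ?orbT.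
Qed.

(** Since [F k] has, up to polynomial factors, the size of the power set of its hot set, the
    estimate [card_avoid] carries over to it. *)
Lemma pr_avoid k (Us : seq {set 'I_n}) w (Q : pred {set 'I_n}) :
  (forall U, U \in Us -> U \subset hot k /\ (#|U| <= w)%N) ->
  pairwise (fun U V : {set 'I_n} => [disjoint U & V]) Us ->
  (forall B U, B \in F k -> Q B -> U \in Us -> ~~ (U \subset B)) ->
  pr (F k) Q <= C0 * n.+1%:R ^+ (sg * l.+1) * (1 - 2 ^- w) ^+ size Us.
Proof.
move=> HU dU QU; rewrite /pr ler_pdivrMr ?ltr0n ?(ext_card_gt0 ext) //.
pose D := [set B : {set 'I_n} | (B \subset hot k) && all (fun U : {set 'I_n} => ~~ (U \subset B)) Us].
have H : (#|[set B in F k | Q B]| <= #|D| * n.+1 ^ sg)%N.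
  apply: card_fam_pred => B BF QB; rewrite inE subsetIr; apply/allP => U UUs.
  by rewrite subsetI negb_and (QU B).
rewrite -(ler_nat rat) natrM in H; apply: le_trans H _.
apply: le_trans (ler_wpM2r _ (card_avoid HU dU)) _ => //.
rewrite mulrAC; apply: le_trans (_ : C0 * #|F k|%:R * n.+1%:R ^+ (sg * l) * (n.+1 ^ sg)%:R * (1 - 2 ^- w) ^+ size Us <= _).
  rewrite ler_wpM2r ?exprn_ge0 ?subr_ge0 ?invf_le1 ?exprn_gt0 ?exprn_ege1 ?ler1n //.
  by rewrite ler_wpM2r // hot_card_le.
rewrite le_eqVlt; apply/orP; left; apply/eqP; rewrite natrX mulnS exprD.
by move: (n.+1%:R ^+ sg) (n.+1%:R ^+ (sg * l)) ((1 - 2 ^- w) ^+ _) => a b c; ring.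
Qed.

Let D3 : rat := l%:R ^+ 2 * (2 ^+ sg * delta) + C0 * l.+1%:R ^+ sg * eps.

Definition linked (t : {ffun 'I_l -> {set 'I_n}}) :=
  [forall k, forall k', (k != k') ==> (t k :|: (t k' :&: hot k) \in F k)].

Local Notation d B k := #|B :&: hot k|.

(** Adding to each of [t k] and [t k'] the hot trace of the other gives members whose intersection
    contains both traces, and these are disjoint because the hot sets are. *)
Lemma linked_le t (k k' : 'I_l) : linked t -> k != k' ->
  (d (t k) k' + d (t k') k <= m [set k; k'])%N.
Proof.
move=> /forallP lt kk'; have kk'F := implyP (forallP (lt k) k') kk'.
have k'k : k' != k by rewrite eq_sym.
have k'kF := implyP (forallP (lt k') k) k'k.
apply: leq_trans (ext_overlap ext kk' kk'F k'kF); rewrite -cardsUI.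
rewrite [X in (_ + X)%N](_ : _ = 0)%N ?addn0.
  apply/subset_leq_card/subsetP => x; rewrite !inE.
  by case/orP => /andP[-> ->]; rewrite !orbT.
apply/eqP; rewrite cards_eq0; apply/eqP/setP => x; rewrite !inE.
apply/negP => /andP[/andP[_ /eqP ->] /andP[_ /eqP]]; move: kk' => /[swap] ->.
by rewrite eqxx.
Qed.

Lemma pr_not_linked : pr (tuples F) (fun t => ~~ linked t) <= l%:R ^+ 2 * (2 ^+ sg * delta).
Proof.
apply: le_trans (_ : pr (tuples F) (fun t => [exists q : 'I_l * 'I_l,
   (q.1 != q.2) && (t q.1 :|: (t q.2 :&: hot q.1) \notin F q.1)]) <= _).
  apply: pr_sub => t _ /forallPn[k /forallPn[k']]; rewrite negb_imply => H.
  by apply/existsP; exists (k, k').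
apply: le_trans (pr_exists _ _ _) _.
apply: le_trans (_ : \sum_(q : 'I_l * 'I_l | q.1 != q.2) 2 ^+ sg * delta <= _).
  apply: ler_sum => -[k k'] /= kk'; apply: (pr_tuples_le (ext_neq0 ext) (k := k)) => t tF.
  have k'k : k' != k by rewrite eq_sym.
  apply: le_trans (_ : pr (F k) (fun B => B :|: (t k' :&: hot k) \notin F k) <= _).
    by apply: pr_sub => B _; rewrite upd_same upd_other.
  apply: le_trans (not_full (subsetIr _ _)) _; rewrite ler_wpM2r // ler_eXn2l ?ltr1n //.
  apply: leq_trans (cap_hot k'k _) _; first exact: (tuplesP _ _ tF).
  by rewrite le_sigma // cards2 k'k.
have X0 : 0 <= 2 ^+ sg * delta by rewrite mulr_ge0 ?exprn_ge0.
rewrite sumr_const -[X in X <= _]mulr_natl ler_wpM2r // -natrX ler_nat.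
by apply: leq_trans (max_card _) _; rewrite card_prod card_ord.
Qed.

(** A tuple is determined by one bit per element, for membership at its hot index, and by its cold
    incidences. A linked tuple has at most [sg] of the latter, and a deficient pair lowers this to
    [sg - 1], saving a factor [n] against the extremal product. *)
Lemma card_linked_deficient : (0 < sg)%N ->
  (#|[set t in tuples F | linked t &&
      [exists q : 'I_l * 'I_l, (q.1 != q.2) &&
         (d (t q.1) q.2 + d (t q.2) q.1 != m [set q.1; q.2])%N]]|
    <= 2 ^ n * (n * l).+1 ^ sg.-1)%N.
Proof.
move=> s0.
pose code (t : {ffun 'I_l -> {set 'I_n}}) :=
  ([set x | x \in t (kappa x)], [set xk : 'I_n * 'I_l | (xk.1 \in t xk.2) && (kappa xk.1 != xk.2)]).
have := card_small_subsets ('I_n * 'I_l)%type sg.-1; rewrite card_prod !card_ord => Hs.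
apply: leq_trans (_ : 2 ^ n * #|[set Z : {set 'I_n * 'I_l} | (#|Z| <= sg.-1)%N]| <= _)%N; last first.
  by rewrite leq_mul2l Hs orbT.
have -> : (2 ^ n = #|powerset [set: 'I_n]|)%N by rewrite card_powerset cardsT card_ord.
rewrite -cardsX; apply: (card_inj_le (f := code)) => [t u _ _ [/setP E1 /setP E2]|t].
  apply/ffunP => k; apply/setP => x; have := E1 x; have := E2 (x, k); rewrite !inE /=.
  by have [->|] := eqVneq (kappa x) k; rewrite ?andbT.
rewrite inE => /andP[tF /andP[lt /existsP[q /andP[q12 qm]]]].
rewrite in_setX powersetT in_setT /= inE -ltnS prednK //.
have -> : #|[set xk : 'I_n * 'I_l | (xk.1 \in t xk.2) && (kappa xk.1 != xk.2)]|
   = (\sum_(k < l) #|t k :\: hot k|)%N.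
  rewrite -sum1_card (partition_big snd predT) //=; apply: eq_bigr => k _.
  rewrite -sum1_card (reindex_onto (fun x => (x, k)) fst) /=; last first.
    by move=> [x j] /andP[_ /eqP /= ->].
  by apply: eq_bigl => x; rewrite !inE /= !eqxx !andbT andbC.
under eq_bigr do rewrite card_cold_sum.
rewrite pair_big_dep /= (eq_bigl (fun r : 'I_l * 'I_l => r.1 != r.2)); last first.
  by move=> r; rewrite eq_sym.
rewrite (big_ordered_pairs _ (fun r : 'I_l * 'I_l => d (t r.1) r.2)).
rewrite /sigma (bigD1 [set q.1; q.2]) ?cards2 ?q12 //=.
rewrite [X in (_ < X)%N](bigD1 [set q.1; q.2]) ?cards2 ?q12 //=.
rewrite -addSn; apply: leq_add.
  rewrite (big_two_orders _ (fun r : 'I_l * 'I_l => d (t r.1) r.2) q12) /=.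
  by rewrite ltn_neqAle qm linked_le.
apply: leq_sum => S /andP[/cards2P[k [k' [kk' ->]]] _].
rewrite (big_two_orders _ (fun r : 'I_l * 'I_l => d (t r.1) r.2) kk') /=.
exact: linked_le.
Qed.

Lemma pr_deficient : (0 < sg)%N ->
  pr (tuples F) (fun t => [exists q : 'I_l * 'I_l, (q.1 != q.2) &&
         (d (t q.1) q.2 + d (t q.2) q.1 != m [set q.1; q.2])%N]) <= D3.
Proof.
move=> s0; set Q := fun t : {ffun _ -> _} => [exists q, _].
apply: le_trans (_ : pr (tuples F) (fun t => ~~ linked t || (linked t && Q t)) <= _).
  by apply: pr_sub => t _; case: (linked t).
apply: le_trans (pr_or _ _ _) _; apply: lerD; first exact: pr_not_linked.
rewrite /pr ler_pdivrMr ?ltr0n ?card_gt0 ?tuples_neq0 //; last exact: ext_neq0 ext.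
apply: le_trans (_ : (2 ^ n * (n * l).+1 ^ sg.-1)%N%:R <= _).
  by rewrite ler_nat; exact: card_linked_deficient.
rewrite card_tuples.
have np : 0 < n%:R :> rat by rewrite ltr0n.
rewrite -(ler_pM2r np) ?mulrA [_ * eps * _]mulrAC -[_ * eps * _]mulrA.
apply: le_trans (_ : l.+1%:R ^+ sg * (2 ^+ n * n%:R ^+ sg) <= _); last first.
  rewrite mulVf ?pnatr_eq0 -?lt0n // mulr1 [C0 * _]mulrC -mulrA.
  by rewrite ler_wpM2l ?exprn_ge0.
rewrite natrM natrX -mulrA [X in _ <= X]mulrCA ler_wpM2l ?exprn_ge0 // natrX.
rewrite -exprMn -[X in _ <= _ ^+ X](prednK s0) exprSr -natrM.
apply: ler_pM => //; first by rewrite exprn_ge0.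
  apply: lerXn2r; rewrite ?nnegrE // ler_nat mulSn mulnC -addn1 addnC leq_add2r //.
by rewrite ler_nat leq_pmull.
Qed.

Hypothesis D3_small : 3 * D3 < 1.

(* Two independent variables whose sum is almost surely constant are almost
   surely constant. *)
Lemma exists_type : (0 < sg)%N -> exists j : 'I_l * 'I_l -> nat,
  [/\ forall k, j (k, k) = 0%N,
      forall k k', k != k' -> (j (k, k') + j (k', k) = m [set k; k'])%N &
      forall k k', k != k' -> pr (F k) (fun B => d B k' != j (k, k')) <= D3].
Proof.
move=> s0; have F0 := ext_neq0 ext; have defi := pr_deficient s0.
have pair k k' : k != k' -> pr (tuples F) (fun t => (d (t k) k' + d (t k') k != m [set k; k'])%N) <= D3.
  move=> kk'; apply: le_trans defi; apply: pr_sub => t _ H.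
  by apply/existsP; exists (k, k'); rewrite kk'.
have one k k' : k != k' -> exists j, pr (F k) (fun B => d B k' != j) <= D3.
  move=> kk'; have k'k : k' != k by rewrite eq_sym.
  (* By averaging, some tuple has conditional failure probability at most [D3]; freezing its
     coordinate [k'] names the typical value of the other trace. *)
  have [t tF H] : exists2 t, t \in tuples F &
      pr (F k) (fun B => (d B k' + d (t k') k != m [set k; k'])%N) <= D3.
    apply/exists_inP; apply: contraT => /exists_inPn /= H; exfalso.
    have := pair _ _ kk'; apply/negP; rewrite -ltNge /pr ltr_pdivlMr; last first.
      by rewrite ltr0n card_gt0 tuples_neq0.
    rewrite -(sum_pr_upd F0 k) mulr_natr -sumr_const; apply: ltr_sum.
      have /set0Pn[t tF] := tuples_neq0 F0.
      by apply/hasP; exists t; rewrite ?mem_index_enum.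
    move=> t /H; rewrite -ltNge => /lt_le_trans; apply; apply: pr_sub => B _.
    by rewrite upd_same upd_other.
  exists (m [set k; k'] - d (t k') k)%N; apply: le_trans H; apply: pr_sub => B _.
  apply: contraNN => /eqP <-; rewrite addnK //.
have : forall q : 'I_l * 'I_l, exists j, if q.1 == q.2 then j = 0%N else
   pr (F q.1) (fun B => d B q.2 != j) <= D3.
  move=> [k k'] /=; case: eqVneq => [_|/one //]; by exists 0%N.
move=> /fin_all_exists[j Hj]; exists j.
have jP k k' : k != k' -> pr (F k) (fun B => d B k' != j (k, k')) <= D3.
  by move=> kk'; have := Hj (k, k'); rewrite /= (negPf kk').
split=> // [k|k k' kk']; first by have := Hj (k, k); rewrite /= eqxx.
have k'k : k' != k by rewrite eq_sym.
(* Three events of probability at most [D3] leave a tuple on which both traces are typical and add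
   up to [m]. *)
have [|t tF] := pr_lt1_ex (tuples_neq0 F0) (Q := fun t : {ffun 'I_l -> {set 'I_n}} => (d (t k) k' != j (k, k')) ||
   ((d (t k') k != j (k', k)) || (d (t k) k' + d (t k') k != m [set k; k'])%N)).
  apply: le_lt_trans (pr_or _ _ _) _; apply: le_lt_trans (lerD (lexx _) (pr_or _ _ _)) _.
  have := jP _ _ kk'; rewrite -(pr_tuples_marginal F0 k (fun B => d B k' != j (k, k'))).
  have := jP _ _ k'k; rewrite -(pr_tuples_marginal F0 k' (fun B => d B k != j (k', k))).
  by have := pair _ _ kk'; move: D3_small; lra.
by rewrite !negb_or !negbK => /andP[/eqP <- /andP[/eqP <- /eqP]].
Qed.

End Hot.

(** * Deleting and reinserting an element *)

Lemma sum_card_in (T : finType) (A : {set {set T}}) (Z : {set T}) :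
  (\sum_(B in A) #|B :&: Z| = \sum_(z in Z) #|[set B in A | z \in B]|)%N.
Proof.
under eq_bigr do rewrite -sum1_card.
rewrite (exchange_big_dep (mem Z)) /=; last by move=> B z _; rewrite inE => /andP[].
apply: eq_bigr => z zZ; rewrite -sum1dep_card; apply: eq_bigl => B.
by rewrite inE zZ andbT.
Qed.

Section Readd.
Variables (l n : nat) (m : {set 'I_l} -> nat) (F : fam l n).
Hypothesis ext : extremal m F.
Notation eps := (n%:R^-1 : rat).
Variables (kappa : 'I_n -> 'I_l) (C0 C2 : rat).
Hypothesis n0 : (0 < n)%N.
Hypothesis C0_ge0 : 0 <= C0.
Hypothesis C2_ge0 : 0 <= C2.
Hypothesis hot_ge : forall x, 1/2 - C2 * eps <= p F (kappa x) x.
Hypothesis card_low : 2 ^+ n * n%:R ^+ sigma m <= C0 * (\prod_(k < l) #|F k|)%:R.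
Local Notation sg := (sigma m).
Hypothesis delta_small : 2 ^+ sg.+1 * (2 * C2 * eps) <= 1/2.
Local Notation hot := (hot kappa).
Implicit Types (U B D Z : {set 'I_n}) (k : 'I_l) (x : 'I_n).

Let cap := cap_hot ext C2_ge0 hot_ge delta_small.

(** Sets with at least [n / dd] elements count as linearly large; [expo] says that avoiding them is
    rare enough to beat all polynomial factors. *)
Variable dd : nat.
Hypothesis expo : forall q w, (0 < w)%N -> (w <= sg)%N -> (n <= dd * q)%N ->
  C0 * n.+1%:R ^+ (sg * l.+1) * (1 - 2 ^- w) ^+ q <= eps ^+ (sg + 4).

Definition addable k k'' B := [set z in hot k'' | (z \notin B) && (z |: B \in F k)].

Lemma addable_sub k k'' B D : D \subset B -> addable k k'' B \subset addable k k'' D.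
Proof.
move=> DB; apply/subsetP => z; rewrite !inE => /and3P[kz zB zBF].
apply/and3P; split=> //; first by apply: contra zB; apply/subsetP.
by apply: ext_down ext _ _ _ _ zBF; exact: setUS.
Qed.

Lemma pr_miss k Z : Z \subset hot k -> (n <= dd * #|Z|)%N -> (0 < sg)%N ->
  pr (F k) (fun B => [disjoint Z & B]) <= eps ^+ (sg + 4).
Proof.
move=> ZH nZ s0; pose Us := [seq [set z] | z <- enum Z].
move: nZ; have <- : size Us = #|Z| by rewrite size_map -cardE.
move=> nZ; apply: le_trans (expo (ltn0Sn 0) s0 nZ).
apply: (pr_avoid ext n0 C0_ge0 C2_ge0 hot_ge card_low delta_small).
- move=> _ /mapP[z zZ ->]; rewrite cards1 sub1set; split=> //.
  by move/subsetP: ZH; apply; rewrite -mem_enum.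
- rewrite pairwise_map; move: (enum_uniq (mem Z)); rewrite uniq_pairwise.
  apply: sub_pairwise => z z' /= zz'.
  by rewrite -setI_eq0; apply/eqP/setP => y; rewrite !inE; case: eqVneq => // ->; exact: negPf.
- move=> B _ BF dB /mapP[z zZ ->]; rewrite sub1set.
  by rewrite (disjointFr dB) // -mem_enum.
Qed.

Local Notation tiny := (n.+1%:R ^+ sg * eps ^+ (sg + 4)).

Section Move.
Variables (k k'' : 'I_l) (BB : {set {set 'I_n}}) (x : 'I_n).
Hypothesis kk'' : k != k''.
Hypothesis BBF : BB \subset F k.
Hypothesis BBZ : forall B, B \in BB -> (n <= dd * #|addable k k'' B|)%N.
Hypothesis s0 : (0 < sg)%N.

Let bad C := [exists B in BB, (m [set k; k''] <= #|B :&: C|)%N].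

(** A bad [C] meets some [B] in exactly [m] elements. It then contains no element addable to
    [D = B :&: C], and there are linearly many of these because [D] is a subset of [B]. Summing over
    the small sets [D] rather than over [BB] keeps the union bound polynomial. *)
Let pr_bad : pr (F k'') bad <= tiny.
Proof.
apply: le_trans (_ : pr (F k'') (fun C => [exists D : {set 'I_n},
    ((#|D| <= sg)%N && (n <= dd * #|addable k k'' D|)%N) && [disjoint addable k k'' D & C]]) <= _).
  apply: pr_sub => C CF /exists_inP[B BBB mB].
  have BF : B \in F k by apply: (subsetP BBF).
  have BCm : #|B :&: C| = m [set k; k''].
    by apply/eqP; rewrite eqn_leq mB (ext_overlap ext kk'').
  apply/existsP; exists (B :&: C); rewrite BCm le_sigma ?cards2 ?kk'' //=.
  have sub := addable_sub k k'' (subsetIl B C).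
  rewrite (leq_trans (BBZ BBB)) ?leq_mul2l ?subset_leq_card ?orbT //=.
  rewrite -setI_eq0; apply/eqP/setP => z; rewrite !inE; apply/negP => /andP[/and3P[_ zBC zF] zC].
  have := ext_overlap ext kk'' zF CF; apply/negP; rewrite -ltnNge -BCm.
  apply: leq_trans (_ : #|z |: (B :&: C)| <= _)%N; first by rewrite cardsU1 inE zBC.
  apply/subset_leq_card/subsetP => y; rewrite !inE => /orP[/eqP ->|/andP[-> ->]].
    by rewrite eqxx.
  by rewrite orbT.
apply: le_trans (pr_exists _ _ _) _.
apply: le_trans (_ : \sum_(D : {set 'I_n} | (#|D| <= sg)%N && (n <= dd * #|addable k k'' D|)%N)
    eps ^+ (sg + 4) <= _).
  apply: ler_sum => D /andP[_ nD]; apply: pr_miss => //.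
  by apply/subsetP => z; rewrite inE => /andP[].
have e0 : 0 <= eps ^+ (sg + 4) by rewrite exprn_ge0 // invr_ge0.
rewrite sumr_const -[X in X <= _]mulr_natl ler_wpM2r // -natrX ler_nat.
have := card_small_subsets 'I_n sg; rewrite card_ord; apply: leq_trans.
by apply/subset_leq_card/subsetP => D; rewrite !inE => /andP[].
Qed.

Let N i := [set B in F i | x \notin B].
Let N' i := if i == k then [set B in BB | x \notin B]
            else if i == k'' then [set B in N k'' | ~~ bad B] else set0.
Let G : fam l n := [ffun i => N i :|: [set x |: B | B in N' i]].

Let N'N i : N' i \subset N i.
Proof.
rewrite /N'; case: eqP => [->|_]; last case: eqP => [->|_]; last exact: sub0set.
  by apply/subsetP => B; rewrite !inE => /andP[/(subsetP BBF) -> ->].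
by apply/subsetP => B; rewrite inE => /andP[].
Qed.

Let G_overlap : overlapping m G.
Proof.
have NF i B : B \in N i -> B \in F i /\ x \notin B by rewrite inE => /andP.
have half i i' A C : i != i' -> A \in N i -> C \in N i' -> (#|A :&: (x |: C)| <= m [set i; i'])%N.
  move=> ii' /NF[AF xA] /NF[CF xC]; apply: leq_trans (ext_overlap ext ii' AF CF).
  apply/subset_leq_card/subsetP => y; rewrite !inE => /andP[yA /orP[/eqP yx|->]].
    by rewrite yx (negPf xA) in yA.
  by rewrite yA.
(* Adding [x] to both sets raises their overlap by one; this is harmless since the bad sets, where
   the bound is already attained, were excluded. *)
have cross A C : A \in N' k -> C \in N' k'' -> (#|(x |: A) :&: (x |: C)| <= m [set k; k''])%N.
  rewrite /N' eqxx [k'' == k]eq_sym (negPf kk'') eqxx !inE.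
  move=> /andP[ABB xA] /andP[/andP[CF xC] /exists_inPn/(_ A ABB)]; rewrite -ltnNge.
  by rewrite -setUIr cardsU1 !inE (negPf xA).
have N'k i A : A \in N' i -> i = k \/ i = k''.
  rewrite /N'; case: eqP => [->|_]; first by left.
  by case: eqP => [->|_]; [right | rewrite inE].
apply/overlapP => i i' ii' A C; rewrite !ffunE.
move=> /setUP[AN|/imsetP[A' A'N ->]] /setUP[CN|/imsetP[C' C'N ->]].
- by case: (NF _ _ AN) (NF _ _ CN) => AF _ [CF _]; exact: (ext_overlap ext).
- by apply: half => //; apply: (subsetP (N'N _)).
- rewrite setIC [[set i; i']]setUC; apply: half => //; first by rewrite eq_sym.
  exact: (subsetP (N'N _)).
- have [ik|ik] := N'k _ _ A'N; have [i'k|i'k] := N'k _ _ C'N; rewrite ik i'k in ii' A'N C'N *.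
  + by rewrite eqxx in ii'.
  + exact: cross.
  + by rewrite setIC [[set k''; k]]setUC; exact: cross.
  + by rewrite eqxx in ii'.
Qed.

Let cardG i : #|G i| = (#|N i| + #|N' i|)%N.
Proof.
rewrite ffunE cardsU card_in_imset => [|B C].
  rewrite [X in (_ - X)%N](_ : _ = 0)%N ?subn0 //; apply/eqP; rewrite cards_eq0.
  apply/eqP/setP => B; rewrite !inE; apply/negP => /andP[/andP[_ xB] /imsetP[C _ BC]].
  by rewrite BC !inE eqxx in xB.
move=> /(subsetP (N'N i)); rewrite inE => /andP[_ xB].
move=> /(subsetP (N'N i)); rewrite inE => /andP[_ xC] E.
by rewrite -(setU1K xB) -(setU1K xC) E.
Qed.

(* Delete [x] from all the sets, then put it back: freely in the family [k'']
   (except for the few members meeting too much of [BB]), and in the members of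
   [BB] for the family [k]. *)
Lemma readd :
  \prod_(i < l) (1 - p F i x) *
    (1 + #|[set B in BB | x \notin B]|%:R / #|[set B in F k | x \notin B]|%:R) *
    (2 - 2 * tiny) <= 1.
Proof.
have : 0 <= tiny by rewrite mulr_ge0 ?exprn_ge0 ?invr_ge0.
move: pr_bad; move: tiny => T Tbad T0.
have k''k : k'' != k by rewrite eq_sym.
have N0 i : 0 < #|N i|%:R :> rat.
  rewrite ltr0n card_gt0; apply/set0Pn; exists set0; rewrite !inE andbT.
  have /set0Pn[B BF] := ext_neq0 ext i; exact: ext_down ext _ _ _ (sub0set _) BF.
have f0 i : 0 < #|F i|%:R :> rat by rewrite ltr0n (ext_card_gt0 ext).
have NE i : #|N i|%:R / #|F i|%:R = 1 - p F i x by rewrite -(p_notin ext).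
have p1 i : 1/2 <= 1 - p F i x by have := p_le_half ext i x; lra.
have := ext_prod ext G_overlap; apply: le_trans.
rewrite [X in _ <= X](bigD1 k) //= [X in _ <= _ * X](bigD1 k'') //=.
rewrite [\prod_(i < l) _](bigD1 k) //= [X in _ * X * _ * _](bigD1 k'') //=.
have -> : \prod_(i < l | (i != k) && (i != k'')) (#|G i|%:R / #|F i|%:R) =
          \prod_(i < l | (i != k) && (i != k'')) (1 - p F i x) :> rat.
  apply: eq_bigr => i /andP[/negPf ik /negPf ik'']; rewrite -NE cardG /N' ik ik''.
  by rewrite cards0 addn0.
have R0 : 0 <= \prod_(i < l | (i != k) && (i != k'')) (1 - p F i x).
  by apply: prodr_ge0 => i _; have := p1 i; lra.
have -> : #|G k|%:R / #|F k|%:R = (1 - p F k x) *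
    (1 + #|[set B in BB | x \notin B]|%:R / #|[set B in F k | x \notin B]|%:R) :> rat.
  rewrite cardG natrD -NE /N' eqxx -/(N k); field.
  by rewrite !gt_eqF.
(* The set [N k''] is counted twice, apart from the bad sets; these are at most [T * #|F k''|],
   hence at most [2 * T * #|N k''|] as [p] is at most 1/2. *)
have H : (1 - p F k'' x) * (2 - 2 * T) <= #|G k''|%:R / #|F k''|%:R.
  have Hb := Tbad; rewrite /pr ler_pdivrMr // in Hb.
  have H2 : 2 * #|N k''|%:R <= #|G k''|%:R + #|[set C in F k'' | bad C]|%:R :> rat.
    rewrite cardG /N' (negPf k''k) eqxx -natrM -natrD ler_nat mul2n -addnn -addnA leq_add2l.
    rewrite -[X in (X <= _)%N](cardsID [set B | ~~ bad B]); apply: leq_add.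
      by apply/subset_leq_card/subsetP => B; rewrite !inE.
    by apply/subset_leq_card/subsetP => B; rewrite !inE negbK => /and3P[-> -> _].
  rewrite ler_pdivlMr // -NE mulrAC divfK ?gt_eqF //.
  have : #|F k''|%:R <= 2 * #|N k''|%:R :> rat.
    by have := p1 k''; rewrite -NE ler_pdivlMr //; lra.
  nra.
set a := 1 - p F k x; set b := 1 - p F k'' x in H *; set c := 1 + _ / _.
set r := \prod_(_ < _ | _) _ in R0 *.
have c0 : 0 <= c by rewrite /c addr_ge0 // divr_ge0.
rewrite (_ : a * (b * r) * c * (2 - 2 * T) = a * c * r * (b * (2 - 2 * T))); last by ring.
rewrite (_ : a * c * (_ * r) = a * c * r * (#|G k''|%:R / #|F k''|%:R)); last by ring.
by rewrite ler_wpM2l // !mulr_ge0 //; have := p1 k; rewrite /a; lra.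
Qed.

End Move.
End Readd.

(** * Warm indices *)

(** In [readd] the loss of at most 1/2 at the hot index is made up for by the free insertion in the
    second family, and the insertion in [BB] gains [1 + e / 4]. If the other indices lost less than
    [e / 32], the product would exceed 1. *)
Lemma warm_arith (a r s e g T : rat) : a <= 1/2 -> 1 - s <= r -> s < e / 32 -> 0 < e ->
  e <= 1/10 -> e / 4 <= g -> T <= e ^+ 3 -> 1 < (1 - a) * r * (1 + g) * (2 - 2 * T).
Proof.
move=> a2 sr se e0 e1 ge T1.
have h1 : 1/2 * (1 - e/32) <= (1 - a) * r by apply: ler_pM; lra.
have h2 : 1/2 * (1 - e/32) * (1 + e/4) <= (1 - a) * r * (1 + g).
  by apply: ler_pM h1 _; lra.
move: ((1 - a) * r * (1 + g)) h2 => X h2; clear a r s g a2 sr se ge h1.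
have ee : e * e <= e * (1/10) by rewrite ler_wpM2l // ltW.
have T2 : T <= e / 100.
  apply: le_trans T1 _; rewrite exprS expr2.
  have : e * (e * e) <= e * (1/10 * (1/10)) by apply: ler_wpM2l; [exact: ltW | apply: ler_pM => //; exact: ltW].
  lra.
have h3 : (1 + e/8) / 2 <= X by lra.
have h4 : (1 + e/8) / 2 * (2 - 2 * (e / 100)) <= X * (2 - 2 * T).
  by apply: ler_pM => //; lra.
apply: lt_le_trans h4; lra.
Qed.

(** Here [b] is the warm and [c] the hot proportion; [128 = 32 * 4] collects the inverses of their
    lower bounds. *)
Lemma others_arith (a b c e L C : rat) : 0 <= a -> e <= b * (32 * L) -> 1/4 <= c -> 0 < e ->
  0 < L -> a * b * c <= C * e ^+ 3 -> a <= 128 * L * C * e ^+ 2.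
Proof.
move=> a0 eb c4 e0 L0 H; have e3 : e ^+ 3 = e ^+ 2 * e := exprSr e 2.
rewrite -(ler_pM2r e0); rewrite e3 in H; clear e3.
have L1 : 0 <= 32 * L by rewrite mulr_ge0 // ltW.
have h1 : a * e * (1/4) <= a * (b * (32 * L)) * c.
  apply: ler_pM => //; first by rewrite mulr_ge0 // ltW.
  exact: ler_wpM2l.
have h2 := ler_wpM2r L1 H; move: (e ^+ 2) h2 => E h2.
have h3 : a * (b * (32 * L)) * c = a * b * c * (32 * L) by ring.
have h4 : C * (E * e) * (32 * L) = 128 * L * C * E * e * (1/4) by field.
lra.
Qed.

Section Warm.
Variables (l n : nat) (m : {set 'I_l} -> nat) (F : fam l n).
Hypothesis ext : extremal m F.
Notation eps := (n%:R^-1 : rat).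
Variables (kappa : 'I_n -> 'I_l) (C0 C1 C2 C3 : rat).
Hypothesis n0 : (0 < n)%N.
Hypothesis C0_ge0 : 0 <= C0.
Hypothesis C1_ge0 : 0 <= C1.
Hypothesis C2_ge0 : 0 <= C2.
Hypothesis C3_ge0 : 0 <= C3.
Hypothesis hot_ge : forall x, 1/2 - C2 * eps <= p F (kappa x) x.
Hypothesis card_low : 2 ^+ n * n%:R ^+ sigma m <= C0 * (\prod_(k < l) #|F k|)%:R.
Local Notation sg := (sigma m).
Hypothesis delta_small : 2 ^+ sg.+1 * (2 * C2 * eps) <= 1/2.
Local Notation hot := (hot kappa).
Implicit Types (U B D Z : {set 'I_n}) (k : 'I_l) (x : 'I_n).

Variable dd : nat.
Hypothesis expo : forall q w, (0 < w)%N -> (w <= sg)%N -> (n <= dd * q)%N ->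
  C0 * n.+1%:R ^+ (sg * l.+1) * (1 - 2 ^- w) ^+ q <= eps ^+ (sg + 4).
Hypothesis tiny_small : n.+1%:R ^+ sg * eps ^+ (sg + 4) <= eps ^+ 3.
Hypothesis eps_small : eps <= 1/10.
Hypothesis s0 : (0 < sg)%N.

Variable j : 'I_l * 'I_l -> nat.
Hypothesis j_diag : forall k, j (k, k) = 0%N.
Hypothesis j_sum : forall k k', k != k' -> (j (k, k') + j (k', k) = m [set k; k'])%N.
Hypothesis j_pr : forall k k', k != k' ->
  pr (F k) (fun B => #|B :&: hot k'| != j (k, k')) <= C3 * eps.
Hypothesis C3_small : C3 * eps <= 1/4.
Hypothesis dd_big : 4 * C3 <= dd%:R.
Hypothesis dd0 : (0 < dd)%N.

Let e0 : 0 < eps. Proof. by rewrite invr_gt0 ltr0n. Qed.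
Let en : n%:R * eps = 1. Proof. by rewrite mulfV // pnatr_eq0 -lt0n. Qed.

(** Deleting from a typical member one of its elements in [hot k''] gives an atypical member to
    which this element is addable. This yields at least [3/4 * #|F k|] such pairs, though only a
    proportion [C3 / n] of the members is atypical. Those with fewer than [n / dd] addable elements
    account for at most [#|F k| / 4] pairs, because [4 * C3 <= dd]; each other member accounts for
    at most [n]. *)
Lemma many_addable k k'' : k != k'' -> (0 < j (k, k''))%N ->
  eps / 2 <= pr (F k) (fun B => (n <= dd * #|addable F kappa k k'' B|)%N).
Proof.
move=> kk'' j0.
pose full := [set B in F k | #|B :&: hot k''| == j (k, k'')].
pose BB := [set B in F k | (n <= dd * #|addable F kappa k k'' B|)%N].
pose rest := [set B in F k | #|B :&: hot k''| != j (k, k'')].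
have H1 : (#|full| <= \sum_(B in rest) #|addable F kappa k k'' B|)%N.
  apply: leq_trans (_ : \sum_(B in full) #|B :&: hot k''| <= _)%N.
    rewrite -sum1_card; apply: leq_sum => B; rewrite inE => /andP[_ /eqP ->].
    exact: j0.
  under eq_bigr do rewrite -sum1_card.
  under [X in (_ <= X)%N]eq_bigr do rewrite -sum1_card.
  rewrite !pair_big_dep /= !sum1dep_card.
  apply: (card_inj_le (f := fun Bz : {set 'I_n} * 'I_n => (Bz.1 :\ Bz.2, Bz.2))).
    move=> [B z] [C y]; rewrite !inE /= => /and3P[_ zB _] /and3P[_ yC _] [E zy].
    by rewrite zy; congr (_, _); rewrite -(setD1K zB) -(setD1K yC) E zy.
  move=> [B z]; rewrite !inE /= => /and3P[/andP[BF /eqP dB] zB zH].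
  rewrite eqxx setD1K // BF zH /= (ext_down ext (subsetDl _ _) BF) /= !andbT.
  rewrite -dB neq_ltn; apply/orP; left; apply: proper_card; apply/properP; split.
    by apply: setSI; rewrite subsetDl.
  by exists z; rewrite !inE ?zB ?zH ?eqxx.
have H2 : (dd * \sum_(B in rest) #|addable F kappa k k'' B| <= dd * n * #|BB| + n * #|rest|)%N.
  rewrite big_distrr /= (bigID (mem BB)) /=; apply: leq_add.
    apply: leq_trans (_ : \sum_(B in BB) dd * n <= _)%N; last first.
      by rewrite sum_nat_const mulnC.
    rewrite [X in (_ <= X)%N](bigID (mem rest)) /=; apply: leq_trans (leq_addr _ _).
    rewrite (eq_bigl (fun B => (B \in BB) && (B \in rest))) => [|B]; last exact: andbC.
    apply: leq_sum => B _; rewrite leq_mul2l (leq_trans (max_card _)) ?card_ord ?orbT //.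
  apply: leq_trans (_ : \sum_(B in rest) n <= _)%N; last by rewrite sum_nat_const mulnC.
  rewrite [X in (_ <= X)%N](bigID (mem BB)) /=; apply: leq_trans (leq_addl _ _).
  apply: leq_sum => B; rewrite !inE => /andP[/andP[-> _]] /=; rewrite -ltnNge.
  exact: ltnW.
have f0 : 0 < #|F k|%:R :> rat by rewrite ltr0n (ext_card_gt0 ext).
have : dd%:R * #|full|%:R <= dd%:R * n%:R * #|BB|%:R + n%:R * #|rest|%:R :> rat.
  rewrite -!natrM -natrD ler_nat; apply: leq_trans H2.
  by rewrite leq_mul2l H1 orbT.
have <- := pr_mul (F k) (fun B => #|B :&: hot k''| == j (k, k'')).
have <- := pr_mul (F k) (fun B => (n <= dd * #|addable F kappa k k'' B|)%N).
have <- := pr_mul (F k) (fun B => #|B :&: hot k''| != j (k, k'')).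
have := j_pr kk''; rewrite (prC _ (ext_neq0 ext k)).
move: (pr _ (fun B => _ == _)) (pr _ (fun B => (n <= _)%N)) => f b fj.
rewrite ![_ * (_ * #|F k|%:R)]mulrA -mulrDl ler_pM2r // => H.
have d0 : 0 < dd%:R :> rat by rewrite ltr0n.
have H3 : dd%:R * (3/4) <= dd%:R * n%:R * b + C3.
  have : n%:R * (1 - f) <= C3.
    have : n%:R * (1 - f) <= n%:R * (C3 * eps) by rewrite ler_wpM2l.
    by rewrite mulrCA en mulr1.
  have : dd%:R * (3/4) <= dd%:R * f by rewrite ler_pM2l //; have := C3_small; lra.
  lra.
have : dd%:R * (1/2) <= dd%:R * (n%:R * b).
  by rewrite mulrA; have := dd_big; lra.
rewrite ler_pM2l // => H4.
have : eps * (1/2) <= eps * (n%:R * b) by rewrite ler_pM2l.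
by rewrite mulrA [eps * n%:R]mulrC en mul1r; lra.
Qed.

Lemma exists_warm x : exists2 w, w != kappa x & eps / (32 * l%:R) <= p F w x.
Proof.
have l0 : (0 < l)%N by case: l (kappa x) => // -[].
have [k [k'' [kk'' jk]]] : exists k k'', k != k'' /\ (0 < j (k, k''))%N.
  have [S] : exists S : {set 'I_l}, (#|S| == 2) && (0 < m S)%N.
    apply/existsP; apply: contraTT s0 => /existsPn H; rewrite -eqn0Ngt /sigma.
    apply/eqP; apply: big1 => S S2; apply/eqP; have := H S.
    by rewrite S2 /= -eqn0Ngt.
  move=> /andP[/cards2P[k [k' [kk' ->]]]]; rewrite -j_sum // addn_gt0.
  by case/orP => H; [exists k, k' | exists k', k; rewrite eq_sym].
pose BB := [set B in F k | (n <= dd * #|addable F kappa k k'' B|)%N].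
have BBF : BB \subset F k by apply/subsetP => B; rewrite inE => /andP[].
have BBZ B : B \in BB -> (n <= dd * #|addable F kappa k k'' B|)%N.
  by rewrite inE => /andP[].
have f0 : 0 < #|F k|%:R :> rat by rewrite ltr0n (ext_card_gt0 ext).
have := readd ext n0 C0_ge0 C2_ge0 hot_ge card_low delta_small expo x kk'' BBF BBZ s0.
(* [BB] has proportion at least [eps / 2], and deleting [x] maps its members containing [x]
   injectively to members of [BB] avoiding [x], so at least half of it avoids [x]. *)
have g : eps / 4 <= #|[set B in BB | x \notin B]|%:R / #|[set B in F k | x \notin B]|%:R.
  have H1 : #|BB|%:R <= 2 * #|[set B in BB | x \notin B]|%:R :> rat.
    rewrite -natrM ler_nat mul2n -addnn -[X in (X <= _)%N](cardsID [set B : {set 'I_n} | x \notin B]).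
    apply: leq_add; first by apply/subset_leq_card/subsetP => B; rewrite !inE.
    apply: (card_inj_le (f := fun B => B :\ x)) => [B C|B].
      rewrite !inE !negbK => /andP[xB _] /andP[xC _] E.
      by rewrite -(setD1K xB) -(setD1K xC) E.
    rewrite !inE negbK eqxx => /and3P[xB BF BZ].
    rewrite (ext_down ext (subsetDl _ _) BF) /= andbT.
    apply: leq_trans BZ _; rewrite leq_mul2l subset_leq_card ?orbT //.
    by apply: (addable_sub ext); rewrite subsetDl.
  have N0 : 0 < #|[set B in F k | x \notin B]|%:R :> rat.
    rewrite ltr0n card_gt0; apply/set0Pn; exists set0; rewrite !inE andbT.
    have /set0Pn[B BF] := ext_neq0 ext k; exact: ext_down ext _ _ _ (sub0set _) BF.
  rewrite ler_pdivlMr //.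
  have N1 : #|[set B in F k | x \notin B]|%:R <= #|F k|%:R :> rat.
    by rewrite ler_nat; apply/subset_leq_card/subsetP => B; rewrite inE => /andP[].
  have := many_addable kk'' jk; rewrite /pr -/BB ler_pdivlMr //.
  have : eps / 4 * #|[set B in F k | x \notin B]|%:R <= eps / 4 * #|F k|%:R.
    by rewrite ler_wpM2l // divr_ge0 // ltW.
  lra.
move: (_ / _) g => g ge; move: tiny_small.
have : 0 <= n.+1%:R ^+ sg * eps ^+ (sg + 4) by rewrite mulr_ge0 ?exprn_ge0 // ltW.
move: (_ * eps ^+ (sg + 4)) => T T0 T1.
rewrite (bigD1 (kappa x)) //= => H.
have sb := @prod_1sub _ (fun i => i != kappa x) (fun i : 'I_l => p F i x).
have {}sb := sb (fun i _ => introT andP (conj (pr_ge0 _ _) (pr_le1 _ _))).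
have big : eps / 32 <= \sum_(i < l | i != kappa x) p F i x.
  rewrite leNgt; apply/negP => small.
  have ph := p_le_half ext (kappa x) x.
  move: ph sb small H ge T1 e0 eps_small; clear.
  by move=> ph sb small H ge T1 e0' e1; have := warm_arith ph sb small e0' e1 ge T1; rewrite ltNge H.
have L0 : 0 < l%:R :> rat by rewrite ltr0n.
apply/exists_inP; apply: contraLR big => /exists_inPn H'; rewrite -ltNge.
apply: le_lt_trans (_ : \sum_(i < l | i != kappa x) eps / (32 * l%:R) < _).
  by apply: ler_sum => i ix; apply: ltW; have := H' i ix; rewrite -ltNge.
rewrite sumr_const (cardC1 (kappa x)) card_ord -[X in X < _]mulr_natl.
have -> : eps / 32 = l%:R * (eps / (32 * l%:R)) by field; rewrite !gt_eqF ?ltr0n.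
(* Strictness comes from the hot index being left out: only [l - 1] terms are summed. *)
rewrite ltr_pM2r ?ltr_nat ?ltn_predL //.
by apply: divr_gt0; [exact: e0 | apply: mulr_gt0; [rewrite ltr0n | exact: L0]].
Qed.

Hypothesis star_bound : forall (Y : 'I_l -> {set 'I_n}) e,
  (e <= \sum_x 'C(#|cover_at Y x|, 2))%N ->
  \prod_(k < l) pr (F k) (fun B => Y k \subset B) <= C1 * eps ^+ e.
Hypothesis C2_small : C2 * eps <= 1/4.

Lemma exists_col : exists warm : 'I_n -> 'I_l, forall x,
  [/\ warm x != kappa x, eps / (32 * l%:R) <= p F (warm x) x &
      forall k, k != warm x -> k != kappa x -> p F k x <= 128 * l%:R * C1 * eps ^+ 2].
Proof.
have H x : exists w, [/\ w != kappa x, eps / (32 * l%:R) <= p F w x &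
      forall k, k != w -> k != kappa x -> p F k x <= 128 * l%:R * C1 * eps ^+ 2].
  have [w wx pw] := exists_warm x; exists w; split; [exact: wx | exact: pw | move=> k kw kx].
  have := ppp_le ext star_bound x kw kx wx.
  have L0 : 0 < l%:R :> rat by rewrite ltr0n; case: l (kappa x) => // -[].
  have hx : 1/4 <= p F (kappa x) x by have := hot_ge x; have := C2_small; lra.
  have k0 : 0 <= p F k x by exact: pr_ge0.
  rewrite ler_pdivrMr ?mulr_gt0 // in pw.
  by move=> H; exact: others_arith k0 pw hx e0 L0 H.
by have [w Hw] := fin_all_exists H; exists w.
Qed.

End Warm.

(** * The main term *)

(** AM-GM for the numbers [a q / j q], each taken [j q] times; the index type [T] holds these
    copies. *)
Lemma weighted_AGM (I : finType) (a j : I -> nat) n s :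
  (0 < s)%N -> (\sum_q a q <= n)%N -> (\sum_q j q = s)%N ->
  \prod_q (a q)%:R ^+ j q <= \prod_q ((j q * n)%:R / s%:R) ^+ j q :> rat.
Proof.
move=> s0 an js; pose T := {q : I & 'I_(j q)}.
pose E (t : T) : rat := (a (tag t))%:R / (j (tag t))%:R.
have cT : #|(predT : pred T)| = s.
  by rewrite (card_tagged (fun q => 'I_(j q))) sumnE big_map big_enum -js; apply: eq_bigr => q _; rewrite card_ord.
have [|+ _] := leif_AGM (A := predT) (E := E); first by move=> t _; rewrite divr_ge0.
rewrite cT => H.
have prodE (G : I -> rat) : \prod_(t : T) G (tag t) = \prod_q G q ^+ j q.
  rewrite (eq_bigl (fun t : T => predT (tag t) && predT (tagged t))) //.
  rewrite -(sig_big_dep predT (fun _ => predT) (fun q _ => G q)) /=.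
  by apply: eq_bigr => q _; rewrite prodr_const card_ord.
have sumE : \sum_(t : T) E t <= n%:R.
  rewrite (eq_bigl (fun t : T => predT (tag t) && predT (tagged t))) //.
  rewrite -(sig_big_dep predT (fun _ => predT) (fun q _ => (a q)%:R / (j q)%:R)) /=.
  apply: le_trans (_ : \sum_q (a q)%:R <= _); last by rewrite -natr_sum ler_nat.
  apply: ler_sum => q _; rewrite sumr_const card_ord -[X in X <= _]mulr_natr.
  by have [->|j0] := posnP (j q); rewrite ?mulr0 // divfK // pnatr_eq0 -lt0n.
have -> : \prod_q ((j q * n)%:R / s%:R) ^+ j q =
    \prod_q (j q)%:R ^+ j q * (n%:R / s%:R) ^+ s :> rat.
  rewrite -js expr_sum -big_split /=; apply: eq_bigr => q _.
  by rewrite natrM -mulrA exprMn.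
have -> : \prod_q (a q)%:R ^+ j q = \prod_q (j q)%:R ^+ j q * \prod_(t : T) E t.
  rewrite (prodE (fun q => (a q)%:R / (j q)%:R)) -big_split /=.
  apply: eq_bigr => q _; rewrite -exprMn.
  have [->|j0] := posnP (j q); first by rewrite !expr0.
  by rewrite mulrC divfK // pnatr_eq0 -lt0n.
apply: ler_wpM2l; first by apply: prodr_ge0 => q _; rewrite exprn_ge0.
have -> : \prod_(t : T) E t = \prod_(t in predT) E t by [].
apply: le_trans H _; apply: lerXn2r; rewrite ?nnegrE ?divr_ge0 //.
  by apply: sumr_ge0 => t _; rewrite divr_ge0.
by rewrite ler_wpM2r ?invr_ge0.
Qed.

Lemma bin_le_expn a j : ('C(a, j)%:R <= (j`!)%:R^-1 * a%:R ^+ j :> rat).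
Proof.
rewrite mulrC ler_pdivlMr ?ltr0n ?fact_gt0 // -natrM bin_ffact -natrX ler_nat.
elim: j => [|j IH]; first by rewrite ffactn0.
by rewrite ffactnSr expnSr leq_mul // leq_subr.
Qed.

Section MainTerm.
Variables (l : nat) (m : {set 'I_l} -> nat) (n : nat).
Local Notation sg := (sigma m).
Hypothesis s0 : (0 < sg)%N.

(** The factor that an overlap [j] contributes to the main term. It is 1 for [j = 0], so diagonal
    indices and absent edges drop out of products. *)
Definition weight (s j : nat) : rat := (j`!)%:R^-1 * ((j * n)%:R / s%:R) ^+ j.

Lemma weight_ge0 s j : 0 <= weight s j.
Proof. by rewrite mulr_ge0 ?invr_ge0 // exprn_ge0 // divr_ge0. Qed.

Lemma weight0 s : weight s 0 = 1.
Proof. by rewrite /weight expr0 mulr1 invr1. Qed.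

(** With denominators cleared, this says that splitting an overlap into [j] and [j'] costs the
    probability that a binomial variable with [j + j'] trials and mean [j] takes the value [j]. *)
Lemma weightD s j j' : weight s j * weight s j' * ((j + j') ^ (j + j'))%:R =
  ('C(j + j', j) * (j ^ j * j' ^ j'))%:R * weight s (j + j').
Proof.
rewrite /weight; pose N : rat := n%:R / s%:R.
have E i : ((i * n)%:R / s%:R) ^+ i = (i ^ i)%:R * N ^+ i :> rat.
  by rewrite natrM -mulrA exprMn natrX.
rewrite !E exprD !natrM.
have fne i : (i`!)%:R != 0 :> rat by rewrite pnatr_eq0 -lt0n fact_gt0.
have /(congr1 (fun x => x%:R : rat)) := bin_fact (leq_addr j' j); rewrite addKn !natrM => bf.
move: (N ^+ j) (N ^+ j') ((j ^ j)%:R : rat) ((j' ^ j')%:R : rat) => x y u v.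
move: (((j + j') ^ (j + j'))%:R : rat) => w.
apply: (mulfI (fne (j + j')%N)); rewrite -{1}bf.
by field; rewrite !fne.
Qed.

Lemma binX_le j j' : ('C(j + j', j) * (j ^ j * j' ^ j') <= (j + j') ^ (j + j'))%N.
Proof.
rewrite [in X in (_ <= X ^ _)%N]addnC expnDn (bigD1 (inord j)) //= inordK ?ltnS ?leq_addr //.
by rewrite addKn [(j ^ j * _)%N]mulnC leq_addr.
Qed.

Lemma binX_lt j j' : (0 < j)%N -> (0 < j')%N ->
  ('C(j + j', j) * (j ^ j * j' ^ j') < (j + j') ^ (j + j'))%N.
Proof.
move=> j0 j'0.
rewrite [in X in (_ < X ^ _)%N]addnC expnDn (bigD1 (inord j)) //= inordK ?ltnS ?leq_addr //.
(* Besides the term of index [j], the binomial expansion has the term of index 0, which is a power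
   of [j'] and so positive. *)
rewrite addKn [(j ^ j * _)%N]mulnC -addn1 leq_add2l (bigD1 ord0) /=; last first.
  by rewrite -val_eqE /= inordK ?ltnS ?leq_addr // eq_sym -lt0n.
by rewrite bin0 mul1n subn0 expn0 muln1 addn_gt0 expn_gt0 j'0.
Qed.

Lemma weight_gt0 j : (0 < n)%N -> 0 < weight sg j.
Proof.
move=> n0; have [->|j0] := posnP j; first by rewrite weight0.
by rewrite mulr_gt0 ?invr_gt0 ?ltr0n ?fact_gt0 // exprn_gt0 // divr_gt0 ?ltr0n ?muln_gt0 ?j0.
Qed.

Lemma weightD_le j j' : weight sg j * weight sg j' <= weight sg (j + j').
Proof.
have X0 : 0 < ((j + j') ^ (j + j'))%:R :> rat.
  by rewrite ltr0n; case: (j + j')%N => // i; rewrite expn_gt0.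
rewrite -(ler_pM2r X0) weightD mulrC ler_wpM2l ?weight_ge0 // ler_nat.
exact: binX_le.
Qed.

(** The two sides of [binX_lt] are integers, so they differ by at least 1, out of at most
    [sg ^ sg]. *)
Lemma weightD_gap j j' : (0 < j)%N -> (0 < j')%N -> (j + j' <= sg)%N ->
  weight sg j * weight sg j' <= (1 - (sg ^ sg)%:R^-1) * weight sg (j + j').
Proof.
move=> j0 j'0 js.
have X0 : 0 < ((j + j') ^ (j + j'))%:R :> rat by rewrite ltr0n expn_gt0 addn_gt0 j0.
rewrite -(ler_pM2r X0) weightD mulrAC ler_wpM2r ?weight_ge0 //.
have := binX_lt j0 j'0; rewrite -(ler_nat rat) => H.
apply: le_trans (_ : ((j + j') ^ (j + j'))%:R - 1 <= _).
  by rewrite lerBrDr -natr1 in H *.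
rewrite mulrBl mul1r lerD2l lerN2 mulrC ler_pdivrMr ?ltr0n ?expn_gt0 ?s0 // mul1r ler_nat.
apply: leq_trans (_ : sg ^ (j + j') <= _)%N.
  by rewrite leq_exp2r // addn_gt0 j0.
by rewrite leq_pexp2l.
Qed.

Variable j : 'I_l * 'I_l -> nat.
Hypothesis j_diag : forall k, j (k, k) = 0%N.
Hypothesis j_sum : forall k k', k != k' -> (j (k, k') + j (k', k) = m [set k; k'])%N.

Lemma off_diag (R : Type) (idx : R) (op : Monoid.com_law idx) (g : 'I_l * 'I_l -> R) :
  (forall k, g (k, k) = idx) ->
  \big[op/idx]_q g q = \big[op/idx]_(S : {set 'I_l} | #|S| == 2)
     \big[op/idx]_(q : 'I_l * 'I_l | (q.1 != q.2) && ([set q.1; q.2] == S)) g q.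
Proof.
move=> g0; rewrite -big_ordered_pairs [LHS](bigID (fun q : 'I_l * 'I_l => q.1 != q.2)) /=.
rewrite [X in op _ X]big1 ?Monoid.mulm1 // => -[k k'] /=.
by rewrite negbK => /eqP ->.
Qed.

Lemma sum_type : (\sum_q j q = sg)%N.
Proof.
rewrite off_diag //; apply: eq_bigr => S /cards2P[k [k' [kk' ->]]].
by rewrite (big_two_orders _ _ kk') /= j_sum.
Qed.

Lemma main_termE : main_term m n = 2 ^+ n * \prod_(S : {set 'I_l} | #|S| == 2) weight sg (m S).
Proof. by []. Qed.

Lemma prod_weight_le : \prod_q weight sg (j q) <= \prod_(S : {set 'I_l} | #|S| == 2) weight sg (m S).
Proof.
rewrite (@off_diag _ _ *%R) => [|k]; last by rewrite j_diag weight0.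
apply: ler_prod => S /cards2P[k [k' [kk' ->]]].
rewrite (@big_two_orders _ _ _ *%R _ k k') //= -j_sum // weightD_le andbT.
by rewrite mulr_ge0 ?weight_ge0.
Qed.

Lemma prod_weight_gap k k' : k != k' -> (0 < j (k, k'))%N -> (0 < j (k', k))%N ->
  \prod_q weight sg (j q) <=
   (1 - (sg ^ sg)%:R^-1) * \prod_(S : {set 'I_l} | #|S| == 2) weight sg (m S).
Proof.
move=> kk' jk jk'.
rewrite (@off_diag _ _ *%R) => [|i]; last by rewrite j_diag weight0.
have S2 : #|[set k; k']| == 2%N by rewrite cards2 kk'.
rewrite (bigD1 [set k; k']) //= [X in _ <= _ * X](bigD1 [set k; k']) //= mulrA.
apply: ler_pM.
- by apply: prodr_ge0 => q _; exact: weight_ge0.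
- by apply: prodr_ge0 => S _; apply: prodr_ge0 => q _; exact: weight_ge0.
- rewrite (@big_two_orders _ _ _ *%R _ k k') //= -j_sum // weightD_gap //.
  by rewrite j_sum // le_sigma.
apply: ler_prod => S /andP[/cards2P[i [i' [ii' ->]]] _].
rewrite (@big_two_orders _ _ _ *%R _ i i') //= -j_sum // weightD_le andbT.
by rewrite mulr_ge0 ?weight_ge0.
Qed.

Lemma prod_bin_le (a : 'I_l * 'I_l -> nat) : (\sum_q a q <= n)%N ->
  (\prod_q 'C(a q, j q))%:R <= \prod_q weight sg (j q).
Proof.
move=> an; rewrite natr_prod.
apply: le_trans (_ : \prod_q (((j q)`!)%:R^-1 * (a q)%:R ^+ j q) <= _).
  by apply: ler_prod => q _; rewrite bin_le_expn ler0n.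
rewrite !big_split /= ler_wpM2l ?prodr_ge0 // => [q _|]; first by rewrite invr_ge0.
exact: weighted_AGM sum_type.
Qed.

End MainTerm.

(** * Zones and the upper bound *)

(* With [warm] and [kappa] the warm and hot indices, this is the paper's set
   A_(k,k') for [q = (k, k')]. *)
Definition zone (l n : nat) (warm kappa : 'I_n -> 'I_l) (q : 'I_l * 'I_l) :=
  [set x | (warm x, kappa x) == q].

Section Zones.
Variables (l n : nat) (warm kappa : 'I_n -> 'I_l).
Local Notation zone := (zone warm kappa).
Local Notation hot := (hot kappa).

Lemma sum_zone : (\sum_q #|zone q| = n)%N.
Proof.
rewrite -[RHS](card_ord n) -sum1_card.
rewrite (partition_big (fun x => (warm x, kappa x)) predT) //=.
by apply: eq_bigr => q _; rewrite -sum1dep_card.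
Qed.

Lemma zone_hot k k' : zone (k, k') \subset hot k'.
Proof. by apply/subsetP => x; rewrite !inE xpair_eqE => /andP[_]. Qed.

Definition off k x := (k != warm x) && (k != kappa x).

(* A tuple of sets avoiding the off coordinates is determined by its free part
   on the hot coordinates and by its traces on the zones. *)
Lemma card_zone_tuples (TT : {set {ffun 'I_l -> {set 'I_n}}}) (j : 'I_l * 'I_l -> nat) :
  (forall t k x, t \in TT -> x \in t k -> ~~ off k x) ->
  (forall t q, t \in TT -> #|t q.1 :&: zone q| = j q) ->
  (#|TT| <= 2 ^ n * \prod_q 'C(#|zone q|, j q))%N.
Proof.
move=> noff tj.
pose D q := [set Z : {set 'I_n} | (Z \subset zone q) && (#|Z| == j q)].
have -> : (\prod_q 'C(#|zone q|, j q) = #|setXn D|)%N.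
  by rewrite cardsXn; apply: eq_bigr => q _; rewrite cards_draws.
have -> : (2 ^ n = #|powerset [set: 'I_n]|)%N by rewrite card_powerset cardsT card_ord.
rewrite -cardsX.
pose code (t : {ffun 'I_l -> {set 'I_n}}) : {set 'I_n} * {dffun forall q : 'I_l * 'I_l, {set 'I_n}} :=
  ([set x | x \in t (kappa x)], [ffun q => t q.1 :&: zone q]).
apply: (card_inj_le (f := code)) => [t u tT uT [/setP E1 /ffunP E2]|t tT].
  apply/ffunP => k; apply/setP => x.
  have [->|xk] := eqVneq k (kappa x); first by have := E1 x; rewrite !inE.
  have [->|xw] := eqVneq k (warm x).
    by have /setP/(_ x) := E2 (warm x, kappa x); rewrite !ffunE !inE !eqxx !andbT.
  have ox : off k x by rewrite /off xk xw.
  by apply/idP/idP => xk'; [have := noff t k x tT xk' | have := noff u k x uT xk']; rewrite ox.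
rewrite in_setX powersetT in_setT /= in_setXn; apply/forallP => q.
by rewrite ffunE inE subsetIr tj // eqxx.
Qed.

End Zones.

Section Count.
Variables (l n : nat) (m : {set 'I_l} -> nat) (F : fam l n).
Hypothesis ext : extremal m F.
Notation eps := (n%:R^-1 : rat).
Variables (warm kappa : 'I_n -> 'I_l) (C3 C4 : rat).
Hypothesis n0 : (0 < n)%N.
Hypothesis C3_ge0 : 0 <= C3.
Hypothesis warm_hot : forall x, warm x != kappa x.
Local Notation hot := (hot kappa).
Local Notation zone := (zone warm kappa).
Local Notation off := (off warm kappa).
Hypothesis p_off : forall k x, off k x -> p F k x <= C4 * eps ^+ 2.
Hypothesis C4_ge0 : 0 <= C4.
Variable j : 'I_l * 'I_l -> nat.
Hypothesis j_diag : forall k, j (k, k) = 0%N.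
Hypothesis j_pr : forall k k', k != k' ->
  pr (F k) (fun B => #|B :&: hot k'| != j (k, k')) <= C3 * eps.
Implicit Types (B : {set 'I_n}) (k : 'I_l) (x : 'I_n).

Let en : n%:R * eps = 1. Proof. by rewrite mulfV // pnatr_eq0 -lt0n. Qed.
Let e0 : 0 <= eps. Proof. by rewrite invr_ge0. Qed.

Lemma sum_p_off k (P : pred 'I_n) : (forall x, P x -> off k x) ->
  \sum_(x | P x) p F k x <= #|P|%:R * (C4 * eps ^+ 2).
Proof.
move=> Po; apply: le_trans (_ : \sum_(x | P x) C4 * eps ^+ 2 <= _).
  by apply: ler_sum => x /Po; exact: p_off.
by rewrite sumr_const mulr_natl.
Qed.

Lemma card_pred_eps (P : pred 'I_n) : #|P|%:R * (C4 * eps ^+ 2) <= C4 * eps.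
Proof.
have X0 : 0 <= C4 * eps ^+ 2 by rewrite mulr_ge0 ?exprn_ge0.
apply: le_trans (_ : n%:R * (C4 * eps ^+ 2) <= _).
  by rewrite ler_wpM2r // ler_nat -[X in (_ <= X)%N](card_ord n) max_card.
by rewrite expr2 mulrCA [n%:R * (_ * _)]mulrA en mul1r.
Qed.

Lemma pr_off k : pr (F k) (fun B => [exists x, off k x && (x \in B)]) <= C4 * eps.
Proof.
apply: le_trans (pr_exists _ _ _) _.
exact: le_trans (sum_p_off (fun x => id)) (card_pred_eps _).
Qed.

Local Notation C5 := (l%:R ^+ 2 * C3 + l%:R * C4).

(** Outside a proportion [C5 / n] of the tuples, all traces on hot sets have their typical size and
    no set contains an off element. Then the trace on [hot k'] is the trace on [zone (k, k')], and
    [card_zone_tuples] applies. *)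
Lemma prod_card_zone_le :
  (1 - C5 * eps) * (\prod_(k < l) #|F k|)%:R <=
   2 ^+ n * (\prod_q 'C(#|zone q|, j q))%:R.
Proof.
have F0 := ext_neq0 ext.
pose bad1 (t : {ffun 'I_l -> {set 'I_n}}) := [exists q : 'I_l * 'I_l, (q.1 != q.2) &&
   (#|t q.1 :&: hot q.2| != j q)].
pose bad2 (t : {ffun 'I_l -> {set 'I_n}}) :=
  [exists k : 'I_l, true && [exists x, off k x && (x \in t k)]].
have H1 : pr (tuples F) bad1 <= l%:R ^+ 2 * (C3 * eps).
  apply: le_trans (pr_exists _ _ _) _.
  apply: le_trans (_ : \sum_(q : 'I_l * 'I_l | q.1 != q.2) C3 * eps <= _).
    apply: ler_sum => -[k k'] /= kk'.
    by rewrite (pr_tuples_marginal F0 k (fun B => #|B :&: hot k'| != j (k, k'))) j_pr.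
  rewrite sumr_const -[X in X <= _]mulr_natl ler_wpM2r ?mulr_ge0 // -natrX ler_nat.
  by apply: leq_trans (max_card _) _; rewrite card_prod card_ord.
have H2 : pr (tuples F) bad2 <= l%:R * (C4 * eps).
  apply: le_trans (pr_exists _ _ _) _.
  apply: le_trans (_ : \sum_(k < l) C4 * eps <= _).
    apply: ler_sum => k _.
    rewrite (pr_tuples_marginal F0 k (fun B => [exists x, off k x && (x \in B)])).
    exact: pr_off.
  by rewrite sumr_const card_ord mulr_natl.
pose TT := [set t in tuples F | ~~ (bad1 t || bad2 t)].
have HT : (1 - C5 * eps) * (\prod_(k < l) #|F k|)%:R <= #|TT|%:R.
  rewrite -card_tuples -pr_mul ler_wpM2r // prC ?tuples_neq0 //.
  have := pr_or (tuples F) bad1 bad2; rewrite mulrDl -!mulrA; lra.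
apply: le_trans HT _; rewrite -natrX -natrM ler_nat.
have TTP t : t \in TT -> ~~ bad1 t /\ ~~ bad2 t.
  by rewrite in_set => /andP[_]; rewrite negb_or => /andP.
have noff t k x : t \in TT -> x \in t k -> ~~ off k x.
  move=> /TTP[_ /existsPn/(_ k) /= /existsPn/(_ x)]; rewrite negb_and.
  by case/orP => // /negPf ->.
apply: card_zone_tuples => // t -[k k'] tT /=.
have [<-|kk'] := eqVneq k k'.
  rewrite j_diag; apply/eqP; rewrite cards_eq0; apply/eqP/setP => x.
  rewrite !inE; apply/negP => /andP[_ /eqP[wk kk]].
  by have := warm_hot x; rewrite wk kk eqxx.
have [/existsPn/(_ (k, k')) /=] := TTP _ tT; rewrite kk' /= negbK => /eqP <- _.
apply: eq_card => x; rewrite !inE; case xt : (x \in t k) => //=.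
have := noff t k x tT xt; rewrite negb_and !negbK xpair_eqE.
case/orP => /eqP E; first by rewrite E eqxx.
by rewrite -E (negPf kk') andbF.
Qed.

End Count.

(** * Product families and the lower bound *)

Section ZoneFamily.
Variables (l n : nat) (m : {set 'I_l} -> nat) (warm kappa : 'I_n -> 'I_l).
Local Notation zone := (zone warm kappa).
Local Notation hot := (hot kappa).
Local Notation off := (off warm kappa).
Hypothesis oriented : forall k k', zone (k, k') = set0 \/ zone (k', k) = set0.
Implicit Types (k : 'I_l) (x : 'I_n) (A B : {set 'I_n}).

(* The families of condition (3) of the theorem; for an index pair that is not
   an edge the zone is empty and the constraint is void. *)
Definition zfam k := [set B : {set 'I_n} | [forall x in B, ~~ off k x] &&
  [forall k', (#|B :&: zone (k, k')| <= m [set k; k'])%N]].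

Lemma zfamP k B : reflect ((forall x, x \in B -> ~~ off k x) /\
    forall k', (#|B :&: zone (k, k')| <= m [set k; k'])%N) (B \in zfam k).
Proof.
rewrite inE; apply: (iffP andP) => -[H1 H2]; split.
- by move=> x xB; apply: (forall_inP H1).
- exact/forallP.
- exact/forall_inP.
- exact/forallP.
Qed.

Lemma zone_diag k : zone (k, k) = set0.
Proof. by case: (oriented k k). Qed.

(** A common element is warm or hot for each of two distinct indices, hence warm for one and hot for
    the other. *)
Lemma zfam_cap k k' A B : k != k' -> A \in zfam k -> B \in zfam k' ->
  A :&: B \subset zone (k, k') :|: zone (k', k).
Proof.
move=> kk' /zfamP[Ao _] /zfamP[Bo _]; apply/subsetP => x /setIP[/Ao ax /Bo bx].
move: ax bx; rewrite /off !negb_and !negbK !inE !xpair_eqE.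
case/orP => /eqP E1 /orP[] /eqP E2; rewrite E1 E2 ?eqxx ?orbT //.
  by rewrite E1 E2 eqxx in kk'.
by rewrite E1 E2 eqxx in kk'.
Qed.

Lemma zfam_overlap k k' A B : k != k' -> A \in zfam k -> B \in zfam k' ->
  (#|A :&: B| <= m [set k; k'])%N.
Proof.
move=> kk' AT BT; have sub := zfam_cap kk' AT BT.
case: (oriented k k') => E; rewrite E ?set0U ?setU0 in sub.
  move/zfamP: BT => [_ /(_ k)]; rewrite setUC; apply: leq_trans.
  by apply: subset_leq_card; rewrite subsetI subsetIr.
move/zfamP: AT => [_ /(_ k')]; apply: leq_trans.
by apply: subset_leq_card; rewrite subsetI subsetIl.
Qed.

Lemma zfam_overlapping : overlapping m [ffun k => zfam k].
Proof. by apply/overlapP => k k' kk' A B; rewrite !ffunE; exact: zfam_overlap. Qed.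

(** The reverse of the encoding of [card_zone_tuples]: the bits of [SD.1] decide membership at the
    hot index and the traces [SD.2] at the warm index. As the two indices differ, all the data can
    be recovered. *)
Lemma prod_card_zfam_ge (j : 'I_l * 'I_l -> nat) :
  (forall k k', (j (k, k') <= m [set k; k'])%N) ->
  (2 ^ n * \prod_q 'C(#|zone q|, j q) <= \prod_(k < l) #|zfam k|)%N.
Proof.
move=> jm.
pose D q := [set Z : {set 'I_n} | (Z \subset zone q) && (#|Z| == j q)].
have -> : (\prod_q 'C(#|zone q|, j q) = #|setXn D|)%N.
  by rewrite cardsXn; apply: eq_bigr => q _; rewrite cards_draws.
have -> : (2 ^ n = #|powerset [set: 'I_n]|)%N by rewrite card_powerset cardsT card_ord.
rewrite -cardsX -(cardsXn (fun k => zfam k)).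
pose code (SD : {set 'I_n} * {dffun forall q : 'I_l * 'I_l, {set 'I_n}}) :
    {dffun forall k : 'I_l, {set 'I_n}} :=
  [ffun k => [set x in SD.1 | kappa x == k] :|: [set x | (warm x == k) && (x \in SD.2 (k, kappa x))]].
have nwh x : warm x != kappa x.
  apply/eqP => E; have : x \in zone (kappa x, kappa x) by rewrite inE E.
  by rewrite zone_diag inE.
have DP (SD : {set 'I_n} * {dffun forall q : 'I_l * 'I_l, {set 'I_n}}) q :
    SD \in setX (powerset [set: 'I_n]) (setXn D) -> SD.2 q \subset zone q /\ #|SD.2 q| = j q.
  by case: SD => S DD; rewrite in_setX => /andP[_ /setXnP/(_ q)]; rewrite inE => /andP[? /eqP].
apply: (card_inj_le (f := code)) => [SD SD' SDX SDX' /ffunP E|SD SDX].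
  rewrite (surjective_pairing SD) (surjective_pairing SD'); congr (_, _).
    apply/setP => x; have /setP/(_ x) := E (kappa x); rewrite !ffunE !inE eqxx !andbT.
    by rewrite (negPf (nwh x)) !orbF.
  apply/ffunP => q; apply/setP => x.
  have [xq|xq] := boolP (x \in zone q); last first.
    by apply/idP/idP => H; [have [/subsetP/(_ x H)] := DP _ q SDX | have [/subsetP/(_ x H)] := DP _ q SDX'];
       rewrite (negPf xq).
  move: xq; rewrite inE => /eqP <-.
  have /setP/(_ x) := E (warm x); rewrite !ffunE !inE eqxx [kappa x == _]eq_sym (negPf (nwh x)).
  by rewrite !andbF.
apply/setXnP => k; rewrite ffunE; apply/zfamP; split=> [x|k'].
  by rewrite !inE /off negb_and !negbK ![k == _]eq_sym => /orP[/andP[_ ->]|/andP[->]] //; rewrite orbT.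
apply: leq_trans (jm k k'); have [_ <-] := DP _ (k, k') SDX.
apply/subset_leq_card/subsetP => x; rewrite !inE xpair_eqE.
move=> /andP[/orP[/andP[_ /eqP E1]|/andP[_ xD]] /andP[/eqP E2 /eqP E3]].
  by have := nwh x; rewrite E1 E2 eqxx.
by rewrite -E3.
Qed.

End ZoneFamily.

Lemma bin_ge_expn a j : (a - j)%N%:R ^+ j * (j`!)%:R^-1 <= 'C(a, j)%:R :> rat.
Proof.
rewrite ler_pdivrMr ?ltr0n ?fact_gt0 // -natrM bin_ffact -natrX ler_nat.
elim: j => [|j IH]; first by rewrite ffactn0.
rewrite ffactnSr expnSr; apply: leq_mul; last by rewrite leq_sub2l.
apply: leq_trans IH; case: j => // j; rewrite leq_exp2r //.
by rewrite leq_sub2l.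
Qed.

Section LowerBound.
Variables (l : nat) (m : {set 'I_l} -> nat) (n : nat).
Local Notation sg := (sigma m).
Notation eps := (n%:R^-1 : rat).
Hypothesis s0 : (0 < sg)%N.
Hypothesis n_big : (2 * sg <= n)%N.

(** Any orientation serves for the lower bound; here each pair is oriented from the smaller index to
    the larger. *)
Let j (q : 'I_l * 'I_l) : nat := if (q.1 < q.2)%N then m [set q.1; q.2] else 0.

Let j_diag k : j (k, k) = 0%N. Proof. by rewrite /j /= ltnn. Qed.

Let j_sum k k' : k != k' -> (j (k, k') + j (k', k) = m [set k; k'])%N.
Proof. by rewrite /j /= setUC -val_eqE; case: ltngtP => // _ _; rewrite addn0 // setUC. Qed.

(** Giving each element of the ground set the label of its residue modulo [sg] will then produce
    zones of the right proportions. *)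
Lemma exists_labels : exists lab : 'I_sg -> 'I_l * 'I_l, forall q, #|[set i | lab i == q]| = j q.
Proof.
have js := sum_type j_diag j_sum.
pose T : finType := {q : 'I_l * 'I_l & 'I_(j q)}.
have cT : #|T| = sg.
  rewrite (card_tagged (fun q => 'I_(j q))) sumnE big_map big_enum -js.
  by apply: eq_bigr => q _; rewrite card_ord.
exists (fun i => tag (enum_val (cast_ord (esym cT) i))) => q.
transitivity #|[set: 'I_(j q)]|; last by rewrite cardsT card_ord.
pose g (i : 'I_(j q)) : 'I_sg := cast_ord cT (enum_rank (Tagged (fun q => 'I_(j q)) i : T)).
have gI : injective g.
  move=> i i' H; have := enum_rank_inj (cast_ord_inj H); exact: eq_from_Tagged.
rewrite -(card_imset _ gI); apply: eq_card => i; rewrite inE; apply/eqP/imsetP => [E|[i' _ ->]].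
  move: E; case Ei: (enum_val _) => [q' i'] /= Eq; subst q'; exists i'; first by rewrite in_setT.
  rewrite [RHS](_ : _ = cast_ord cT (enum_rank (enum_val (cast_ord (esym cT) i)))).
    by rewrite enum_valK cast_ordKV.
  by rewrite Ei.
by rewrite /g cast_ordK enum_rankK.
Qed.

Lemma s_star_ge : (1 - 2 * sg%:R ^+ 2 * eps) * main_term m n <= (s_star n m)%:R.
Proof.
have n0 : (0 < n)%N by apply: leq_trans n_big; rewrite muln_gt0.
have [lab Hlab] := exists_labels.
pose lb (x : 'I_n) := lab (Ordinal (ltn_pmod x s0)).
pose warm x := (lb x).1; pose kappa x := (lb x).2.
have zE q : zone warm kappa q = [set x | lb x == q].
  by apply/setP => x; rewrite !inE /warm /kappa; case: (lb x).
have jz q : j q = 0%N -> zone warm kappa q = set0.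
  rewrite -Hlab => /eqP; rewrite cards_eq0 => /eqP/setP H; rewrite zE.
  by apply/setP => x; have := H (Ordinal (ltn_pmod x s0)); rewrite !inE.
have oriented k k' : zone warm kappa (k, k') = set0 \/ zone warm kappa (k', k) = set0.
  have [kk'|kk'] := ltnP k k'; [right|left]; apply: jz; rewrite /j /=.
    by rewrite ltnNge ltnW.
  by rewrite ltnNge kk'.
have zcard q : (j q * (n %/ sg) <= #|zone warm kappa q|)%N.
  rewrite -Hlab zE -[X in (_ * X)%N](card_ord (n %/ sg)) -[X in (_ * X)%N]cardsT -cardsX.
  have bnd (i : 'I_sg) (r : 'I_(n %/ sg)) : (r * sg + i < n)%N.
    apply: leq_trans (_ : (r.+1 * sg <= _)%N).
      by rewrite mulSn addnC ltn_add2r.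
    by apply: leq_trans (leq_divM n sg); rewrite leq_mul2r ltn_ord orbT.
  apply: (card_inj_le (f := fun ir : 'I_sg * 'I_(n %/ sg) => Ordinal (bnd ir.1 ir.2))).
    move=> [i r] [i' r'] _ _ /(congr1 val) /= E.
    have Ei : i = i' :> nat.
      by have := congr1 (modn^~ sg) E; rewrite !modnMDl !modn_small.
    have Er : r = r' :> nat.
      by have := congr1 (divn^~ sg) E; rewrite !divnMDl // (divn_small (ltn_ord i)) (divn_small (ltn_ord i')) !addn0.
    by congr (_, _); exact: val_inj.
  move=> [i r]; rewrite !inE andbT /lb => /eqP <-; apply/eqP; congr lab; apply: val_inj.
  by rewrite /= modnMDl modn_small.
have := prod_card_zfam_ge (m := m) oriented (j := j).
have jm k k' : (j (k, k') <= m [set k; k'])%N by rewrite /j /=; case: ifP.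
move=> /(_ jm) H.
have {}H : (2 ^ n * \prod_q 'C(#|zone warm kappa q|, j q) <= s_star n m)%N.
  apply: leq_trans H _.
  rewrite (eq_bigr (fun k => #|[ffun k => zfam m warm kappa k] k|)) => [|k _]; last by rewrite ffunE.
  exact: (leq_bigmax_cond (F := fun G : fam l n => \prod_(k < l) #|G k|)%N) (zfam_overlapping m oriented).
rewrite -(ler_nat rat) in H; apply: le_trans H; rewrite natrM natrX main_termE mulrCA.
rewrite ler_wpM2l ?exprn_ge0 //.
have -> : \prod_(S : {set 'I_l} | #|S| == 2) weight n sg (m S) = \prod_q weight n sg (j q).
  rewrite (@off_diag _ _ _ *%R) => [|k]; last by rewrite j_diag weight0.
  apply: eq_bigr => S /cards2P[k [k' [kk' ->]]].
  rewrite (@big_two_orders _ _ _ *%R _ k k') //= -(j_sum kk') /j /=.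
  case: ltngtP => [_|_|/val_inj E]; last by rewrite E eqxx in kk'.
    by rewrite addn0 weight0 mulr1.
  by rewrite add0n weight0 mul1r.
rewrite natr_prod.
have np : 0 < n%:R :> rat by rewrite ltr0n.
have sp : 0 < sg%:R :> rat by rewrite ltr0n.
(* This makes [n / sg * d = 2]: one unit pays for rounding in [n %/ sg], the other for the falling
   factorial. The [sg] factors [1 - d] then cost at most [sg * d] together. *)
pose d : rat := 2 * sg%:R * eps.
have d1 : d <= 1 by rewrite /d ler_pdivrMr // mul1r -natrM ler_nat.
have d0 : 0 <= d by rewrite /d mulr_ge0 ?mulr_ge0 // invr_ge0 ltW.
apply: le_trans (_ : \prod_q (weight n sg (j q) * (1 - d) ^+ j q) <= _); last first.
  apply: ler_prod => q _; rewrite mulr_ge0 ?weight_ge0 ?exprn_ge0 ?subr_ge0 //=.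
  apply: le_trans (bin_ge_expn _ _); rewrite /weight -mulrA mulrC -exprMn.
  rewrite ler_wpM2r ?invr_ge0 //; apply: lerXn2r; rewrite ?nnegrE //.
    by rewrite mulr_ge0 ?divr_ge0 // subr_ge0.
  have [->|jq] := posnP (j q); first by rewrite mul0n !mul0r.
  have dn : d * n%:R = 2 * sg%:R by rewrite /d divfK // gt_eqF.
  apply: le_trans (_ : (j q * (n %/ sg))%N%:R - (j q)%:R <= _); last first.
    have [h|h] := leqP (j q) #|zone warm kappa q|.
      by rewrite natrB // lerD2r ler_nat.
    by apply: le_trans (_ : 0 <= _); rewrite // subr_le0 ler_nat (leq_trans (zcard q)) // ltnW.
  have E : n%:R / sg%:R * d = 2 by rewrite mulrAC [n%:R * d]mulrC dn mulfK // gt_eqF.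
  rewrite -mulrA natrM -[_ * n%:R * _]mulrA [n%:R * _]mulrA mulrBr mulr1 E.
  rewrite natrM -[X in _ <= _ - X]mulr1 -mulrBr ler_wpM2l //.
  have : n%:R / sg%:R <= (n %/ sg)%:R + 1 :> rat.
    rewrite ler_pdivrMr // natr1 -natrM ler_nat mulSn addnC {1}(divn_eq n sg) leq_add2l.
    by rewrite ltnW // ltn_pmod.
  lra.
rewrite [X in _ <= X]big_split /= [X in X <= _]mulrC ler_wpM2l ?prodr_ge0 // => [q _|]; first exact: weight_ge0.
rewrite -expr_sum (sum_type j_diag j_sum) -[X in _ <= _ ^+ X]card_ord -prodr_const.
apply: le_trans (prod_1sub _); last by move=> i _; rewrite d0.
rewrite sumr_const card_ord (_ : d *+ sg = 2 * sg%:R ^+ 2 * eps) //.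
by rewrite -[LHS]mulr_natr /d expr2 mulrAC !mulrA.
Qed.

End LowerBound.

Local Close Scope ring_scope.

(** * Deficient members and stars of the product families *)

Section Deficit.
Variables (T : finType) (Q : {set {set T}}) (A : {set T}) (M : nat).
Implicit Types (B : {set T}) (y z : T).
Hypothesis Q_cap : forall B, B \in Q -> #|B :&: A| <= M.
Hypothesis Q_del : forall B z, B \in Q -> z \in A -> B :\ z \in Q.
Hypothesis Q_add : forall B z, B \in Q -> z \in A -> #|B :&: A| < M -> z |: B \in Q.

Definition deficient := [set B in Q | #|B :&: A| < M].

(** Deleting [y] and adding [y] are injections in the two directions: a member loses its maximal
    trace by the deletion, and a deficient member accepts the addition. *)
Lemma deg_deficient y : y \in A ->
  #|[set B in Q | y \in B]| = #|[set B in deficient | y \notin B]|.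
Proof.
move=> yA; apply/eqP; rewrite eqn_leq; apply/andP; split.
  apply: (card_inj_le (f := fun B => B :\ y)) => [B C|B].
    by rewrite !inE => /andP[_ yB] /andP[_ yC] E; rewrite -(setD1K yB) -(setD1K yC) E.
  rewrite !inE eqxx andbT => /andP[BQ yB]; rewrite Q_del //=.
  apply: leq_trans (Q_cap BQ); apply: proper_card; apply/properP; split.
    by apply: setSI; rewrite subsetDl.
  by exists y; rewrite !inE ?yB ?yA ?eqxx.
apply: (card_inj_le (f := fun B => y |: B)) => [B C|B].
  by rewrite !inE => /andP[_ yB] /andP[_ yC] E; rewrite -(setU1K yB) -(setU1K yC) E.
by rewrite !inE eqxx andbT => /andP[/andP[BQ BM] _]; exact: Q_add.
Qed.

Lemma sum_deg_deficient :
  \sum_(y in A) #|[set B in Q | y \in B]| + \sum_(B in deficient) #|B :&: A| = #|A| * #|deficient|.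
Proof.
rewrite sum_card_in -big_split /= -sum_nat_const; apply: eq_bigr => y yA.
rewrite deg_deficient // addnC -[RHS](cardsID [set B : {set T} | y \in B]).
by congr (_ + _); apply: eq_card => B; rewrite !inE // andbC.
Qed.

(** Each member that is not deficient contributes [M] to the degree sum of [sum_deg_deficient]. The
    proportion of deficient members is thus at least [M / (#|A| + M)], while [deficient_le] bounds
    it by [2 * M / #|A|]. *)
Lemma deficient_ge : M * #|Q| <= (#|A| + M) * #|deficient|.
Proof.
rewrite mulnDl -sum_deg_deficient -sum_card_in -addnA.
have -> : #|Q| = #|deficient| + #|Q :\: deficient|.
  by rewrite -(cardsID deficient Q) (setIidPr _) //; apply/subsetP => B; rewrite inE => /andP[].
rewrite mulnDr addnC; apply: leq_add; last exact: leq_addl.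
rewrite (bigID (mem deficient)) /=; apply: leq_trans (leq_addl _ _).
rewrite mulnC -sum_nat_const; apply: leq_trans (_ : \sum_(B in Q :\: deficient) #|B :&: A| <= _).
  by apply: leq_sum => B; rewrite !inE negb_and => /andP[/orP[/negPf->//|H] _]; rewrite leqNgt.
by apply: eq_leq; apply: eq_bigl => B; rewrite in_setD andbC.
Qed.

Lemma deficient_le : #|A| * #|deficient| <= 2 * M * #|Q|.
Proof.
rewrite -sum_deg_deficient -sum_card_in -mulnA mul2n -addnn; apply: leq_add.
  by rewrite mulnC -sum_nat_const; exact: leq_sum.
apply: leq_trans (_ : \sum_(B in deficient) M <= _).
  by apply: leq_sum => B; rewrite inE => /andP[/Q_cap].
rewrite sum_nat_const mulnC leq_mul2l; apply/orP; right.
by apply/subset_leq_card/subsetP => B; rewrite inE => /andP[].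
Qed.

Lemma deg_le_deficient y : y \in A -> #|[set B in Q | y \in B]| <= #|deficient|.
Proof.
move=> yA; rewrite deg_deficient //; apply/subset_leq_card/subsetP => B.
by rewrite inE => /andP[].
Qed.

End Deficit.

(** * The proportion of a product family lying above one of its members *)

Section StarBound.
Variables (l n : nat) (m : {set 'I_l} -> nat) (warm kappa : 'I_n -> 'I_l).
Local Notation zone := (zone warm kappa).
Local Notation hot := (hot kappa).
Local Notation off := (off warm kappa).
Local Notation zfam := (zfam m warm kappa).
Hypothesis warm_hot : forall x, warm x != kappa x.
Implicit Types (k : 'I_l) (x y z : 'I_n) (A B G : {set 'I_n}).

Lemma zfam_down k : downset (zfam k).
Proof.
move=> A B AB /zfamP[H1 H2]; apply/zfamP; split=> [x xA|k'].
  by apply: H1; apply: (subsetP AB).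
by apply: leq_trans (H2 k'); apply: subset_leq_card; exact: setSI.
Qed.

Lemma zfam_add k k' B z : B \in zfam k -> z \in zone (k, k') ->
  #|B :&: zone (k, k')| < m [set k; k'] -> z |: B \in zfam k.
Proof.
move=> /zfamP[H1 H2]; rewrite inE xpair_eqE => /andP[/eqP wz /eqP kz] lt; apply/zfamP.
split=> [x|k''].
  by move=> /setU1P[->|/H1 //]; rewrite /off wz eqxx.
have [->|ne] := eqVneq k'' k'.
  rewrite setIUl; apply: leq_trans (leq_card_setU _ _) _.
  apply: leq_trans (_ : 1 + #|B :&: zone (k, k')| <= _); last by [].
  by rewrite leq_add2r (leq_trans (subset_leq_card (subsetIl _ _))) // cards1.
rewrite (_ : (z |: B) :&: _ = B :&: zone (k, k'')) //; apply/setP => x; rewrite !inE.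
case: (eqVneq x z) => [->|] //=; rewrite kz xpair_eqE [k' == k'']eq_sym (negPf ne).
by rewrite !andbF.
Qed.

Lemma zfam_add_hot k B y : kappa y = k -> B \in zfam k -> y |: B \in zfam k.
Proof.
move=> ky /zfamP[H1 H2]; apply/zfamP; split=> [x|k'].
  by move=> /setU1P[->|/H1 //]; rewrite /off ky eqxx andbF.
rewrite (_ : (y |: B) :&: _ = B :&: zone (k, k')) //; apply/setP => x; rewrite !inE.
case: (eqVneq x y) => [->|] //=; rewrite xpair_eqE ky.
by have := warm_hot y; rewrite ky => /negPf ->; rewrite andbF.
Qed.

Lemma star_step_hot k G y : kappa y = k ->
  #|star (zfam k) G| <= 2 * #|star (zfam k) (y |: G)|.
Proof.
move=> ky; rewrite mul2n -addnn -(cardsID [set B : {set 'I_n} | y \in B]); apply: leq_add.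
  apply/subset_leq_card/subsetP => B; rewrite !inE subUset sub1set.
  by move=> /andP[/andP[-> ->] ->].
apply: (card_inj_le (f := fun B => y |: B)) => [B C|B].
  by rewrite !inE => /andP[yB _] /andP[yC _] E; rewrite -(setU1K yB) -(setU1K yC) E.
move=> /setDP[BS _]; have /andP[BT GB] : (B \in zfam k) && (G \subset B).
  by move: BS; rewrite inE.
by rewrite inE (zfam_add_hot ky BT) setUS.
Qed.

(** A set above [G] contains [y], or has room for it in the zone, or becomes able to take it once
    some [z] outside [G] is removed from the zone. In the last case [z] is recorded, whence the
    factor [1 + 1 + n]. *)
Lemma star_step_warm k G y : y \notin G -> warm y = k -> y |: G \in zfam k ->
  #|star (zfam k) G| <= n.+2 * #|star (zfam k) (y |: G)|.
Proof.
move=> yG wy yGT; set S := star (zfam k) (y |: G).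
pose A := zone (k, kappa y); pose M := m [set k; kappa y].
have yA : y \in A by rewrite inE wy.
have SP B : B \in star (zfam k) G -> B \in zfam k /\ G \subset B by rewrite inE => /andP.
have inS B : B \in zfam k -> y |: G \subset B -> B \in S by move=> BT GB; rewrite /S inE BT.
rewrite -(cardsID [set B : {set 'I_n} | y \in B]).
have H1 : #|star (zfam k) G :&: [set B : {set 'I_n} | y \in B]| <= #|S|.
  apply/subset_leq_card/subsetP => B /setIP[/SP[BT GB]]; rewrite inE => yB; apply: inS => //.
  by rewrite subUset sub1set yB.
have H2 : #|star (zfam k) G :\: [set B : {set 'I_n} | y \in B]| <= #|S| + n * #|S|.
  rewrite -(cardsID [set B : {set 'I_n} | #|B :&: A| < M]); apply: leq_add.
    apply: (card_inj_le (f := fun B => y |: B)) => [B C|B].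
      move=> /setIP[/setDP[_ yB] _] /setIP[/setDP[_ yC] _] E; rewrite inE in yB; rewrite inE in yC.
      by rewrite -(setU1K yB) -(setU1K yC) E.
    move=> /setIP[/setDP[/SP[BT GB] _]]; rewrite inE => BM.
    by apply: inS; [exact: zfam_add BM | exact: setUS].
  have -> : n * #|S| = #|setX S [set: 'I_n]| by rewrite cardsX cardsT card_ord mulnC.
  (* Since [y |: G] obeys the zone bound and contains [y], the trace of [G] on [A] has fewer than
     [M] elements, whereas that of [B] has at least [M]. *)
  have pickz B : B \in (star (zfam k) G :\: [set B : {set 'I_n} | y \in B]) :\: [set B : {set 'I_n} | #|B :&: A| < M] ->
      exists z, [/\ z \in B, z \in A & z \notin G].
    move=> /setDP[/setDP[/SP[BT GB] yB] BM]; rewrite !inE in yB BM.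
    have : ~~ ((B :&: A) \subset (G :&: A)).
      apply: contra BM => /subset_leq_card H; apply: leq_ltn_trans H _.
      move/zfamP: yGT => [_ /(_ (kappa y))]; apply: leq_trans; apply: proper_card.
      apply/properP; split; first by apply: setSI; exact: subsetUr.
      by exists y; rewrite !inE ?eqxx ?wy ?eqxx // (negPf yG).
    by move=> /subsetPn[z /setIP[zB zA] H]; exists z; split=> //; move: H; rewrite inE zA andbT.
  pose f B := if [pick z | [&& z \in B, z \in A & z \notin G]] is Some z then (y |: (B :\ z), z) else (B, y).
  apply: (card_inj_le (f := f)) => [B C HB HC|B HB].
    have yB : y \notin B by move: HB => /setDP[/setDP[_]]; rewrite inE.
    have yC : y \notin C by move: HC => /setDP[/setDP[_]]; rewrite inE.
    rewrite /f; case: pickP => [z /and3P[zB _ _]|none]; last first.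
      by have [z [a b c]] := pickz B HB; have := none z; rewrite a b c.
    case: pickP => [z' /and3P[zC _ _]|none]; last first.
      by have [z' [a b c]] := pickz C HC; have := none z'; rewrite a b c.
    move=> [E zz']; rewrite -(setD1K zB) -(setD1K zC) -zz'; congr (_ |: _).
    have yBz : y \notin B :\ z by rewrite !inE negb_and yB orbT.
    have yCz : y \notin C :\ z' by rewrite !inE negb_and yC orbT.
    by rewrite -(setU1K yBz) E setU1K // zz'.
  rewrite /f; case: pickP => [z /and3P[zB zA zG]|none]; last first.
    by have [z [a b c]] := pickz B HB; have := none z; rewrite a b c.
  move: HB => /setDP[/setDP[/SP[BT GB] _] _]; rewrite in_setX in_setT andbT /=.
  apply: inS; last first.
    by apply: setUS; rewrite subsetD1 GB.
  apply: (@zfam_add k (kappa y)) => //; first exact: zfam_down (subsetDl _ _) BT.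
  move/zfamP: BT => [_ /(_ (kappa y))]; apply: leq_trans; apply: proper_card.
  apply/properP; split; first by apply: setSI; rewrite subsetDl.
  by exists z; rewrite ?in_setI ?zB ?zA // !inE eqxx.
by apply: leq_trans (leq_add H1 H2) _; rewrite addnA addnn -mul2n -mulnDl add2n.
Qed.

Lemma star_ge k G : G \in zfam k ->
  #|zfam k| <= 2 ^ #|G :&: hot k| * n.+2 ^ #|G :\: hot k| * #|star (zfam k) G|.
Proof.
move Es : #|G| => s; elim: s G Es => [|s IH] G.
  move/eqP; rewrite cards_eq0 => /eqP -> _; rewrite set0I set0D cards0 !mul1n.
  by apply/subset_leq_card/subsetP => B BT; rewrite inE BT sub0set.
move=> Gs GT; have /set0Pn[y yG] : G != set0 by rewrite -card_gt0 Gs.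
have cV : #|G :\ y| = s by move: Gs; rewrite (cardsD1 y) yG => -[].
have VT : G :\ y \in zfam k by apply: zfam_down GT; rewrite subsetDl.
apply: leq_trans (IH _ cV VT) _; have yV : y \notin G :\ y by rewrite !inE eqxx.
have [ky|ky] := eqVneq (kappa y) k.
  have := star_step_hot (G :\ y) ky; rewrite setD1K // => H.
  apply: leq_trans (leq_mul (leqnn _) H) _.
  have -> : #|G :&: hot k| = #|(G :\ y) :&: hot k|.+1.
    rewrite (cardsD1 y (G :&: _)) !inE yG ky eqxx; congr _.+1.
    by apply: eq_card => x; rewrite !inE andbA.
  have -> : (G :\ y) :\: hot k = G :\: hot k.
    by apply/setP => x; rewrite !inE; case: (eqVneq x y) => [->|] //=; rewrite ky eqxx.
  apply: eq_leq; rewrite expnS; move: (2 ^ _) (n.+2 ^ _) #|star _ _| => u v w; ring.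
have wy : warm y = k.
  move/zfamP: GT => [/(_ y yG) + _]; rewrite /off negb_and !negbK [k == kappa y]eq_sym (negPf ky) orbF.
  by move/eqP.
have := star_step_warm yV wy; rewrite setD1K // => /(_ GT) H.
apply: leq_trans (leq_mul (leqnn _) H) _.
have -> : #|G :\: hot k| = #|(G :\ y) :\: hot k|.+1.
  rewrite (cardsD1 y (G :\: _)) !inE yG (negPf ky); congr _.+1.
  by apply: eq_card => x; rewrite !inE andbCA.
have -> : (G :\ y) :&: hot k = G :&: hot k.
  by apply/setP => x; rewrite !inE; case: (eqVneq x y) => [->|] //=; rewrite (negPf ky) andbF.
apply: eq_leq; rewrite expnS; move: (n.+2) (2 ^ _) (n.+2 ^ _) #|star _ _| => r u v w; ring.
Qed.

End StarBound.

Local Open Scope ring_scope.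

(** * Empty zones *)

(** After [i] choices the union [V] of the chosen sets has at most [w * i] elements, so the
    hypothesis supplies one more set disjoint from it. *)
Lemma greedy_disjoint (T : finType) (P : pred {set T}) w q :
  (forall V : {set T}, (#|V| <= w * q)%N -> exists U : {set T}, [/\ P U, (#|U| <= w)%N & [disjoint U & V]]) ->
  exists Us : seq {set T}, [/\ size Us = q, forall U, U \in Us -> P U /\ (#|U| <= w)%N &
     pairwise (fun U V : {set T} => [disjoint U & V]) Us].
Proof.
move=> H; suff: forall i, (i <= q)%N -> exists Us : seq {set T},
   [/\ size Us = i, forall U, U \in Us -> P U /\ (#|U| <= w)%N,
     pairwise (fun U V : {set T} => [disjoint U & V]) Us &
     exists2 V : {set T}, (#|V| <= w * i)%N & forall U, U \in Us -> U \subset V].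
  by move=> /(_ q (leqnn q))[Us [a b c _]]; exists Us.
elim=> [_|i IH iq]; first by exists [::]; split=> //; exists set0; rewrite ?cards0.
have [Us [sU PU dU [V Vi UV]]] := IH (ltnW iq).
have [|U [PU' Uw UdV]] := H V; first by apply: leq_trans Vi _; rewrite leq_mul2l ltnW ?orbT.
exists (U :: Us); split=> /=; first by rewrite sU.
- by move=> W; rewrite inE => /orP[/eqP ->|/PU].
- rewrite dU andbT; apply/allP => W WU; rewrite disjoint_sym.
  by apply: disjointWl (UV W WU) _; rewrite disjoint_sym.
exists (U :|: V).
  by apply: leq_trans (leq_card_setU _ _) _; rewrite mulnS leq_add.
move=> W; rewrite inE => /orP[/eqP ->|/UV]; first exact: subsetUl.
by move=> WV; rewrite (subset_trans WV) // subsetUr.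
Qed.

Section ZoneEmpty.
Variables (l n : nat) (m : {set 'I_l} -> nat) (F : fam l n).
Hypothesis ext : extremal m F.
Notation eps := (n%:R^-1 : rat).
Variables (warm kappa : 'I_n -> 'I_l) (C0 C2 C3 c1 : rat).
Hypothesis n0 : (0 < n)%N.
Hypothesis C0_ge0 : 0 <= C0.
Hypothesis C2_ge0 : 0 <= C2.
Hypothesis hot_ge : forall x, 1/2 - C2 * eps <= p F (kappa x) x.
Hypothesis hot_le : forall x k, k != kappa x -> p F k x <= C2 * eps.
Hypothesis card_low : 2 ^+ n * n%:R ^+ sigma m <= C0 * (\prod_(k < l) #|F k|)%:R.
Local Notation sg := (sigma m).
Hypothesis delta_small : 2 ^+ sg.+1 * (2 * C2 * eps) <= 1/2.
Local Notation hot := (hot kappa).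
Local Notation zone := (zone warm kappa).
Implicit Types (U B D V Z : {set 'I_n}) (k : 'I_l) (x y : 'I_n).
Variables (dd q : nat).
Hypothesis expo : forall q w, (0 < w)%N -> (w <= sg)%N -> (n <= dd * q)%N ->
  C0 * n.+1%:R ^+ (sg * l.+1) * (1 - 2 ^- w) ^+ q <= eps ^+ (sg + 4).
Hypothesis q_big : (n <= dd * q)%N.

(** As [F k] is a downset, a member containing [y] contains no [U] with [y |: U] outside [F k]. The
    hypothesis lets [q] such [U] be chosen disjoint, so [pr_avoid] applies. *)
Lemma p_tiny k y w : (0 < w)%N -> (w <= sg)%N ->
  (forall V, (#|V| <= w * q)%N -> exists U : {set 'I_n},
     [/\ U \subset hot k, (#|U| <= w)%N, y |: U \notin F k & [disjoint U & V]]) ->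
  p F k y <= eps ^+ (sg + 4).
Proof.
move=> w0 ws H.
have [|Us [sU PU dU]] := @greedy_disjoint _ (fun U : {set 'I_n} => (U \subset hot k) && (y |: U \notin F k)) w q.
  by move=> V /H[U [a b c d]]; exists U; rewrite a c.
apply: le_trans (expo w0 ws q_big); rewrite -sU.
apply: (pr_avoid ext n0 C0_ge0 C2_ge0 hot_ge card_low delta_small) => //.
  by move=> U /PU[/andP[]].
move=> B U BF yB /PU[/andP[_ yU] _]; apply: contra yU => UB.
by apply: ext_down ext _ _ _ _ BF; rewrite subUset sub1set yB.
Qed.

(** The second alternative is what the exchange uses: a non-negligible [y] combines with all
    [w]-sets of hot elements outside a small exceptional set. *)
Lemma p_tiny_or k y w : (0 < w)%N -> (w <= sg)%N ->
  p F k y <= eps ^+ (sg + 4) \/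
  exists2 V : {set 'I_n}, (#|V| <= w * q)%N & forall D, D \subset hot k -> #|D| = w ->
    [disjoint D & V] -> y |: D \in F k.
Proof.
move=> w0 ws.
have [/existsP[V /andP[Vw /forallP HV]]|] := boolP [exists V : {set 'I_n}, (#|V| <= w * q)%N &&
   [forall D : {set 'I_n}, [&& D \subset hot k, #|D| == w & [disjoint D & V]] ==> (y |: D \in F k)]].
  by right; exists V => // D a b c; apply: (implyP (HV D)); rewrite a b eqxx c.
move=> /existsPn H; left; apply: (@p_tiny k y w) => // V Vw.
have := H V; rewrite Vw /= => /forallPn[D]; rewrite negb_imply => /andP[/and3P[a /eqP b c] d].
by exists D; rewrite b.
Qed.

Variable j : 'I_l * 'I_l -> nat.
Hypothesis j_sum : forall k k', k != k' -> (j (k, k') + j (k', k) = m [set k; k'])%N.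
Hypothesis j_pr : forall k k', k != k' ->
  pr (F k) (fun B => #|B :&: hot k'| != j (k, k')) <= C3 * eps.
Hypothesis warm_hot : forall x, warm x != kappa x.
Hypothesis warm_ge : forall x, c1 * eps <= p F (warm x) x.
Hypothesis c1_gt0 : 0 < c1.
Hypothesis q_small : (sg * q)%:R * (C2 * eps) <= 1/8.
Hypothesis C2_small : C2 * eps <= 1/8.
Hypothesis C3_small : C3 * eps <= 1/8.
Hypothesis tiny2 : eps ^+ (sg + 4) < c1 * eps.

Lemma p_gt0_in k y : 0 < p F k y -> [set y] \in F k.
Proof.
move=> /pr_gt0_ex[B BF yB]; apply: ext_down ext _ _ _ _ BF.
by rewrite sub1set.
Qed.

Lemma e_gt0 : 0 < eps. Proof. by rewrite invr_gt0 ltr0n. Qed.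

Lemma p_warm_gt0 y : 0 < p F (warm y) y.
Proof. by apply: lt_le_trans (warm_ge y); rewrite mulr_gt0 // e_gt0. Qed.

Lemma p_hot_gt0 y : 0 < p F (kappa y) y.
Proof. by apply: lt_le_trans (hot_ge y); have := C2_small; lra. Qed.

Lemma m_gt0_of_p k k' y : k != k' -> 0 < p F k y -> 0 < p F k' y -> (0 < m [set k; k'])%N.
Proof.
move=> kk' /p_gt0_in yk /p_gt0_in yk'; have := ext_overlap ext kk' yk yk'.
by rewrite setIid cards1.
Qed.

(** Let [x] be in the zone. A typical member [B] of [F k'] containing [x] has [m] elements in
    [hot k]; together with [x] they meet [B] in [m + 1] elements and so cannot belong to [F k]. Such
    obstructions can be found outside any small [V], so [p_tiny] contradicts the warmth of [x]. *)
Lemma zone_empty k k' : j (k, k') = 0%N -> zone (k, k') = set0.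
Proof.
move=> jk; apply/eqP; apply: contraT => /set0Pn[x]; rewrite inE xpair_eqE.
move=> /andP[/eqP wx /eqP kx]; have kk' : k != k' by rewrite -wx -kx.
have k'k : k' != k by rewrite eq_sym.
have m0 : (0 < m [set k; k'])%N.
  by apply: (@m_gt0_of_p k k' x) => //; [rewrite -wx p_warm_gt0 | rewrite -kx p_hot_gt0].
have ms : (m [set k; k'] <= sg)%N by rewrite le_sigma // cards2 kk'.
suff : p F k x <= eps ^+ (sg + 4) by have := warm_ge x; rewrite wx => a b; have := lt_le_trans tiny2 a; rewrite ltNge b.
apply: (p_tiny m0 ms) => V Vw.
have jk' : j (k', k) = m [set k; k'] by rewrite -(j_sum kk') jk.
(* The three failure probabilities are at most 5/8, 1/8 and 1/8; the last uses that elements of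
   [hot k] are rare in [F k']. *)
have [|B BF] := pr_lt1_ex (ext_neq0 ext k') (Q := fun B => (x \notin B) ||
   ((#|B :&: hot k| != j (k', k)) || [exists v, (v \in V :&: hot k) && (v \in B)])).
  apply: le_lt_trans (pr_or _ _ _) _; apply: le_lt_trans (lerD (lexx _) (pr_or _ _ _)) _.
  have h1 : pr (F k') (fun B => x \notin B) <= 1/2 + C2 * eps.
    by rewrite (p_notin ext); have := hot_ge x; rewrite kx; lra.
  have h2 := j_pr k'k.
  have h3 : pr (F k') (fun B => [exists v, (v \in V :&: hot k) && (v \in B)]) <= 1/8.
    apply: le_trans q_small; apply: le_trans (pr_exists _ _ _) _.
    apply: le_trans (_ : \sum_(v in V :&: hot k) C2 * eps <= _).
      apply: ler_sum => v; rewrite !inE => /andP[_ /eqP kv].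
      by apply: hot_le; rewrite kv.
    rewrite sumr_const -[X in X <= _]mulr_natl ler_wpM2r ?mulr_ge0 ?invr_ge0 // ler_nat.
    apply: leq_trans (subset_leq_card (subsetIl _ _)) _; apply: leq_trans Vw _.
    by rewrite leq_mul2r ms orbT.
  by move: h1 h2 h3 C2_small C3_small; lra.
rewrite 2!negb_or 2!negbK => /andP[xB /andP[/eqP dB /existsPn Bv]].
exists (B :&: hot k); split.
- exact: subsetIr.
- by rewrite dB jk'.
- apply/negP => yF; have := ext_overlap ext kk' yF BF; apply/negP; rewrite -ltnNge -jk' -dB.
  have xH : x \notin B :&: hot k by rewrite !inE kx (negPf k'k) andbF.
  rewrite -[X in (X <= _)%N]/(#|B :&: hot k|.+1) -add1n.
  have <- : #|x |: (B :&: hot k)| = (1 + #|B :&: hot k|)%N by rewrite cardsU1 xH.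
  by apply/subset_leq_card; rewrite subsetI subxx subUset sub1set xB subsetIl.
rewrite -setI_eq0; apply/eqP/setP => v; rewrite !inE; apply/negP => /andP[/andP[vB kv] vV].
by have := Bv v; rewrite !inE vV kv vB.
Qed.

End ZoneEmpty.

(** * Exchange *)

Section Exchange.
Variables (l n : nat) (m : {set 'I_l} -> nat) (F : fam l n).
Hypothesis ext : extremal m F.
Notation eps := (n%:R^-1 : rat).
Variables (warm kappa : 'I_n -> 'I_l) (C1 C2 C4 c1 : rat).
Hypothesis n0 : (0 < n)%N.
Hypothesis C1_ge0 : 0 <= C1.
Hypothesis C2_ge0 : 0 <= C2.
Hypothesis C4_ge0 : 0 <= C4.
Hypothesis c1_gt0 : 0 < c1.
Hypothesis hot_ge : forall x, 1/2 - C2 * eps <= p F (kappa x) x.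
Local Notation sg := (sigma m).
Hypothesis delta_small : 2 ^+ sg.+1 * (2 * C2 * eps) <= 1/2.
Local Notation hot := (hot kappa).
Local Notation zone := (zone warm kappa).
Local Notation off := (off warm kappa).
Local Notation zf := (zfam m warm kappa).
Implicit Types (U B D V Z G Y : {set 'I_n}) (k b : 'I_l) (x y : 'I_n).
Hypothesis p_off : forall k x, off k x -> p F k x <= C4 * eps ^+ 2.
Variable j : 'I_l * 'I_l -> nat.
Hypothesis j_sum : forall k k', k != k' -> (j (k, k') + j (k', k) = m [set k; k'])%N.
Hypothesis j_orient : forall k k', k != k' -> j (k, k') = 0%N \/ j (k', k) = 0%N.
Hypothesis zone_e : forall k k', j (k, k') = 0%N -> zone (k, k') = set0.
Hypothesis warm_hot : forall x, warm x != kappa x.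
Hypothesis warm_ge : forall x, c1 * eps <= p F (warm x) x.
Hypothesis p_hot_gt0 : forall y, 0 < p F (kappa y) y.
Hypothesis star_bound : forall (Y : 'I_l -> {set 'I_n}) e,
  (e <= \sum_x 'C(#|cover_at Y x|, 2))%N ->
  \prod_(k < l) pr (F k) (fun B => Y k \subset B) <= C1 * eps ^+ e.
Variable q : nat.
Hypothesis tiny_or : forall k y w, (0 < w)%N -> (w <= sg)%N ->
  p F k y <= eps ^+ (sg + 4) \/
  exists2 V : {set 'I_n}, (#|V| <= w * q)%N & forall D, D \subset hot k -> #|D| = w ->
    [disjoint D & V] -> y |: D \in F k.
Hypothesis zone_big : forall r, (0 < j r)%N -> (4 * sg * (1 + sg * q) < #|zone r|)%N.
Hypothesis C4_small : C4 * eps <= 1/2.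
Hypothesis poly_small : (2 * n.+2 ^ sg.+1 <= n ^ (sg + 2))%N.

Let cap := cap_hot ext C2_ge0 hot_ge delta_small.
Let e0 : 0 < eps. Proof. by rewrite invr_gt0 ltr0n. Qed.
Let en : n%:R * eps = 1. Proof. by rewrite mulfV // pnatr_eq0 -lt0n. Qed.

Lemma not_off k x : ~~ off k x = (k == warm x) || (k == kappa x).
Proof. by rewrite /off negb_and !negbK. Qed.

Lemma zones_oriented k k' : zone (k, k') = set0 \/ zone (k', k) = set0.
Proof.
have [<-|kk'] := eqVneq k k'.
  left; apply/setP => x; rewrite !inE; apply/negP => /eqP[wx kx].
  by have := warm_hot x; rewrite wx kx eqxx.
by have [/zone_e|/zone_e] := j_orient kk'; [left | right].
Qed.

Let p_warm_gt0 y : 0 < p F (warm y) y.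
Proof. by apply: lt_le_trans (warm_ge y); rewrite mulr_gt0. Qed.

Lemma p_col_gt0 k y : ~~ off k y -> 0 < p F k y.
Proof. by rewrite /off negb_and !negbK => /orP[] /eqP ->. Qed.

(** For members without off elements, the zone bounds follow from [cap_hot]. *)
Lemma zfam_or_off k B : B \in F k -> (B \in zf k) || [exists x, off k x && (x \in B)].
Proof.
move=> BF; case: existsP => [|H]; rewrite ?orbT ?orbF //.
apply/zfamP; split=> [x xB|k']; first by apply/negP => ox; apply: H; exists x; rewrite ox.
have [<-|kk'] := eqVneq k k'.
  by have [->|->] := zones_oriented k k; rewrite setI0 cards0.
apply: leq_trans (cap kk' BF); apply: subset_leq_card; apply: setIS; exact: zone_hot.
Qed.

Lemma card_fam_le_zfam k : (1 - C4 * eps) * #|F k|%:R <= #|zf k|%:R.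
Proof.
apply: le_trans (_ : pr (F k) (fun B => B \in zf k) * #|F k|%:R <= _).
  rewrite ler_wpM2r //.
  have := pr_off n0 p_off C4_ge0 k.
  have : 1 <= pr (F k) (fun B => B \in zf k) + pr (F k) (fun B => [exists x, off k x && (x \in B)]).
    apply: le_trans (pr_or _ _ _).
    rewrite (eq_pr (Q' := predT)) => [|B BF]; last exact: zfam_or_off.
    by rewrite -(pr_set0 ext k); apply: pr_sub.
  lra.
rewrite pr_mul ler_nat; apply/subset_leq_card/subsetP => B.
by rewrite inE => /andP[].
Qed.

Lemma card_fam_le2 k : (#|F k| <= 2 * #|zf k|)%N.
Proof.
rewrite -(ler_nat rat) natrM; have := card_fam_le_zfam k.
have f0 : 0 <= #|F k|%:R :> rat by [].
have := ler_wpM2r f0 C4_small; move: (#|F k|%:R) (#|zf k|%:R) (C4 * eps) => f z e.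
rewrite mulrBl mul1r; lra.
Qed.

(** The element [y] occurs in both its warm and its hot family, so their overlap bound is at least
    1. *)
Lemma sing_zfam k y : ~~ off k y -> [set y] \in zf k.
Proof.
move=> ky; apply/zfamP; split=> [x|k']; first by rewrite inE => /eqP ->.
have [->|/set0Pn[x]] := eqVneq ([set y] :&: zone (k, k')) set0; first by rewrite cards0.
rewrite !inE xpair_eqE => /and3P[/eqP -> /eqP wy /eqP kY].
apply: leq_trans (subset_leq_card (subsetIl _ _)) _; rewrite cards1.
apply: (m_gt0_of_p (y := y) ext); first by rewrite -wy -kY.
  by rewrite -wy.
by rewrite -kY.
Qed.

Variable c : 'I_l.

Let miss := zf c :\: F c.
Let W := [set x | warm x == c].

Lemma zfam_warm_card B : B \in zf c -> (#|B :&: W| <= sg)%N.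
Proof.
move=> /zfamP[_ H]; apply: leq_trans (sum_other_le m c).
apply: leq_trans (_ : \sum_(k' < l | k' != c) #|B :&: zone (c, k')| <= _)%N; last first.
  by apply: leq_sum => k' _.
rewrite -sum1_card (partition_big kappa (fun k' => k' != c)) /= => [|x]; last first.
  by rewrite !inE => /andP[_ /eqP <-]; rewrite eq_sym warm_hot.
apply: leq_sum => k' _; rewrite -sum1_card leq_eqVlt; apply/orP; left; apply/eqP.
by apply: eq_bigl => x; rewrite !inE xpair_eqE andbA.
Qed.

Definition conflicting b := [set G in F b | [exists B in zf c, (m [set b; c] < #|G :&: B|)%N]].

Lemma conflict_miss b G B : b != c -> G \in F b -> B \in zf c ->
  (m [set b; c] < #|G :&: B|)%N -> B \in miss.
Proof.
move=> bc GF BT; rewrite ltnNge => H; rewrite inE BT andbT.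
by apply: contra H => BF; exact: (ext_overlap ext bc GF BF).
Qed.

(** One member of [F b] with more than [m] elements excludes everything above it from [F c]; in this
    way a single conflict yields many missing members. *)
Lemma star_miss b G : b != c -> G \in F b -> (m [set b; c] < #|G|)%N ->
  star (zf c) G \subset miss.
Proof.
move=> bc GF Gm; apply/subsetP => B; rewrite inE => /andP[BT GB].
by apply: (conflict_miss bc GF BT); rewrite (setIidPl GB).
Qed.

(** If no common element were off [b], the intersection would lie in the two zones of the pair. One
    of these is empty, and on the other the bound holds by [cap_hot] or by the definition of
    [zf c]. *)
Lemma conflict_off b G B : b != c -> G \in F b -> B \in zf c ->
  (m [set b; c] < #|G :&: B|)%N -> exists y, [/\ y \in G, y \in B, off b y & ~~ off c y].
Proof.
move=> bc GF BT GB; have /zfamP[Boff Bcap] := BT.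
have [/existsP[y /and3P[yG yB ob]]|/existsPn H] :=
  boolP [exists y, [&& y \in G, y \in B & off b y]].
  by exists y; split=> //; exact: Boff.
have sub : G :&: B \subset zone (b, c) :|: zone (c, b).
  apply/subsetP => y; rewrite !inE => /andP[yG yB].
  have := H y; rewrite yG yB /= not_off; have := Boff y yB.
  rewrite not_off !xpair_eqE; case/orP => /eqP E1 /orP[] /eqP E2.
  - by rewrite E1 E2 eqxx in bc.
  - by rewrite E1 E2 !eqxx orbT.
  - by rewrite E1 E2 !eqxx.
  - by rewrite E1 E2 eqxx in bc.
exfalso; have := GB; apply/negP; rewrite -leqNgt.
have [E|E] := zones_oriented b c; rewrite E ?set0U ?setU0 in sub.
  apply: leq_trans (_ : #|B :&: zone (c, b)| <= _)%N.
    by apply: subset_leq_card; rewrite subsetI sub subsetIr.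
  by rewrite setUC; exact: Bcap.
apply: leq_trans (cap bc GF); apply: subset_leq_card; rewrite subsetI subsetIl.
exact: subset_trans sub (zone_hot _ _ _ _).
Qed.

Lemma conflicting_le b : b != c -> pr (F b) (fun G => G \in conflicting b) <= C4 * eps.
Proof.
move=> bc; apply: le_trans (pr_off n0 p_off C4_ge0 b); apply: pr_sub => G GF.
rewrite inE => /andP[_ /exists_inP[B BT GB]].
have [y [yG _ oy _]] := conflict_off bc GF BT GB.
by apply/existsP; exists y; rewrite oy.
Qed.

Local Notation beta := (#|miss|%:R / #|F c|%:R : rat).

Let f0 : 0 < #|F c|%:R :> rat. Proof. by rewrite ltr0n (ext_card_gt0 ext). Qed.

Lemma subset_of_card (A : {set 'I_n}) s : (s <= #|A|)%N ->
  exists2 U : {set 'I_n}, U \subset A & #|U| = s.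
Proof.
move=> sA; have /card_gt0P[U] : (0 < #|[set U : {set 'I_n} | (U \subset A) && (#|U| == s)]|)%N.
  by rewrite cards_draws bin_gt0.
by rewrite inE => /andP[a /eqP b]; exists U.
Qed.

(** By [ext_add] a missing [B] conflicts with a member of another family; some [m + 1] common
    elements already conflict, and their whole star is missing. By [star_ge] this star has
    polynomial proportion, so terms of order [eps ^+ (sg + 4)] will be negligible against [beta]. *)
Lemma miss_ge : miss != set0 -> eps ^+ (sg + 2) <= beta.
Proof.
move=> /set0Pn[B]; rewrite inE => /andP[BF BT].
have [b [G [bc GF GB]]] : exists b G, [/\ b != c, G \in F b & (m [set b; c] < #|G :&: B|)%N].
  have [/existsP[b /andP[bc /exists_inP[G GF GB]]]|] :=
    boolP [exists b, (b != c) && [exists G in F b, (m [set b; c] < #|G :&: B|)%N]].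
    by exists b, G.
  move=> /existsPn H; case/negP: BF; apply: (ext_add ext) => b G bc GF.
  have := H b; rewrite bc /= => /exists_inPn/(_ G GF); rewrite -leqNgt.
  by rewrite setUC setIC.
have [G0 G0s G0m] := subset_of_card GB.
have [G0G G0B] : G0 \subset G /\ G0 \subset B by apply/andP; rewrite -subsetI.
have G0F : G0 \in F b by exact: ext_down ext _ _ _ G0G GF.
have G0T : G0 \in zf c by exact: zfam_down G0B BT.
have G0b : (m [set b; c] < #|G0|)%N by rewrite G0m.
have sub := star_miss bc G0F G0b.
have H : (#|F c| <= n ^ (sg + 2) * #|miss|)%N.
  apply: leq_trans (card_fam_le2 c) _.
  apply: leq_trans (leq_mul (leqnn 2) (star_ge warm_hot G0T)) _.
  rewrite mulnA; apply: leq_mul; last exact: subset_leq_card.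
  apply: leq_trans poly_small; rewrite leq_mul2l /=.
  apply: leq_trans (_ : n.+2 ^ #|G0 :&: hot c| * n.+2 ^ #|G0 :\: hot c| <= _)%N.
    by rewrite leq_mul2r; apply/orP; right; case: #|_| => // i; rewrite leq_exp2r.
  rewrite -expnD cardsID G0m leq_exp2l // ltnS.
  by rewrite le_sigma // cards2 bc.
rewrite ler_pdivlMr // exprVn mulrC ler_pdivrMr ?exprn_gt0 ?ltr0n //.
by rewrite mulrC -natrX -natrM ler_nat.
Qed.

(** A member of [zf c] containing [y] whose trace on the zone is maximal and avoids [V] conflicts
    with [y] joined to that trace. The exceptions are deficient or meet [V]; there are at most
    [1 + #|V|] times as many as deficient members. The bound [zone_big] is chosen so that these are
    at most half of the star. *)
Lemma popular_star b y V : b != c -> (0 < j (c, b))%N -> off b y -> ~~ off c y ->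
  (#|V| <= m [set c; b] * q)%N ->
  (forall D, D \subset hot b -> #|D| = m [set c; b] -> [disjoint D & V] -> y |: D \in F b) ->
  (#|star (zf c) [set y]| <= 2 * #|[set B in miss | y \in B]|)%N.
Proof.
move=> bc jcb oy cy Vq HV; pose M := m [set c; b]; pose A := zone (c, b).
pose Q := star (zf c) [set y].
have yA : y \notin A.
  rewrite inE xpair_eqE; apply/negP => /andP[_ /eqP E].
  by move: oy; rewrite /off E eqxx andbF.
have QP B : B \in Q -> B \in zf c /\ y \in B by rewrite inE sub1set => /andP.
have inQ B : B \in zf c -> y \in B -> B \in Q by move=> BT yB; rewrite /Q inE BT sub1set.
have Q_cap B : B \in Q -> (#|B :&: A| <= M)%N by move=> /QP[/zfamP[_ H] _]; exact: H.
have Q_del B z : B \in Q -> z \in A -> B :\ z \in Q.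
  move=> /QP[BT yB] zA; apply: inQ; first exact: zfam_down (subsetDl _ _) BT.
  by rewrite !inE yB andbT; apply: contraNneq yA => ->.
have Q_add B z : B \in Q -> z \in A -> (#|B :&: A| < M)%N -> z |: B \in Q.
  move=> /QP[BT yB] zA lt; apply: inQ; first exact: zfam_add lt.
  by rewrite !inE yB orbT.
pose def := deficient Q A M.
have sub : Q \subset def :|: (\bigcup_(v in V :&: A) [set B in Q | v \in B] :|: [set B in miss | y \in B]).
  apply/subsetP => B BQ; rewrite !in_setU; have [BT yB] := QP _ BQ.
  have [BM|BM] := ltnP #|B :&: A| M; first by apply/orP; left; rewrite inE; apply/andP; split.
  have [dis|] := boolP [disjoint B :&: A & V]; last first.
    rewrite -setI_eq0 => /set0Pn[v]; rewrite !in_setI => /andP[/andP[vB vA] vV].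
    apply/orP; right; apply/orP; left; apply/bigcupP; exists v; first by rewrite in_setI vV.
    by rewrite inE; apply/andP; split.
  apply/orP; right; apply/orP; right; rewrite inE yB andbT.
  have cM : #|B :&: A| = M by apply/eqP; rewrite eqn_leq BM Q_cap.
  have yDF : y |: (B :&: A) \in F b.
    by apply: HV => //; apply: subset_trans (subsetIr _ _) (zone_hot _ _ _ _).
  apply: (conflict_miss bc yDF BT).
  have -> : (y |: (B :&: A)) :&: B = y |: (B :&: A).
    by apply/setIidPl; rewrite subUset sub1set yB subsetIl.
  by rewrite cardsU1 inE yB (negPf yA) /= cM setUC.
have H1 : (#|Q| <= #|def| + (#|V| * #|def| + #|[set B in miss | y \in B]|))%N.
  apply: leq_trans (subset_leq_card sub) _; apply: leq_trans (leq_card_setU _ _) _.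
  rewrite leq_add2l; apply: leq_trans (leq_card_setU _ _) _; rewrite leq_add2r.
  apply: leq_trans (_ : \sum_(v in V :&: A) #|def| <= _)%N; last first.
    by rewrite sum_nat_const leq_mul2r subset_leq_card ?orbT // subsetIl.
  apply: leq_trans (_ : \sum_(v in V :&: A) #|[set B in Q | v \in B]| <= _)%N.
    elim/big_rec2: _ => [|v a E _ IH]; first by rewrite cards0.
    by apply: leq_trans (leq_card_setU _ _) _; rewrite leq_add2l.
  apply: leq_sum => v; rewrite in_setI => /andP[_ vA].
  exact: deg_le_deficient.
have H2 := deficient_le Q_cap Q_del Q_add; rewrite -/def in H2.
have H3 := zone_big jcb; rewrite -/A in H3.
have Ms : (M <= sg)%N by rewrite le_sigma // cards2 [c == b]eq_sym bc.
have H4 : (2 * (1 + #|V|) * #|def| <= #|Q|)%N.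
  rewrite -(leq_pmul2l (leq_ltn_trans (leq0n _) H3)).
  apply: leq_trans (_ : 2 * (1 + #|V|) * (2 * M * #|Q|) <= _)%N.
    by rewrite mulnCA leq_mul2l H2 orbT.
  rewrite mulnA leq_mul2r; apply/orP; right; apply: ltnW; apply: leq_ltn_trans H3.
  have Vs : (#|V| <= sg * q)%N by apply: leq_trans Vq _; rewrite leq_mul2r Ms orbT.
  apply: leq_trans (_ : 4 * M * (1 + #|V|) <= _)%N.
    by apply: eq_leq; move: {+}M #|V| => u v; ring.
  by apply: leq_mul; rewrite ?leq_mul2l ?leq_add2l.
have E : (2 * (1 + #|V|) * #|def| = 2 * (#|def| + #|V| * #|def|))%N.
  by move: #|V| #|def| => u v; ring.
move: H1 H4; rewrite E; move: (#|V| * #|def|)%N #|def| #|Q| #|[set B in miss | y \in B]|.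
clear; move=> *; lia.
Qed.

Lemma sum_card_miss_warm :
  (\sum_(y in W) #|[set B in miss | y \in B]| <= sg * #|miss|)%N.
Proof.
rewrite -sum_card_in mulnC -sum_nat_const; apply: leq_sum => B.
by rewrite inE => /andP[_]; exact: zfam_warm_card.
Qed.

Hypothesis n2 : (2 <= n)%N.

Let C4n_ge0 : 0 <= 12 * C4 * sg%:R.
Proof. by apply: mulr_ge0; [apply: mulr_ge0; [exact: ler0n | exact: C4_ge0] | exact: ler0n]. Qed.

Let inner_ge0 : 0 <= 12 * C4 * sg%:R + 1 + 8 * C4.
Proof.
apply: addr_ge0; first by apply: addr_ge0; [exact: C4n_ge0 | exact: ler01].
by apply: mulr_ge0; [exact: ler0n | exact: C4_ge0].
Qed.

(** A conflicting set contains some [y] of [Y] by [conflict_off], so it suffices to sum over [Y].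
    Elements of tiny probability in [F b] are negligible by [miss_ge]; for the others half of the
    star of [y] is missing, and the cost of [y] is charged to the missing members containing it. *)
Lemma conflicting_inner b : miss != set0 -> b != c -> (0 < j (c, b))%N ->
  pr (F b) (fun G => G \in conflicting b) <= (12 * C4 * sg%:R + 1 + 8 * C4) * eps * beta.
Proof.
move=> miss0 bc jcb; have b0 : 0 <= beta by rewrite divr_ge0.
have ms := miss_ge miss0.
have cb : c != b by rewrite eq_sym.
have jE : j (c, b) = m [set c; b].
  by rewrite -(j_sum cb); case: (j_orient cb) => E; [rewrite E in jcb | rewrite E addn0].
have M0 : (0 < m [set c; b])%N by rewrite -jE.
have Ms : (m [set c; b] <= sg)%N by rewrite le_sigma // cards2 cb.
pose Y := [set y | off b y && ~~ off c y].
pose pop y := ~~ (p F b y <= eps ^+ (sg + 4)).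
have star_pop y : y \in Y -> pop y -> (#|star (zf c) [set y]| <= 2 * #|[set B in miss | y \in B]|)%N.
  rewrite inE => /andP[oy cy] py; have [H|[V Vw HV]] := tiny_or b y M0 Ms.
    by rewrite /pop H in py.
  exact: (popular_star (b := b) bc jcb oy cy Vw HV).
(* If such a [y] is hot for [c], its star is at least half of [zf c]; then [beta] is at least 1/8
   and the crude bound [C4 * eps] suffices. *)
have [/existsP[y /and3P[yY py ky]]|/existsPn none] := boolP [exists y, [&& y \in Y, pop y & kappa y == c]].
  have cy : ~~ off c y by move: yY; rewrite inE => /andP[].
  have := star_ge warm_hot (sing_zfam cy).
  have -> : #|[set y] :&: hot c| = 1%N.
    rewrite -(cards1 y); apply: eq_card => x; rewrite !inE; case: eqVneq => // ->.
    by rewrite ky.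
  have -> : #|[set y] :\: hot c| = 0%N.
    apply/eqP; rewrite cards_eq0; apply/eqP/setP => x; rewrite !inE andbC; case: eqVneq => //= ->.
    by rewrite ky.
  rewrite muln1 => H1; have H2 := star_pop y yY py; have H3 := card_fam_le2 c.
  have H4 : (#|[set B in miss | y \in B]| <= #|miss|)%N.
    by apply/subset_leq_card/subsetP => B; rewrite inE => /andP[].
  have H5 : (#|F c| <= 8 * #|miss|)%N.
    rewrite expn1 in H1; move: H1 H2 H3 H4.
    by move: #|F c| #|zf c| #|star _ _| #|[set B in _ | _]| #|miss|; clear; move=> *; lia.
  have H6 : 1 <= 8 * beta.
    by rewrite mulrA ler_pdivlMr // mul1r -natrM ler_nat.
  apply: le_trans (conflicting_le bc) _.
  have X0 : 0 <= C4 * eps by rewrite mulr_ge0 // ltW.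
  have X1 : 0 <= (12 * C4 * sg%:R + 1) * eps * beta.
    apply: mulr_ge0 b0; apply: mulr_ge0 (ltW e0).
    by apply: addr_ge0; [exact: C4n_ge0 | exact: ler01].
  have X2 : C4 * eps * 1 <= C4 * eps * (8 * beta) by rewrite ler_wpM2l.
  move: X1 X2; move: beta (sg%:R) eps => B S e; clear ms; rewrite mulr1 => X1 X2; lra.
apply: le_trans (_ : \sum_(y in Y) p F b y <= _).
  apply: le_trans (pr_exists (mem Y) (F b) (fun y G => y \in G)); apply: pr_sub => G GF.
  rewrite inE => /andP[_ /exists_inP[B BT GB]].
  have [y [yG _ oy cy]] := conflict_off bc GF BT GB.
  have yY : y \in Y by rewrite inE oy cy.
  by apply/existsP; exists y; rewrite yG andbT.
have X12' : 0 <= 12 * C4 * eps.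
  by apply: mulr_ge0 (ltW e0); apply: mulr_ge0; [exact: ler0n | exact: C4_ge0].
have X12 y : 0 <= 12 * C4 * eps * (#|[set B in miss | y \in B]|%:R / #|F c|%:R).
  by apply: mulr_ge0 X12' _; apply: divr_ge0; exact: ler0n.
apply: le_trans (_ : \sum_(y in Y) (eps ^+ (sg + 4) +
    (if y \in W then 12 * C4 * eps * (#|[set B in miss | y \in B]|%:R / #|F c|%:R) else 0)) <= _).
  apply: ler_sum => y yY; have [py|py] := boolP (pop y); last first.
    rewrite negbK in py; apply: le_trans py _; rewrite lerDl; case: ifP => [_|_]; last exact: lexx.
    exact: X12.
  have cy : ~~ off c y by move: yY; rewrite inE => /andP[].
  have ky : kappa y != c by have := none y; rewrite yY py.
  have wy : warm y == c by move: cy; rewrite not_off [c == kappa y]eq_sym (negPf ky) orbF eq_sym.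
  have -> : y \in W by rewrite inE.
  have oy : off b y by move: yY; rewrite inE => /andP[].
  apply: le_trans (p_off oy) _.
  (* The constant is [2 * 3 * 2], from [card_fam_le2], from [n + 2 <= 3 * n] and from the missing
     half of the star. *)
  have H5 : (#|F c| <= 12 * n * #|[set B in miss | y \in B]|)%N.
    have := star_ge warm_hot (sing_zfam cy).
    have -> : #|[set y] :&: hot c| = 0%N.
      apply/eqP; rewrite cards_eq0; apply/eqP/setP => x; rewrite !inE; case: eqVneq => //= ->.
      by rewrite (negPf ky).
    have -> : #|[set y] :\: hot c| = 1%N.
      rewrite -(cards1 y); apply: eq_card => x; rewrite !inE andbC; case: eqVneq => // ->.
      by rewrite (negPf ky).
    rewrite mul1n expn1 => H1; have H2 := star_pop y yY py; have H3 := card_fam_le2 c.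
    have n3 : (n.+2 <= 3 * n)%N by move: n2; clear; lia.
    apply: leq_trans H3 _; apply: leq_trans (leq_mul (leqnn 2) H1) _.
    apply: leq_trans (leq_mul (leqnn 2) (leq_mul n3 H2)) _; apply: eq_leq.
    by move: #|[set B in _ | _]|; clear; move=> s; ring.
  have H6 : eps <= 12 * (#|[set B in miss | y \in B]|%:R / #|F c|%:R).
    have np : 0 < n%:R :> rat by rewrite ltr0n.
    rewrite mulrA (ler_pdivlMr _ _ f0) mulrC (ler_pdivrMr _ _ np) mulrAC -!natrM ler_nat.
    exact: H5.
  have X0 : 0 <= C4 * eps by rewrite mulr_ge0 // ltW.
  have X1 : 0 <= eps ^+ (sg + 4) by rewrite exprn_ge0 // ltW.
  have := ler_wpM2l X0 H6; move: X1; rewrite expr2; move: (eps ^+ (sg + 4)) (_ / _) => t s.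
  by clear ms; move: eps => e X1 H7; lra.
rewrite big_split /=.
have S1 : \sum_(y in Y) eps ^+ (sg + 4) <= eps * beta.
  rewrite sumr_const -[X in X <= _]mulr_natl.
  apply: le_trans (_ : n%:R * eps ^+ (sg + 4) <= _).
    rewrite ler_wpM2r ?exprn_ge0 ?(ltW e0) // ler_nat -[X in (_ <= X)%N](card_ord n).
    exact: max_card.
  have -> : (sg + 4 = (sg + 2).+2)%N by rewrite !addnS.
  rewrite exprS mulrA en mul1r exprS ler_wpM2l ?(ltW e0) //.
have S2 : \sum_(y in Y) (if y \in W then 12 * C4 * eps * (#|[set B in miss | y \in B]|%:R / #|F c|%:R) else 0)
    <= 12 * C4 * eps * (sg%:R * beta).
  apply: le_trans (_ : \sum_(y in W) 12 * C4 * eps * (#|[set B in miss | y \in B]|%:R / #|F c|%:R) <= _).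
    rewrite [X in _ <= X]big_mkcond /=; rewrite [X in X <= _]big_mkcond /=.
    apply: ler_sum => y _; case: (y \in Y); case: ifP => [_|_]; rewrite ?lexx //; exact: X12.
  rewrite -mulr_sumr ler_wpM2l ?X12' // -mulr_suml mulrA ler_wpM2r ?invr_ge0 //.
  by rewrite -natr_sum -natrM ler_nat sum_card_miss_warm.
apply: le_trans (lerD S1 S2) _.
have X0 : 0 <= C4 * eps by rewrite mulr_ge0 // ltW.
have X1 : 0 <= C4 * eps * beta by rewrite mulr_ge0.
by move: X1; move: beta (sg%:R) eps => B S e; clear ms; move=> X1; lra.
Qed.

Local Notation C7 := (C1 * (2 ^+ (sg + 2)) ^+ l / c1).

(** The star inequality is applied with [Y] at [b], with each element of [Y] also at its hot index,
    and with one element [y1] also at [c]. The hot factors are bounded below by constants, the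
    factor at [c] by [c1 * eps]. There are at least three coincidences at [y1] and one at each other
    element, hence [#|Y| + 2], of which the division by [c1 * eps] uses up one. *)
Lemma pr_off_set b Y : b != c -> Y != set0 -> (#|Y| <= sg.+1)%N ->
  (forall y, y \in Y -> warm y = c /\ off b y) ->
  pr (F b) (fun B => Y \subset B) <= C7 * eps ^+ (#|Y|.+1).
Proof.
move=> bc /set0Pn[y1 y1Y] Ys HY; have cb : c != b by rewrite eq_sym.
pose Yf i := if i == b then Y else if i == c then [set y1] else [set y in Y | kappa y == i].
have kb y : y \in Y -> kappa y != b by move=> /HY[_ /andP[_]]; rewrite eq_sym.
have kc y : y \in Y -> kappa y != c by move=> /HY[<- _]; rewrite eq_sym warm_hot.
have inb y : y \in Y -> [set b; kappa y] \subset cover_at Yf y.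
  move=> yY; rewrite subUset !sub1set !inE /Yf eqxx yY /=.
  by rewrite (negPf (kb y yY)) (negPf (kc y yY)) inE yY eqxx.
have e_le : (#|Y| + 2 <= \sum_x 'C(#|cover_at Yf x|, 2))%N.
  apply: leq_trans (_ : \sum_(x in Y) 'C(#|cover_at Yf x|, 2) <= _)%N; last first.
    by rewrite [X in (_ <= X)%N](bigID (mem Y)) leq_addr.
  rewrite (bigD1 y1) //= (cardsD1 y1) y1Y add1n addSn -addnS addnC; apply: leq_add.
    have sub : c |: [set b; kappa y1] \subset cover_at Yf y1.
      by rewrite subUset inb // andbT sub1set inE /Yf (negPf cb) eqxx inE.
    have := leq_bin2l 2 (subset_leq_card sub); apply: leq_trans.
    rewrite cardsU1 !inE negb_or cb eq_sym kc //= cards2 [b == _]eq_sym kb //.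
  apply: leq_trans (_ : \sum_(x in Y | x != y1) 1 <= _)%N.
    by rewrite -sum1_card; apply: eq_leq; apply: eq_bigl => x; rewrite !inE andbC.
  apply: leq_sum => x /andP[xY _]; have := leq_bin2l 2 (subset_leq_card (inb x xY)).
  by rewrite cards2 [b == _]eq_sym kb.
have := star_bound e_le; rewrite (bigD1 b) //= (bigD1 c) //= {1}/Yf eqxx.
rewrite [X in _ * (X * _) <= _](_ : _ = p F c y1); last first.
  by apply: eq_pr => B _; rewrite /Yf (negPf cb) eqxx sub1set.
have k0 : 0 < 2 ^- (sg + 2) :> rat by rewrite invr_gt0 exprn_gt0.
have k1 : 2 ^- (sg + 2) <= 1 :> rat by rewrite invf_le1 ?exprn_gt0 // exprn_ege1.
have rest : (2 ^- (sg + 2)) ^+ l <= \prod_(i < l | (i != b) && (i != c)) pr (F i) (fun B => Yf i \subset B).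
  apply: le_trans (_ : \prod_(i < l | (i != b) && (i != c)) 2 ^- (sg + 2) <= _).
    rewrite prodr_const; apply: ler_wiXn2l; rewrite ?(ltW k0) //.
    by apply: leq_trans (max_card _) _; rewrite card_ord.
  apply: ler_prod => i /andP[/negPf ib /negPf ic]; rewrite (ltW k0) /=.
  have YH : Yf i \subset hot i.
    by rewrite /Yf ib ic; apply/subsetP => y; rewrite !inE => /andP[].
  have Yc : (#|Yf i| <= sg.+1)%N.
    apply: leq_trans Ys; apply: subset_leq_card; rewrite /Yf ib ic.
    by apply/subsetP => y; rewrite inE => /andP[].
  have := pr_superset ext C2_ge0 hot_ge YH.
  have D := pow_delta_small C2_ge0 delta_small Yc.
  have P0 := pr_ge0 (F i) (fun B => Yf i \subset B).
  have X2 : 2 ^+ #|Yf i| <= 2 ^+ sg.+1 :> rat by rewrite ler_eXn2l ?ltr1n.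
  rewrite -[2 ^- _]mul1r (ler_pdivrMr _ _ (exprn_gt0 _ _)) ?ltr0n // addn2 exprS.
  move: D P0 X2; move: (pr _ _) (2 ^+ #|_|) (2 ^+ sg.+1) (2 * C2 * eps) => P u v d.
  clear k0 k1; move=> D P0 X2 H; have := ler_wpM2r P0 X2; lra.
have wy : c1 * eps <= p F c y1 by have [<- _] := HY _ y1Y; exact: warm_ge.
have P0 := pr_ge0 (F b) (fun B => Y \subset B).
rewrite addn2 [eps ^+ _.+2]exprSr.
have X0 : 0 <= (2 ^- (sg + 2)) ^+ l :> rat by rewrite exprn_ge0 // ltW.
have -> : C7 = C1 / (c1 * (2 ^- (sg + 2)) ^+ l).
  by rewrite invfM exprVn invrK mulrA [RHS]mulrAC.
have X1 : 0 < (2 ^- (sg + 2)) ^+ l :> rat by rewrite exprn_gt0.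
move: rest wy P0 X1; move: (\prod_(_ < _ | _) _) ((2 ^- (sg + 2)) ^+ l) (p F c y1) (pr _ _).
move: (eps ^+ _.+1) => E R K pc P RK wy P0 K0 H.
have h1 : c1 * eps * K <= pc * R by apply: ler_pM => //; rewrite ?(ltW K0) // mulr_ge0 ?ltW.
have h2 : P * (c1 * eps * K) <= C1 * (E * eps) by apply: le_trans H; apply: ler_wpM2l.
have h3 : P * (c1 * K) <= C1 * E.
  rewrite -(ler_pM2r e0); move: h2; rewrite !mulrA; rewrite [P * c1 * eps * K]mulrAC; exact: id.
by rewrite mulrAC ler_pdivlMr ?mulr_gt0.
Qed.

Local Notation KK := (2 ^ (sg + 2) * 3 ^ sg.+1)%N.

(** From a conflict take [m + 1] common elements [G0], and let [Y] be those not hot for [c]: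
    nonempty by [cap_hot], warm for [c], and off [b] as [zone (c, b)] is empty. The star of [G0] is
    missing and has proportion at least of order [n ^- #|Y|], whereas [Y] has probability only
    [O(n ^- (#|Y| + 1))] in [F b]. So each [Y] costs [eps] times the missing proportion above it,
    and a missing member has at most [2 ^ sg] such subsets. *)
Lemma conflicting_outer b : b != c -> (0 < j (b, c))%N ->
  pr (F b) (fun G => G \in conflicting b) <= C7 * KK%:R * (2 ^ sg)%:R * eps * beta.
Proof.
move=> bc jbc; have cb : c != b by rewrite eq_sym.
have bm : (m [set b; c] <= sg)%N by rewrite le_sigma // cards2 bc.
have zcb : zone (c, b) = set0.
  by case: (j_orient cb) => [/zone_e//|E]; rewrite E in jbc.
pose num Y := #|[set B in miss | Y \subset B]|.
pose YY := [set Y : {set 'I_n} | [&& Y != set0, (#|Y| <= sg.+1)%N,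
   [forall y in Y, (warm y == c) && off b y] & (#|F c| <= KK * n ^ #|Y| * num Y)%N]].
have C7_ge0 : 0 <= C7 by rewrite divr_ge0 ?(ltW c1_gt0) // mulr_ge0 // !exprn_ge0.
have step : pr (F b) (fun G => G \in conflicting b) <= \sum_(Y in YY) pr (F b) (fun G => Y \subset G).
  apply: le_trans (pr_exists (mem YY) (F b) (fun Y G => Y \subset G)); apply: pr_sub => G GF.
  rewrite inE => /andP[_ /exists_inP[B BT GB]].
  have [G0 G0s G0m] := subset_of_card GB.
  have [G0G G0B] : G0 \subset G /\ G0 \subset B by apply/andP; rewrite -subsetI.
  have G0F : G0 \in F b by exact: ext_down ext _ _ _ G0G GF.
  have G0T : G0 \in zf c by exact: zfam_down G0B BT.
  have G0b : (m [set b; c] < #|G0|)%N by rewrite G0m.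
  have sub := star_miss bc G0F G0b.
  pose Y := G0 :\: hot c.
  have YG : Y \subset G0 by exact: subsetDl.
  have Yle : (#|Y| <= #|G0|)%N by exact: subset_leq_card.
  have Y0 : Y != set0.
    apply: contraTneq G0b => Y0; rewrite -leqNgt; apply: leq_trans (cap bc G0F).
    by apply: subset_leq_card; rewrite subsetI subxx -setD_eq0 -/Y Y0 eqxx.
  apply/existsP; exists Y; rewrite (subset_trans YG G0G) andbT; suff : Y \in YY by [].
  rewrite inE Y0 /=.
  apply/and3P; split.
  - by apply: leq_trans Yle _; rewrite G0m.
  - apply/forall_inP => y; rewrite !inE => /andP[kY yG0].
    have /zfamP[/(_ y yG0)] := G0T; rewrite not_off [c == kappa y]eq_sym (negPf kY) orbF => /eqP wy _.
    rewrite -wy eqxx /off -wy bc /=; apply/eqP => E.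
    have : y \in zone (c, b) by rewrite inE wy E.
    by rewrite zcb inE.
  apply: leq_trans (card_fam_le2 c) _.
  apply: leq_trans (leq_mul (leqnn 2) (star_ge warm_hot G0T)) _; rewrite -/Y mulnA.
  apply: leq_mul; last first.
    apply/subset_leq_card/subsetP => Z ZS; rewrite inE (subsetP sub _ ZS) /=.
    by move: ZS; rewrite inE => /andP[_]; exact: subset_trans.
  have Ys : (#|Y| <= sg.+1)%N by apply: leq_trans Yle _; rewrite G0m.
  apply: leq_trans (_ : 2 * (2 ^ sg.+1 * (3 * n) ^ #|Y|) <= _)%N.
    rewrite leq_mul2l; apply: leq_mul.
      rewrite leq_exp2l //; apply: leq_trans (subset_leq_card (subsetIl _ _)) _.
      by rewrite G0m.
    by case: #|Y| => // i; rewrite leq_exp2r //; move: n2; clear; lia.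
  rewrite expnMn !mulnA leq_mul2r; apply/orP; right.
  by rewrite -expnS addn2 leq_mul2l leq_exp2l // Ys orbT.
apply: le_trans step _.
apply: le_trans (_ : \sum_(Y in YY) C7 * KK%:R * eps * ((num Y)%:R / #|F c|%:R) <= _).
  apply: ler_sum => Y; rewrite inE => /and4P[Y0 Ys /forall_inP HY YK].
  apply: le_trans (pr_off_set bc Y0 Ys _) _.
    by move=> y /HY/andP[/eqP -> ->].
  have H : eps ^+ #|Y| <= KK%:R * ((num Y)%:R / #|F c|%:R).
    rewrite mulrA ler_pdivlMr // exprVn mulrC ler_pdivrMr ?exprn_gt0 ?ltr0n //.
    rewrite mulrAC -natrX -!natrM ler_nat; exact: YK.
  have X0 : 0 <= C7 * eps by rewrite mulr_ge0 // ltW.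
  have := ler_wpM2l X0 H; rewrite exprS; move: (eps ^+ #|Y|) (KK%:R) (_ / #|F c|%:R) => E K R.
  by move: (C7) eps => C e; rewrite !mulrA [C * K * e]mulrAC.
have S : \sum_(Y in YY) (num Y)%:R <= (2 ^ sg)%:R * #|miss|%:R :> rat.
  rewrite -natr_sum -natrM ler_nat.
  apply: leq_trans (_ : \sum_(Y in YY) \sum_(B in miss) (Y \subset B : nat) <= _)%N.
    apply: leq_sum => Y _; rewrite /num -sum1dep_card big_mkcondr /= leq_eqVlt; apply/orP; left.
    by apply/eqP; apply: eq_bigr => B _; case: (Y \subset B).
  rewrite exchange_big /= mulnC -sum_nat_const; apply: leq_sum => B.
  rewrite inE => /andP[_ BT].
  apply: leq_trans (_ : #|powerset (B :&: W)| <= _)%N; last first.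
    by rewrite card_powerset leq_exp2l // zfam_warm_card.
  rewrite -sum1_card [X in (_ <= X)%N]big_mkcond /= big_mkcond /=; apply: leq_sum => Y _.
  case: ifP => // ; rewrite inE => /and4P[_ _ /forall_inP HY _].
  case: (boolP (Y \subset B)) => // YB; rewrite inE subsetI YB /=.
  have -> // : Y \subset W by apply/subsetP => y /HY/andP[wy _]; rewrite inE.
rewrite -mulr_sumr -mulr_suml.
have X0 : 0 <= C7 * KK%:R * eps by exact: mulr_ge0 (mulr_ge0 C7_ge0 (ler0n _ _)) (ltW e0).
have X1 : 0 <= #|F c|%:R^-1 :> rat by rewrite invr_ge0.
have := ler_wpM2l X0 (ler_wpM2r X1 S).
move: (\sum_(_ in _) _) (KK%:R) ((2 ^ sg)%:R) (C7) eps (#|F c|%:R^-1) (#|miss|%:R) => s K t C e i M.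
by rewrite !mulrA [C * K * t * e]mulrAC.
Qed.

Local Notation C6 := (12 * C4 * sg%:R + 1 + 8 * C4 + C7 * KK%:R * (2 ^ sg)%:R).
Hypothesis C4_small' : l%:R * (C4 * eps) <= 1/4.
Hypothesis C6_small : l%:R * (C6 * eps) <= 1/4.

Lemma conflicting_beta b : miss != set0 -> b != c ->
  pr (F b) (fun G => G \in conflicting b) <= C6 * eps * beta.
Proof.
move=> miss0 bc; have cb : c != b by rewrite eq_sym.
have C7_ge0 : 0 <= C7 by rewrite divr_ge0 ?(ltW c1_gt0) // mulr_ge0 // !exprn_ge0.
have b0 : 0 <= beta by rewrite divr_ge0.
have X1 : 0 <= (12 * C4 * sg%:R + 1 + 8 * C4) * eps * beta.
  exact: mulr_ge0 (mulr_ge0 inner_ge0 (ltW e0)) b0.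
have X2 : 0 <= C7 * KK%:R * (2 ^ sg)%:R * eps * beta.
  exact: mulr_ge0 (mulr_ge0 (mulr_ge0 (mulr_ge0 C7_ge0 (ler0n _ _)) (ler0n _ _)) (ltW e0)) b0.
have -> : C6 * eps * beta = (12 * C4 * sg%:R + 1 + 8 * C4) * eps * beta +
   C7 * KK%:R * (2 ^ sg)%:R * eps * beta.
  have gen (a d e B : rat) : (a + d) * e * B = a * e * B + d * e * B by rewrite !mulrDl.
  exact: gen.
have [jbc|jbc] := posnP (j (b, c)); last first.
  by apply: le_trans (conflicting_outer bc jbc) _; rewrite lerDr.
have [jcb|jcb] := posnP (j (c, b)); last first.
  by apply: le_trans (conflicting_inner miss0 bc jcb) _; rewrite lerDl.
(* Without an edge between [b] and [c] the overlap bound is 0, and a conflict would give an element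
   occurring in both families. *)
apply: le_trans (_ : 0 <= _); last exact: addr_ge0 X1 X2.
rewrite -(pr0 (F b)); apply: pr_sub => G GF.
rewrite inE => /andP[_ /exists_inP[B BT GB]].
have [y [yG yB oy cy]] := conflict_off bc GF BT GB.
have := m_gt0_of_p (y := y) ext bc; rewrite -j_sum // jbc jcb => /(_ _ (p_col_gt0 cy)).
suff -> : 0 < p F b y by move=> /(_ isT).
exact: pr_gt0 GF yG.
Qed.

(* Adding to [F c] the missing members of [zf c], and removing from the other
   families what conflicts with them, would increase the product. *)
Lemma zfam_sub : zf c \subset F c.
Proof.
rewrite -setD_eq0 -/miss; apply: contraT => miss0.
pose G : fam l n := [ffun i => if i == c then F c :|: zf c else F i :\: conflicting i].
have Gov : overlapping m G.
  have H b A B : b != c -> A \in F b :\: conflicting b -> B \in F c :|: zf c ->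
      (#|A :&: B| <= m [set b; c])%N.
    move=> bc /setDP[AF]; rewrite inE AF /= => /exists_inPn nA /setUP[BF|BT].
      exact: (ext_overlap ext bc AF BF).
    by rewrite leqNgt; exact: nA.
  apply/overlapP => k k' kk' A B; rewrite !ffunE.
  case: (eqVneq k c) => [kc|kc]; case: (eqVneq k' c) => [k'c|k'c].
  - by rewrite kc k'c eqxx in kk'.
  - by move=> AF BF; rewrite setIC kc setUC; exact: H.
  - by rewrite k'c; exact: H.
  - by move=> /setDP[AF _] /setDP[BF _]; exact: (ext_overlap ext kk' AF BF).
have := ext_prod ext Gov; rewrite (bigD1 c) //=.
have -> : #|G c|%:R / #|F c|%:R = 1 + beta :> rat.
  rewrite ffunE eqxx (_ : F c :|: zf c = F c :|: miss); last first.
    by apply/setP => B; rewrite !inE; case: (B \in F c).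
  rewrite cardsU (_ : F c :&: miss = set0) ?cards0 ?subn0; last first.
    by apply/setP => B; rewrite !inE; case: (B \in F c).
  by rewrite natrD mulrDl divff // gt_eqF.
have -> : \prod_(i < l | i != c) (#|G i|%:R / #|F i|%:R) =
   \prod_(i < l | i != c) (1 - pr (F i) (fun A => A \in conflicting i)) :> rat.
  apply: eq_bigr => i /negPf ic; rewrite -prC ?(ext_neq0 ext) // /pr ffunE ic.
  by congr (_%:R / _); apply: eq_card => A; rewrite !inE andbC.
set pi := \prod_(_ < _ | _) _ => H.
have := @prod_1sub _ (fun i => i != c) (fun i : 'I_l => pr (F i) (fun A => A \in conflicting i)).
have p01 (i : 'I_l) : i != c -> 0 <= pr (F i) (fun A => A \in conflicting i) <= 1.
  by rewrite pr_ge0 pr_le1.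
move=> /(_ p01); rewrite -/pi; set s := \sum_(_ < _ | _) _ => sp.
have s1 : s <= 1/4.
  apply: le_trans C4_small'; apply: le_trans (_ : \sum_(i < l | i != c) C4 * eps <= _).
    by apply: ler_sum => i ic; exact: conflicting_le.
  rewrite sumr_const -[X in X <= _]mulr_natl ler_wpM2r ?mulr_ge0 ?(ltW e0) // ler_nat.
  by apply: leq_trans (max_card _) _; rewrite card_ord.
have b0 : 0 < beta by rewrite divr_gt0 // ltr0n card_gt0.
have s2 : s <= beta * (1/4).
  apply: le_trans (_ : \sum_(i < l | i != c) C6 * eps * beta <= _).
    by apply: ler_sum => i ic; exact: conflicting_beta.
  have X0 : 0 <= C6 * eps * beta.
    have C7_ge0 : 0 <= C7 by rewrite divr_ge0 ?(ltW c1_gt0) // mulr_ge0 // !exprn_ge0.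
    apply: mulr_ge0 (ltW b0); apply: mulr_ge0 (ltW e0); apply: addr_ge0 inner_ge0 _.
    by apply: mulr_ge0; [apply: mulr_ge0; [exact: C7_ge0 | exact: ler0n] | exact: ler0n].
  rewrite sumr_const -[X in X <= _]mulr_natl.
  apply: le_trans (_ : l%:R * (C6 * eps * beta) <= _).
    by rewrite ler_wpM2r // ler_nat; apply: leq_trans (max_card _) _; rewrite card_ord.
  by rewrite mulrA [beta * _]mulrC ler_wpM2r ?(ltW b0).
have b1 := mulr_gt0 b0 b0; move: H sp s1 s2 b0 b1.
move: beta pi s => B P s H sp s1 s2 b0 b1.
(* With [s <= 1/4] and [s <= B / 4], the product is at least [1 + B / 2]. *)
exfalso; have h : (1 + B) * (1 - s) <= 1.
  by apply: le_trans H; apply: ler_wpM2l => //; apply: addr_ge0 => //; exact: ltW.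
have h2 : B * s <= B * (1/4) by rewrite ler_wpM2l // ltW.
lra.
Qed.

End Exchange.

(** * Sizes of the zones *)

(** An expansion of [1 / ((1 - u) * (1 - T))]. The linear term in [u] has coefficient exactly 1, so
    ratios of order 1/n will be compared up to errors of order 1/n^2. *)
Lemma gain_arith (u r T : rat) : 0 <= u -> u <= 1/2 -> 0 <= T -> T <= 1/2 -> 0 <= r ->
  (1 - u) * (1 + r) * (1 - T) <= 1 -> r <= u + 2 * (u * u) + 4 * T.
Proof.
move=> u0 u2 T0 T2 r0 H.
have h1 : (1 - u) * (1 + r) <= 1 + 2 * T.
  have X0 : 0 <= 1 + 2 * T by lra.
  have h : (1 - u) * (1 + r) * (1 - T) * (1 + 2 * T) <= 1 * (1 + 2 * T) by apply: ler_wpM2r.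
  have Y0 : 0 <= (1 - u) * (1 + r) by apply: mulr_ge0; lra.
  have T1 : 0 <= T * (1 - 2 * T) by apply: mulr_ge0; lra.
  have := mulr_ge0 Y0 T1; lra.
have h2 : (1 - u) * r <= u + 2 * T by lra.
have h3 : (1 - u) * r * (1 + 2 * u) <= (u + 2 * T) * (1 + 2 * u) by apply: ler_wpM2r => //; lra.
have h4 : 0 <= r * (u * (1 - 2 * u)) by rewrite !mulr_ge0 //; lra.
have h5 : T * u <= T * (1/2) by apply: ler_wpM2l.
lra.
Qed.

Lemma loss_arith (x y c d s e : rat) : 0 <= x -> 0 <= c -> 0 <= d -> 0 <= e -> d * e <= 1 ->
  x - c * e ^+ 2 <= y -> x <= s * e -> x - (c + d * s) * e ^+ 2 <= y * (1 - d * e).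
Proof.
move=> x0 c0 d0 e0 de xy xs.
have h1 : (x - c * e ^+ 2) * (1 - d * e) <= y * (1 - d * e) by apply: ler_wpM2r => //; rewrite subr_ge0.
have h2 : d * e * x <= d * e * (s * e) by apply: ler_wpM2l => //; exact: mulr_ge0.
have h3 : 0 <= c * e ^+ 2 * (d * e).
  by apply: mulr_ge0; apply: mulr_ge0 => //; exact: exprn_ge0.
have h4 : d * e * (s * e) = d * s * e ^+ 2 by rewrite expr2; ring.
move: h1 h2 h3; rewrite h4; move: (e ^+ 2) => E; lra.
Qed.

Lemma compare_arith (a b rho E lC Q c T u : rat) : u = a + lC * E -> b - c * E <= rho ->
  u * u <= Q * E -> T <= E -> rho <= u + 2 * (u * u) + 4 * T -> b <= a + (lC + 2 * Q + 4 + c) * E.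
Proof. move=> -> *; lra. Qed.

Section Sizes.
Variables (l n : nat) (m : {set 'I_l} -> nat) (F : fam l n).
Hypothesis ext : extremal m F.
Notation eps := (n%:R^-1 : rat).
Variables (warm kappa : 'I_n -> 'I_l) (C0 C2 C4 : rat).
Hypothesis n0 : (0 < n)%N.
Hypothesis C0_ge0 : 0 <= C0.
Hypothesis C2_ge0 : 0 <= C2.
Hypothesis C4_ge0 : 0 <= C4.
Hypothesis hot_ge : forall x, 1/2 - C2 * eps <= p F (kappa x) x.
Local Notation sg := (sigma m).
Hypothesis card_low : 2 ^+ n * n%:R ^+ sigma m <= C0 * (\prod_(k < l) #|F k|)%:R.
Hypothesis delta_small : 2 ^+ sg.+1 * (2 * C2 * eps) <= 1/2.
Local Notation hot := (hot kappa).
Local Notation zone := (zone warm kappa).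
Local Notation off := (off warm kappa).
Local Notation zf := (zfam m warm kappa).
Implicit Types (U B D V Z G Y : {set 'I_n}) (k b : 'I_l) (x y : 'I_n).
Hypothesis p_off : forall k x, off k x -> p F k x <= C4 * eps ^+ 2.
Variable j : 'I_l * 'I_l -> nat.
Hypothesis j_diag : forall k, j (k, k) = 0%N.
Hypothesis j_sum : forall k k', k != k' -> (j (k, k') + j (k', k) = m [set k; k'])%N.
Hypothesis j_orient : forall k k', k != k' -> j (k, k') = 0%N \/ j (k', k) = 0%N.
Hypothesis zone_e : forall k k', j (k, k') = 0%N -> zone (k, k') = set0.
Hypothesis warm_hot : forall x, warm x != kappa x.
Hypothesis C4_small : C4 * eps <= 1/2.
Variables dd gg : nat.
Hypothesis expo : forall q w, (0 < w)%N -> (w <= sg)%N -> (n <= dd * q)%N ->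
  C0 * n.+1%:R ^+ (sg * l.+1) * (1 - 2 ^- w) ^+ q <= eps ^+ (sg + 4).
Variable tiny : rat.
Hypothesis tinyE : n.+1%:R ^+ sg * eps ^+ (sg + 4) = tiny.
Hypothesis tiny_ge0 : 0 <= tiny.
Hypothesis tiny_le : tiny <= eps ^+ 2.
Hypothesis tiny_half : tiny <= 1/2.
Hypothesis zone_ge : forall r, (0 < j r)%N -> (n <= gg * #|zone r|)%N.
Hypothesis zone_ge2 : forall r, (0 < j r)%N -> (2 * sg <= #|zone r|)%N.
Hypothesis dd_gg : (2 * gg <= dd)%N.
Hypothesis zsub : forall k, zf k \subset F k.
Hypothesis s0 : (0 < sg)%N.

Let e0 : 0 < eps. Proof. by rewrite invr_gt0 ltr0n. Qed.
Let en : n%:R * eps = 1. Proof. by rewrite mulfV // pnatr_eq0 -lt0n. Qed.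

Local Notation ratio r := ((j r)%:R / #|zone r|%:R : rat).
Local Notation C9 := (sg%:R * gg%:R : rat).
Hypothesis C2_small : (2 * C2 + 2 * C9) * eps <= 1.
Hypothesis C9_small : (C9 + l%:R * C4) * eps <= 1/2.

Lemma j_full k k' : (0 < j (k, k'))%N -> k != k' /\ j (k, k') = m [set k; k'].
Proof.
move=> j0; have kk' : k != k' by apply: contraTneq j0 => ->; rewrite j_diag.
split=> //; rewrite -j_sum //; case: (j_orient kk') => E; first by rewrite E in j0.
by rewrite E addn0.
Qed.

Lemma j_le_sg r : (j r <= sg)%N.
Proof.
case: r => k k'; have [->//|/j_full[kk' ->]] := posnP (j (k, k')).
by rewrite le_sigma // cards2 kk'.
Qed.

Lemma zone_gt0 r : (0 < j r)%N -> 0 < #|zone r|%:R :> rat.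
Proof.
move=> /zone_ge2 H; rewrite ltr0n; apply: leq_trans H.
by rewrite muln_gt0.
Qed.

Lemma ratio_ge0 r : 0 <= ratio r. Proof. exact: divr_ge0. Qed.

Lemma ratio_le r : (0 < j r)%N -> ratio r <= C9 * eps.
Proof.
move=> jr; rewrite (ler_pdivrMr _ _ (zone_gt0 jr)) mulrAC.
have np : 0 < n%:R :> rat by rewrite ltr0n.
rewrite (ler_pdivlMr _ _ np) -!natrM ler_nat -mulnA.
by apply: leq_mul; [exact: j_le_sg | exact: zone_ge].
Qed.

Let cap := cap_hot ext C2_ge0 hot_ge delta_small.

(** By [cap_hot] the members meet the zone in at most [j] elements, so the ratio bounds the average
    of [p] over the zone. *)
Lemma exists_light r : (0 < j r)%N -> exists2 x, x \in zone r & p F r.1 x <= ratio r.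
Proof.
case: r => k k' jr; have [kk' jE] := j_full jr.
have z0 := zone_gt0 jr; rewrite ltr0n in z0.
apply/exists_inP; apply: contraT => /exists_inPn /= H; exfalso.
have f0 : 0 < #|F k|%:R :> rat by rewrite ltr0n (ext_card_gt0 ext).
have H1 : \sum_(x in zone (k, k')) p F k x <= (j (k, k'))%:R.
  rewrite /p /pr -mulr_suml ler_pdivrMr // -natr_sum -sum_card_in -natrM ler_nat mulnC.
  rewrite -sum_nat_const; apply: leq_sum => B BF; rewrite jE.
  apply: leq_trans (cap kk' BF); apply: subset_leq_card; apply: setIS; exact: zone_hot.
have H2 : \sum_(x in zone (k, k')) ratio (k, k') < \sum_(x in zone (k, k')) p F k x.
  apply: ltr_sum => [|x /H]; last by rewrite -ltNge.
  have /card_gt0P[x xz] := z0; apply/hasP; exists x; rewrite ?mem_index_enum //.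
move: (lt_le_trans H2 H1); rewrite sumr_const -[X in X < _]mulr_natr divfK ?ltxx //.
by rewrite pnatr_eq0 -lt0n.
Qed.

Lemma zoneD r r' : r != r' -> zone r :&: zone r' = set0.
Proof.
move=> rr'; apply/setP => x; rewrite !inE; apply/negP => /andP[/eqP E /eqP E'].
by rewrite -E -E' eqxx in rr'.
Qed.

Section Deficient.
Variables k k'' : 'I_l.
Hypothesis jk : (0 < j (k, k''))%N.
Let M := m [set k; k''].
Let BB := deficient (zf k) (zone (k, k'')) M.

Let kk'' : k != k''. Proof. by have [] := j_full jk. Qed.
Let jE : j (k, k'') = M. Proof. by have [] := j_full jk. Qed.

Let zcap B : B \in zf k -> (#|B :&: zone (k, k'')| <= M)%N.
Proof. by move=> /zfamP[_]; exact. Qed.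

Let zdel B z : B \in zf k -> B :\ z \in zf k.
Proof. by move=> BT; apply: zfam_down BT; exact: subsetDl. Qed.

Let zadd B z : B \in zf k -> z \in zone (k, k'') -> (#|B :&: zone (k, k'')| < M)%N -> z |: B \in zf k.
Proof. exact: zfam_add. Qed.

Let f0 : 0 < #|F k|%:R :> rat. Proof. by rewrite ltr0n (ext_card_gt0 ext). Qed.

(** With [a] the zone size and [r = j / a], [deficient_ge] gives a proportion [j / (a + j)] of
    [zf k], at least [r - r ^ 2]; the other error term comes from comparing [zf k] with [F k]. *)
Lemma deficient_fraction :
  ratio (k, k'') - (C9 ^+ 2 + C4 * C9) * eps ^+ 2 <= #|BB|%:R / #|F k|%:R.
Proof.
have H := deficient_ge zcap (fun B z BT _ => zdel z BT) zadd; rewrite -/BB -jE in H.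
have z0 := zone_gt0 jk; have rl := ratio_le jk; have r0 := ratio_ge0 (k, k'').
rewrite -(ler_nat rat) !natrM natrD in H.
have Hz := card_fam_le_zfam ext n0 C2_ge0 C4_ge0 hot_ge delta_small p_off j_orient zone_e warm_hot k.
rewrite (ler_pdivlMr _ _ f0).
have sq : ratio (k, k'') * ratio (k, k'') <= C9 * eps * (C9 * eps) by apply: ler_pM.
have c4 : C4 * eps * ratio (k, k'') <= C4 * eps * (C9 * eps).
  by apply: ler_wpM2l => //; exact: mulr_ge0 C4_ge0 (ltW e0).
have h1 : ratio (k, k'') - ratio (k, k'') * ratio (k, k'') <=
    (j (k, k''))%:R / (#|zone (k, k'')|%:R + (j (k, k''))%:R).
  move: z0; move: (#|zone (k, k'')|%:R : rat) ((j (k, k''))%:R : rat) (ler0n rat (j (k, k''))).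
  move=> a M' M0 a0; have aM : 0 < a + M' by lra.
  rewrite (ler_pdivlMr _ _ aM).
  have -> : (M' / a - M' / a * (M' / a)) * (a + M') = M' - M' * (M' / a * (M' / a)).
    by field; rewrite gt_eqF.
  by rewrite gerBl mulr_ge0 // mulr_ge0 // divr_ge0 // ltW.
have h2 : (j (k, k''))%:R / (#|zone (k, k'')|%:R + (j (k, k''))%:R) * #|zf k|%:R <= #|BB|%:R :> rat.
  have aM : 0 < #|zone (k, k'')|%:R + (j (k, k''))%:R :> rat.
    by have := ler0n rat (j (k, k'')); lra.
  by rewrite mulrAC (ler_pdivrMr _ _ aM) [X in _ <= X]mulrC.
apply: le_trans h2.
have q0 : 0 <= (j (k, k''))%:R / (#|zone (k, k'')|%:R + (j (k, k''))%:R) :> rat.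
  by rewrite divr_ge0 ?addr_ge0.
apply: le_trans (ler_wpM2l q0 Hz); rewrite [X in _ <= X]mulrA; apply: ler_wpM2r; first exact: ltW f0.
have e1 : 0 <= 1 - C4 * eps by have := C4_small; lra.
apply: le_trans (ler_wpM2r e1 h1).
have -> : (C9 ^+ 2 + C4 * C9) * eps ^+ 2 = C9 * eps * (C9 * eps) + C4 * eps * (C9 * eps).
  by rewrite !expr2; ring.
have X0 : 0 <= ratio (k, k'') * ratio (k, k'') * (C4 * eps).
  by apply: mulr_ge0; [exact: mulr_ge0 | exact: mulr_ge0 C4_ge0 (ltW e0)].
move: sq c4 X0; move: (ratio _) (C9 * eps) (C4 * eps) => r c d; lra.
Qed.

Let BBP B : reflect (B \in zf k /\ (#|B :&: zone (k, k'')| < M)%N) (B \in BB).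
Proof. by rewrite [B \in BB]inE; exact: andP. Qed.

Let BB_sub : BB \subset F k.
Proof. by apply: subset_trans (zsub k); apply/subsetP => B /BBP[]. Qed.

Let BB_down : downset BB.
Proof.
move=> A B AB /BBP[BT BM]; apply/BBP; split; first exact: zfam_down AB BT.
by apply: leq_ltn_trans BM; apply: subset_leq_card; exact: setSI.
Qed.

Let BB_addable B : B \in BB -> (n <= dd * #|addable F kappa k k'' B|)%N.
Proof.
move=> /BBP[BT BM].
have sub : zone (k, k'') :\: B \subset addable F kappa k k'' B.
  apply/subsetP => z /setDP[zz zB]; rewrite inE zB (subsetP (zone_hot _ _ _ _) _ zz) /=.
  by apply: (subsetP (zsub k)); exact: zfam_add BM.
have h1 : (#|zone (k, k'')| <= #|zone (k, k'') :\: B| + sg)%N.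
  rewrite -(cardsID B (zone (k, k''))) addnC leq_add2l setIC.
  apply: leq_trans (ltnW BM) _; rewrite -jE; exact: j_le_sg.
have h2 := zone_ge2 jk; have h3 := subset_leq_card sub.
apply: leq_trans (zone_ge jk) _.
apply: leq_trans (_ : gg * (2 * #|addable F kappa k k'' B|) <= _)%N.
  rewrite leq_mul2l; apply/orP; right.
  by move: h1 h2 h3; move: #|zone _| #|_ :\: _| #|addable _ _ _ _ _| sg; clear; move=> *; lia.
by rewrite mulnA [(gg * 2)%N]mulnC leq_mul2r dd_gg orbT.
Qed.

(** If [x] is hot for [k], at least half of [BB] and about half of [F k] avoid it. If [x] is warm
    for [k], its zone differs from [(k, k'')], so [BB] is free to gain or lose elements there and
    [deficient_le] shows that few members contain [x]. Otherwise no member of [BB] contains [x]. *)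
Lemma deficient_without r x : (0 < j r)%N -> r != (k, k'') -> x \in zone r ->
  #|BB|%:R / #|F k|%:R * (1 - (2 * C2 + 2 * C9) * eps) <=
  #|[set B in BB | x \notin B]|%:R / #|[set B in F k | x \notin B]|%:R :> rat.
Proof.
case: r => w h jr rk xz; have [wh jrE] := j_full jr.
move: xz; rewrite inE xpair_eqE => /andP[/eqP wx /eqP hx].
have C9_ge0 : 0 <= C9 by exact: mulr_ge0.
have N0 : 0 < #|[set B in F k | x \notin B]|%:R :> rat.
  rewrite ltr0n card_gt0; apply/set0Pn; exists set0; rewrite !inE andbT.
  have /set0Pn[B BF] := ext_neq0 ext k; exact: ext_down ext _ _ _ (sub0set _) BF.
have N1 : #|[set B in F k | x \notin B]|%:R <= #|F k|%:R :> rat.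
  by rewrite ler_nat; apply/subset_leq_card/subsetP => B; rewrite inE => /andP[].
have mono (d : rat) : 0 <= d -> d <= (2 * C2 + 2 * C9) * eps ->
   #|BB|%:R * (1 - d) <= #|[set B in BB | x \notin B]|%:R ->
   #|BB|%:R / #|F k|%:R * (1 - (2 * C2 + 2 * C9) * eps) <=
   #|[set B in BB | x \notin B]|%:R / #|[set B in F k | x \notin B]|%:R.
  move=> d0 dC H; rewrite (ler_pdivlMr _ _ N0).
  apply: le_trans (_ : #|BB|%:R / #|F k|%:R * (1 - d) * #|F k|%:R <= _); last first.
    by rewrite mulrAC divfK ?gt_eqF.
  apply: ler_pM => //; first by rewrite mulr_ge0 ?divr_ge0 // subr_ge0.
  by rewrite ler_wpM2l ?divr_ge0 // lerD2l lerN2.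
have splitBB : #|BB| = (#|[set B in BB | x \in B]| + #|[set B in BB | x \notin B]|)%N.
  rewrite -(cardsID [set B : {set 'I_n} | x \in B]); congr (_ + _)%N.
    by apply: eq_card => B; rewrite !inE.
  by apply: eq_card => B; rewrite !inE andbC.
have [hk|hk] := eqVneq h k.
  have H1 : (#|BB| <= 2 * #|[set B in BB | x \notin B]|)%N.
    rewrite splitBB mul2n -addnn leq_add2r.
    apply: (card_inj_le (f := fun B => B :\ x)) => [B C|B].
      move=> /setIdP[_ xB] /setIdP[_ xC] E.
      by rewrite -(setD1K xB) -(setD1K xC) E.
    move=> /setIdP[BBB xB]; apply/setIdP; split; last by rewrite !inE eqxx.
    exact: BB_down (subsetDl _ _) BBB.
  rewrite -(ler_nat rat) natrM in H1.
  have NE : #|[set B in F k | x \notin B]|%:R <= (1/2 + C2 * eps) * #|F k|%:R :> rat.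
    have -> : #|[set B in F k | x \notin B]|%:R = (1 - p F k x) * #|F k|%:R.
      by rewrite -(p_notin ext) pr_mul.
    apply: ler_wpM2r; first exact: ltW f0.
    by have := hot_ge x; rewrite hx hk; lra.
  rewrite (ler_pdivlMr _ _ N0).
  apply: le_trans (_ : #|BB|%:R / #|F k|%:R * (1 - (2 * C2) * eps) * ((1/2 + C2 * eps) * #|F k|%:R) <= _).
    apply: ler_pM => //; last first.
      rewrite ler_wpM2l ?divr_ge0 // lerD2l lerN2; apply: ler_wpM2r; first exact: ltW e0.
      by rewrite lerDl; exact: mulr_ge0.
    by apply: mulr_ge0; [exact: divr_ge0 | have := C2_small; lra].
  have -> : #|BB|%:R / #|F k|%:R * (1 - 2 * C2 * eps) * ((1/2 + C2 * eps) * #|F k|%:R) =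
     #|BB|%:R * ((1 - 2 * C2 * eps) * (1/2 + C2 * eps)) :> rat.
    move: f0; move: (#|F k|%:R : rat) (#|BB|%:R : rat) (1 - 2 * C2 * eps) (1/2 + C2 * eps) => f B u v f1.
    by field; rewrite gt_eqF.
  apply: le_trans (_ : #|BB|%:R * (1/2) <= _); last by move: H1; lra.
  apply: ler_wpM2l => //.
  have X0 : 0 <= C2 * eps * (C2 * eps) by apply: mulr_ge0; apply: mulr_ge0 => //; exact: ltW.
  move: X0; rewrite -[2 * C2 * eps]mulrA; move: (C2 * eps) => c; lra.
have X2 : 0 <= 2 * C2 by exact: mulr_ge0.
have X9 : 0 <= 2 * C9 by exact: mulr_ge0.
have [wk|wk] := eqVneq w k; last first.
  apply: (mono 0) => //.
    by apply: mulr_ge0 (ltW e0); exact: addr_ge0.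
  rewrite subr0 mulr1 ler_nat; apply/subset_leq_card/subsetP => B BBB.
  apply/setIdP; split=> //; apply/negP => xB; move: BBB => /BBP[/zfamP[/(_ x xB) H _] _]; move: H.
  by rewrite not_off wx hx ![k == _]eq_sym (negPf wk) (negPf hk).
apply: (mono (2 * C9 * eps)).
- by apply: mulr_ge0 (ltW e0).
- by apply: ler_wpM2r; [exact: ltW e0 | rewrite lerDr].
pose A := zone (w, h); pose N := m [set w; h].
have zN : A :&: zone (k, k'') = set0 by exact: zoneD.
have A_cap B : B \in BB -> (#|B :&: A| <= N)%N.
  by move=> /BBP[/zfamP[_ H] _]; rewrite /A /N wk; exact: H.
have A_del B z : B \in BB -> z \in A -> B :\ z \in BB.
  by move=> BBB _; apply: BB_down BBB; exact: subsetDl.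
have A_add B z : B \in BB -> z \in A -> (#|B :&: A| < N)%N -> z |: B \in BB.
  move=> /BBP[BT BM] zA lt; apply/BBP; split.
    by apply: (@zfam_add _ _ _ _ _ k h) => //; rewrite -wk.
  rewrite (_ : (z |: B) :&: _ = B :&: zone (k, k'')) //; apply/setP => y.
  rewrite !in_setI in_setU1; case: (eqVneq y z) => //= ->.
  by have /setP/(_ z) := zN; rewrite in_setI zA in_set0 /= => ->; rewrite andbF.
have H1 := deg_le_deficient A_cap A_del A_add (y := x).
have xA : x \in A by rewrite inE wx hx.
have {}H1 := H1 xA.
have H2 := deficient_le A_cap A_del A_add.
have H3 : (#|A| * #|[set B in BB | x \in B]| <= 2 * N * #|BB|)%N.
  by apply: leq_trans H2; rewrite leq_mul2l H1 orbT.
have z0 := zone_gt0 jr; have rl := ratio_le jr.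
rewrite -(ler_nat rat) !natrM in H3.
have H4 : #|[set B in BB | x \in B]|%:R <= 2 * ratio (w, h) * #|BB|%:R :> rat.
  rewrite mulrA -[2 * _ / _ * _]mulrAC (ler_pdivlMr _ _ z0) mulrC jrE.
  exact: H3.
have H5 : #|[set B in BB | x \in B]|%:R <= #|BB|%:R * (2 * C9 * eps) :> rat.
  apply: le_trans H4 _; rewrite [X in _ <= X]mulrC; apply: ler_wpM2r => //.
  by rewrite -[2 * C9 * eps]mulrA; apply: ler_wpM2l.
have S : #|BB|%:R = #|[set B in BB | x \in B]|%:R + #|[set B in BB | x \notin B]|%:R :> rat.
  by rewrite -natrD -splitBB.
rewrite mulrBr mulr1 lerBlDl; apply: le_trans (lerD H5 (lexx _)).
by rewrite -S.
Qed.

(** A light element of zone [r] is moved to zone [(k, k'')]: removing it costs about [ratio r]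
    beyond the half lost at its hot index, and adding it to the deficient members of [F k] and
    almost freely to [F k''] gains about [ratio (k, k'')]. Extremality forbids a net gain. *)
Lemma ratio_compare r : (0 < j r)%N ->
  ratio (k, k'') <= ratio r +
    (l%:R * C4 + 2 * (C9 + l%:R * C4) ^+ 2 + 4 + (C9 ^+ 2 + C4 * C9 + (2 * C2 + 2 * C9) * C9)) * eps ^+ 2.
Proof.
move=> jr; have C9_ge0 : 0 <= C9 by exact: mulr_ge0.
have lC4 : 0 <= l%:R * C4 by exact: mulr_ge0.
have E2 : 0 <= eps ^+ 2 by apply: exprn_ge0; exact: ltW e0.
have d0 : 0 <= 2 * C2 + 2 * C9.
  by apply: addr_ge0; apply: mulr_ge0 => //; exact: ler0n.
have c0 : 0 <= C9 ^+ 2 + C4 * C9 by apply: addr_ge0; [exact: exprn_ge0 | exact: mulr_ge0].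
have K0 : 0 <= l%:R * C4 + 2 * (C9 + l%:R * C4) ^+ 2 + 4 + (C9 ^+ 2 + C4 * C9 + (2 * C2 + 2 * C9) * C9).
  apply: addr_ge0; last by apply: addr_ge0 => //; exact: mulr_ge0.
  apply: addr_ge0; last exact: ler0n.
  apply: addr_ge0 => //; apply: mulr_ge0; first exact: ler0n.
  by apply: exprn_ge0; exact: addr_ge0.
have [->|rk] := eqVneq r (k, k''); first by rewrite lerDl; exact: mulr_ge0.
have [x xz px] := exists_light jr.
have := readd ext n0 C0_ge0 C2_ge0 hot_ge card_low delta_small expo x kk'' BB_sub BB_addable s0.
rewrite tinyE; have := deficient_without jr rk xz.
set rho := #|[set B in BB | _]|%:R / _ => rho_ge H.
have rho0 : 0 <= rho by exact: divr_ge0.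
have y_ge := loss_arith (ratio_ge0 (k, k'')) c0 d0 (ltW e0) C2_small deficient_fraction (ratio_le jk).
have {}rho_ge := le_trans y_ge rho_ge.
have hx : kappa x = r.2 by move: xz; rewrite inE => /eqP <-.
have wx : warm x = r.1 by move: xz; rewrite inE => /eqP <-.
pose u := ratio r + l%:R * (C4 * eps ^+ 2).
have sum_le : \sum_(i < l | i != kappa x) p F i x <= u.
  rewrite (bigD1 (warm x)) ?warm_hot //=; apply: lerD; first by rewrite wx.
  apply: le_trans (_ : \sum_(i < l | (i != kappa x) && (i != warm x)) C4 * eps ^+ 2 <= _).
    by apply: ler_sum => i /andP[ik iw]; apply: p_off; rewrite /off iw ik.
  rewrite sumr_const -[X in X <= _]mulr_natl; apply: ler_wpM2r; first exact: mulr_ge0.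
  by rewrite ler_nat; apply: leq_trans (max_card _) _; rewrite card_ord.
have prod_ge : 1/2 * (1 - u) <= \prod_(i < l) (1 - p F i x).
  rewrite (bigD1 (kappa x)) //=.
  have h1 : 1/2 <= 1 - p F (kappa x) x by have := p_le_half ext (kappa x) x; lra.
  have h2 : 0 <= \prod_(i < l | i != kappa x) (1 - p F i x).
    by apply: prodr_ge0 => i _; rewrite subr_ge0 pr_le1.
  apply: le_trans (ler_wpM2r h2 h1); apply: ler_wpM2l; first by rewrite divr_ge0.
  apply: le_trans (prod_1sub _); last by move=> i _; rewrite pr_ge0 pr_le1.
  by rewrite lerD2l lerN2.
have e1 : eps <= 1 by rewrite invf_le1 ?ltr0n // ler1n.
have u_le : u <= (C9 + l%:R * C4) * eps.
  rewrite mulrDl; apply: lerD; first exact: ratio_le.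
  rewrite mulrA; apply: ler_wpM2l => //; rewrite expr2.
  by rewrite -[X in _ <= X]mulr1; apply: ler_wpM2l => //; exact: ltW e0.
have u0 : 0 <= u by apply: addr_ge0; [exact: ratio_ge0 | apply: mulr_ge0 => //; exact: mulr_ge0].
have H2 : (1 - u) * (1 + rho) * (1 - tiny) <= 1.
  have h1 : 0 <= 1 + rho by exact: addr_ge0.
  have h2 : 0 <= 2 - 2 * tiny by move: tiny_half; lra.
  have := ler_wpM2r h2 (ler_wpM2r h1 prod_ge).
  move: H; move: (\prod_(_ < _) _) => P HP Hle; have := le_trans Hle HP; lra.
have u2 : u * u <= (C9 + l%:R * C4) ^+ 2 * eps ^+ 2.
  by rewrite -exprMn expr2; apply: ler_pM.
have G := gain_arith u0 (le_trans u_le C9_small) tiny_ge0 tiny_half rho0 H2.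
have uE : u = ratio r + l%:R * C4 * eps ^+ 2 by rewrite /u mulrA.
exact: compare_arith uE rho_ge u2 tiny_le G.
Qed.

End Deficient.

Local Notation K8 := (l%:R * C4 + 2 * (C9 + l%:R * C4) ^+ 2 + 4 +
  (C9 ^+ 2 + C4 * C9 + (2 * C2 + 2 * C9) * C9)).

(** The zone sizes sum to [n], and the ratios weighted by the zone sizes sum to [sg]. As all ratios
    of nonempty zones agree up to [K * eps ^+ 2], each [n * ratio r] equals [sg] up to [K * eps]. *)
Lemma zone_size r : (0 < j r)%N ->
  `|#|zone r|%:R - (j r * n)%N%:R / sg%:R| <= K8 * eps * ((j r * n)%N%:R / sg%:R).
Proof.
move=> jr; have [K K_eq] : exists K, K = K8 by exists K8.
have cmp r1 r2 : (0 < j r1)%N -> (0 < j r2)%N -> ratio r1 <= ratio r2 + K * eps ^+ 2.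
  by case: r1 => k k'' j1 j2; rewrite K_eq; exact: ratio_compare.
rewrite -K_eq {K_eq}; have np : 0 < n%:R :> rat by rewrite ltr0n.
have sp : 0 < sg%:R :> rat by rewrite ltr0n.
have K0 : 0 <= K * eps ^+ 2 by have := cmp r r jr jr; rewrite lerDl.
have E : n%:R * (K * eps ^+ 2) = K * eps.
  by rewrite expr2 mulrCA [n%:R * (_ * _)]mulrA en mul1r.
have Ke0 : 0 <= K * eps by rewrite -E mulr_ge0 // ltW.
have jE r1 : (j r1)%:R = ratio r1 * #|zone r1|%:R :> rat.
  have [j0|j1] := posnP (j r1); last by rewrite divfK // gt_eqF // zone_gt0.
  by rewrite j0 mul0r mul0r.
have sgE : sg%:R = \sum_r1 ratio r1 * #|zone r1|%:R :> rat.
  by rewrite -(sum_type j_diag j_sum) natr_sum; apply: eq_bigr => r1 _; exact: jE.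
have nE : n%:R = \sum_r1 #|zone r1|%:R :> rat by rewrite -natr_sum sum_zone.
have z_empty r1 : j r1 = 0%N -> #|zone r1| = 0%N.
  by case: r1 => k k' /zone_e ->; rewrite cards0.
have up : sg%:R <= n%:R * ratio r + K * eps.
  rewrite -E -mulrDr sgE.
  apply: le_trans (_ : \sum_r1 #|zone r1|%:R * (ratio r + K * eps ^+ 2) <= _); last first.
    by rewrite -mulr_suml -nE.
  apply: ler_sum => r1 _.
  have [/z_empty ->|j1] := posnP (j r1); first by rewrite mulr0 mul0r.
  by rewrite mulrC; apply: ler_wpM2l => //; exact: cmp.
have lo : n%:R * ratio r - K * eps <= sg%:R.
  rewrite -E -mulrBr sgE.
  apply: le_trans (_ : _ <= \sum_r1 #|zone r1|%:R * (ratio r - K * eps ^+ 2)) _.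
    by rewrite -mulr_suml -nE.
  apply: ler_sum => r1 _.
  have [/z_empty ->|j1] := posnP (j r1); first by rewrite mulr0 mul0r.
  by rewrite [X in _ <= X]mulrC; apply: ler_wpM2l => //; rewrite lerBlDr; exact: cmp.
have z0 := zone_gt0 jr.
have zn : #|zone r|%:R <= n%:R :> rat by rewrite ler_nat -[X in (_ <= X)%N](card_ord n) max_card.
have rz : n%:R * ratio r * #|zone r|%:R = (j r)%:R * n%:R by rewrite -mulrA -jE mulrC.
have Kz : K * eps * #|zone r|%:R <= K * 1.
  apply: le_trans (_ : K * eps * n%:R <= _); first exact: ler_wpM2l.
  by rewrite -mulrA [eps * _]mulrC en.
have Kge0 : 0 <= K by rewrite -(pmulr_lge0 _ e0).
have j1 : 1 <= (j r)%:R :> rat by rewrite ler1n.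
have Kj : K * 1 <= K * (j r)%:R by apply: ler_wpM2l.
have -> : K * eps * ((j r * n)%N%:R / sg%:R) = K * (j r)%:R / sg%:R.
  rewrite natrM; have := en; move: eps => e; move: (n%:R : rat) ((j r)%:R : rat) (sg%:R^-1 : rat) => N J S eN.
  have -> : K * e * (J * N * S) = K * J * S * (N * e) by ring.
  by rewrite eN mulr1.
rewrite natrM (ler_pdivlMr _ _ sp).
have -> : `|#|zone r|%:R - (j r)%:R * n%:R / sg%:R| * sg%:R =
   `|#|zone r|%:R * sg%:R - (j r)%:R * n%:R| :> rat.
  have := normrM (#|zone r|%:R - (j r)%:R * n%:R / sg%:R) (sg%:R : rat).
  by rewrite (gtr0_norm sp) => <-; rewrite mulrBl divfK // gt_eqF.
apply: le_trans Kj; apply: le_trans Kz; rewrite ler_norml -rz.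
have u1 := ler_wpM2r (ltW z0) up; have l1 := ler_wpM2r (ltW z0) lo.
apply/andP; split.
  by move: l1; rewrite mulrBl [#|_|%:R * sg%:R]mulrC; lra.
by move: u1; rewrite mulrDl [#|_|%:R * sg%:R]mulrC; lra.
Qed.

End Sizes.

(** * Asymptotics *)

Definition eventually_nat (Q : nat -> Prop) := exists N : nat, forall n, (N <= n)%N -> Q n.

Lemma ev_and (Q R : nat -> Prop) :
  eventually_nat Q -> eventually_nat R -> eventually_nat (fun n => Q n /\ R n).
Proof.
move=> [N HN] [M HM]; exists (maxn N M) => n; rewrite geq_max => /andP[a b].
by split; [exact: HN | exact: HM].
Qed.

Lemma ev_ge N : eventually_nat (fun n => (N <= n)%N). Proof. by exists N. Qed.

Lemma ev_small (C d : rat) : 0 < d -> eventually_nat (fun n => C * n%:R^-1 <= d).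
Proof.
move=> d0; have [C0|C0] := lerP C 0.
  by exists 0%N => n _; apply: le_trans (ltW d0); rewrite mulr_le0_ge0 ?invr_ge0.
exists (Num.bound (C / d)) => n nb.
have h : C / d < n%:R.
  apply: lt_le_trans (archi_boundP _) _; first by rewrite divr_ge0 // ltW.
  by rewrite ler_nat.
have np : 0 < n%:R :> rat by apply: le_lt_trans h; rewrite divr_ge0 // ltW.
by rewrite (ler_pdivrMr _ _ np) mulrC -(ler_pdivrMr _ _ d0) ltW.
Qed.

Lemma bernoulli (x : rat) n : 0 <= x -> 1 + n%:R * x <= (1 + x) ^+ n.
Proof.
move=> x0; elim: n => [|n IH]; first by rewrite mul0r addr0.
rewrite exprS -natr1; have x1 : 0 <= 1 + x by exact: addr_ge0.
apply: le_trans (ler_wpM2l x1 IH).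
have : 0 <= x * (n%:R * x) by rewrite !mulr_ge0.
by move: (n%:R : rat) => N; lra.
Qed.

(** Since [(1 - t) * (1 + t) <= 1], a lower bound for [(1 + t) ^+ q] suffices; it is Bernoulli's
    inequality with exponent [q %/ s], raised to the power [s]. *)
Lemma exp_beats_poly (t : rat) (s q : nat) : 0 < t -> t <= 1 -> (0 < s)%N -> (0 < q)%N ->
  (1 - t) ^+ q <= (s%:R / (t * q%:R)) ^+ s.
Proof.
move=> t0 t1 s0 q0; pose q' := (q %/ s)%N.
have sp : 0 < s%:R :> rat by rewrite ltr0n.
have qp : 0 < q%:R :> rat by rewrite ltr0n.
have tp : 0 < 1 + t by lra.
have h1 : (1 - t) ^+ q <= ((1 + t) ^+ q)^-1.
  rewrite -[X in _ <= X]mul1r (ler_pdivlMr _ _ (exprn_gt0 _ tp)) -exprMn.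
  apply: exprn_ile1; last first.
    have : 0 <= t * t by rewrite mulr_ge0 // ltW.
    lra.
  by apply: mulr_ge0; lra.
have h2 : (t * q%:R / s%:R) ^+ s <= (1 + t) ^+ q.
  apply: le_trans (_ : ((1 + t) ^+ q') ^+ s <= _); last first.
    rewrite -exprM; apply: ler_weXn2l; first by lra.
    exact: leq_divM.
  apply: lerXn2r; rewrite ?nnegrE.
  - by rewrite divr_ge0 ?mulr_ge0 // ltW.
  - by rewrite exprn_ge0 // ltW.
  apply: le_trans (bernoulli _ (ltW t0)); rewrite (ler_pdivrMr _ _ sp).
  have h3 : q%:R <= (q'%:R + 1) * s%:R :> rat.
    by rewrite natr1 -natrM ler_nat mulSn addnC {1}(divn_eq q s) leq_add2l ltnW // ltn_pmod.
  have := ler_wpM2l (ltW t0) h3.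
  have : 0 <= (1 - t) * s%:R by rewrite mulr_ge0 ?subr_ge0 // ltW.
  by move: (q'%:R : rat) (s%:R : rat) (q%:R : rat) => a b c; lra.
apply: le_trans h1 _.
have -> : (s%:R / (t * q%:R)) ^+ s = ((t * q%:R / s%:R) ^+ s)^-1.
  by rewrite -exprVn invf_div.
rewrite lef_pV2 // posrE exprn_gt0 // divr_gt0 // mulr_gt0 //.
Qed.

Lemma ev_expo (C0 : rat) (a b w0 dd : nat) : 0 <= C0 -> (0 < dd)%N ->
  eventually_nat (fun n => forall q w, (w <= w0)%N -> (n <= dd * q)%N ->
    C0 * n.+1%:R ^+ a * (1 - 2 ^- w) ^+ q <= (n%:R^-1) ^+ b).
Proof.
(* The exponent [a + b + 1] leaves one factor [1 / n] to spare, which absorbs the constants. *)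
move=> C00 dd0; pose t : rat := 2 ^- w0; pose s := (a + b).+1.
have two w : 0 < 2 ^+ w :> rat by rewrite exprn_gt0.
have t0 : 0 < t by rewrite invr_gt0.
have t1 : t <= 1 by rewrite invf_le1 // exprn_ege1 // ler1n.
pose R : rat := s%:R * dd%:R / t.
have [N HN] := ev_and (ev_small (C0 * 2 ^+ a * R ^+ s) ltr01) (ev_ge 1).
exists N => n /HN[small n0] q w ww nq.
have np : 0 < n%:R :> rat by rewrite ltr0n.
have q0 : (0 < q)%N by case: q nq => //; rewrite muln0 leqNgt n0.
have h1 : (1 - 2 ^- w) ^+ q <= (1 - t) ^+ q :> rat.
  apply: lerXn2r; rewrite ?nnegrE ?subr_ge0 //.
    by rewrite invf_le1 // exprn_ege1 // ler1n.
  by rewrite lerD2l lerN2 lef_pV2 ?posrE // ler_eXn2l // ltr1n.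
have h2 : (s%:R / (t * q%:R)) <= R * n%:R^-1.
  rewrite (ler_pdivlMr _ _ np) /R mulrAC (ler_pdivrMr _ _ (mulr_gt0 t0 _)) ?ltr0n //.
  have -> : s%:R * dd%:R / t * (t * q%:R) = s%:R * (dd%:R * q%:R).
    by rewrite [LHS]mulrA divfK ?gt_eqF // mulrA.
  by apply: ler_wpM2l => //; rewrite -natrM ler_nat.
have h3 : (1 - 2 ^- w) ^+ q <= (R * n%:R^-1) ^+ s :> rat.
  apply: le_trans h1 _; apply: le_trans (exp_beats_poly t0 t1 (ltn0Sn _) q0) _.
  apply: lerXn2r h2; rewrite nnegrE; first by rewrite divr_ge0 // mulr_ge0 // ltW.
  by rewrite mulr_ge0 ?invr_ge0 // divr_ge0 ?mulr_ge0 // ltW.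
have h4 : n.+1%:R ^+ a <= 2 ^+ a * n%:R ^+ a :> rat.
  rewrite -exprMn; apply: lerXn2r; rewrite ?nnegrE ?mulr_ge0 //.
  by rewrite -natrM ler_nat mul2n -addnn -addn1 leq_add2l.
have X0 : 0 <= (R * n%:R^-1) ^+ s.
  by rewrite exprn_ge0 // mulr_ge0 ?invr_ge0 // divr_ge0 ?mulr_ge0 // ltW.
have X1 : 0 <= C0 * n.+1%:R ^+ a by rewrite mulr_ge0 // exprn_ge0.
apply: le_trans (ler_wpM2l X1 h3) _.
apply: le_trans (ler_wpM2r X0 (ler_wpM2l C00 h4)) _.
rewrite exprMn [X in (R ^+ s * X)](_ : _ = n%:R^-1 ^+ a * (n%:R^-1 ^+ b * n%:R^-1)); last first.
  by rewrite /s -exprSr -exprD addnS.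
have en : n%:R ^+ a * n%:R^-1 ^+ a = 1 :> rat by rewrite -exprMn mulfV ?expr1n // gt_eqF.
have b0 : 0 <= n%:R^-1 ^+ b :> rat by rewrite exprn_ge0 // invr_ge0.
have := ler_wpM2r b0 small; rewrite mul1r; apply: le_trans.
rewrite le_eqVlt; apply/orP; left; apply/eqP; move: en.
move: (n%:R ^+ a : rat) (n%:R^-1 ^+ a : rat) => u v.
move: (n%:R^-1 ^+ b : rat) => x; move: (n%:R^-1 : rat) (2 ^+ a : rat) (R ^+ s) => y z r uv.
have -> : C0 * (z * u) * (r * (v * (x * y))) = C0 * z * r * y * x * (u * v) by ring.
by rewrite uv mulr1.
Qed.

(** * Constants *)

Section Bounds.
Variables (l : nat) (m : {set 'I_l} -> nat).
Local Notation sg := (sigma m).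
Hypothesis s0 : (0 < sg)%N.

(** The denominator of the main term; the remaining factors [m S ^ m S] are at least 1. The factor 2
    in [C0] comes from [s_star] being at least half the main term. *)
Definition scale := ((\prod_(S : {set 'I_l} | #|S| == 2) (m S)`!) * sg ^ sg)%N.

Definition C0 : rat := (2 * scale)%N%:R.

Lemma main_term_ge n : 2 ^+ n * n%:R ^+ sg <= scale%:R * main_term m n.
Proof.
have sp : 0 < sg%:R :> rat by rewrite ltr0n.
have E : sg%:R ^+ sg = \prod_(S : {set 'I_l} | #|S| == 2) sg%:R ^+ m S :> rat.
  by rewrite [in X in _ ^+ X = _]/sigma prodrXr.
have En : n%:R ^+ sg = \prod_(S : {set 'I_l} | #|S| == 2) n%:R ^+ m S :> rat.
  by rewrite [in X in _ ^+ X = _]/sigma prodrXr.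
rewrite main_termE mulrCA; apply: ler_wpM2l; first exact: exprn_ge0.
rewrite /scale natrM natrX natr_prod E En -!big_split /=; apply: ler_prod => S _.
rewrite exprn_ge0 //= /weight.
have f0 : ((m S)`!)%:R != 0 :> rat by rewrite pnatr_eq0 -lt0n fact_gt0.
have -> : (m S)`!%:R * sg%:R ^+ m S * ((m S)`!%:R^-1 * ((m S * n)%N%:R / sg%:R) ^+ m S)
   = (m S * n)%N%:R ^+ m S :> rat.
  by rewrite mulrACA mulfV // mul1r -exprMn mulrCA mulfV ?mulr1 // gt_eqF.
case: (m S) => [|k]; first by rewrite !expr0.
by rewrite lerXn2r ?nnegrE // ler_nat mulSn leq_addr.
Qed.

Lemma main_term_gt0 n : (0 < n)%N -> 0 < main_term m n.
Proof.
move=> n0; rewrite main_termE mulr_gt0 ?exprn_gt0 //.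
by apply: prodr_gt0 => S _; exact: weight_gt0.
Qed.

Lemma extremal_card_ge n (F : fam l n) : extremal m F -> (4 * sg ^ 2 <= n)%N ->
  2 ^+ n * n%:R ^+ sg <= C0 * (\prod_(k < l) #|F k|)%:R.
Proof.
rewrite /C0.
move=> [_ ->] ns.
have n0 : (0 < n)%N by apply: leq_trans ns; rewrite muln_gt0 expn_gt0 s0.
have ns2 : (2 * sg <= n)%N.
  apply: leq_trans ns; rewrite -mulnn; move: s0; clear; move=> *; nia.
apply: le_trans (main_term_ge n) _; rewrite mulnC natrM -mulrA; apply: ler_wpM2l => //.
have low := s_star_ge s0 ns2; have M0 := main_term_gt0 n0.
have h : 1/2 <= 1 - 2 * sg%:R ^+ 2 / n%:R :> rat.
  have : 2 * sg%:R ^+ 2 / n%:R <= 1/2 :> rat.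
    rewrite (ler_pdivrMr _ _ _) ?ltr0n //.
    have : 4 * sg%:R ^+ 2 <= n%:R :> rat by rewrite -natrX -natrM ler_nat.
    by move: (sg%:R ^+ 2 : rat) => S; lra.
  by move: (2 * _ / n%:R : rat) => X; lra.
have := le_trans (ler_wpM2r (ltW M0) h) low; lra.
Qed.

Lemma extremal_star_bound n (F : fam l n) (C : rat) : extremal m F -> (0 < n)%N ->
  2 ^+ n * n%:R ^+ sg <= C * (\prod_(k < l) #|F k|)%:R ->
  forall (Y : 'I_l -> {set 'I_n}) e, (e <= \sum_x 'C(#|cover_at Y x|, 2))%N ->
  \prod_(k < l) pr (F k) (fun B => Y k \subset B) <= 2 ^+ (l.+1 * sg) * C * n%:R^-1 ^+ e.
Proof.
move=> ext n0 low Y e Ye.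
have P0 : 0 < (\prod_(k < l) #|F k|)%:R :> rat.
  by rewrite ltr0n prodn_gt0 // => k; exact: (ext_card_gt0 ext).
rewrite /pr prodf_div -!natr_prod (ler_pdivrMr _ _ P0).
have N0 : 0 < n%:R ^+ e :> rat by rewrite exprn_gt0 // ltr0n.
rewrite exprVn mulrAC (ler_pdivlMr _ _ N0).
have := prod_star_le (ext.1) n0 Ye; rewrite -(ler_nat rat) natrM => H.
rewrite -[n%:R ^+ e]natrX; apply: le_trans H _.
rewrite natrM expnMn natrM mulrA !natrX -exprM mulrC.
by rewrite -mulrA; apply: ler_wpM2l; rewrite ?exprn_ge0.
Qed.

Lemma leq_expl a b e : (a <= b)%N -> (a ^ e <= b ^ e)%N.
Proof. by case: e => // e; rewrite leq_exp2r. Qed.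

(** One factor [n] of the trivial bound is replaced by [a r]. As the count of an extremal tuple has
    the full order in [n], every zone with [j r > 0] must be linearly large. *)
Lemma prod_bin_zone_le n (a j : 'I_l * 'I_l -> nat) r : (\sum_q a q <= n)%N -> (0 < j r)%N ->
  (n * \prod_q 'C(a q, j q) <= a r * n ^ (\sum_q j q))%N.
Proof.
move=> an jr; have al q : (a q <= n)%N.
  by apply: leq_trans an; rewrite (bigD1 q) //= leq_addr.
have bl q : ('C(a q, j q) <= a q ^ j q)%N.
  rewrite -(ler_nat rat); apply: le_trans (bin_le_expn _ _) _.
  rewrite natrX ler_piMl ?exprn_ge0 // invf_le1 ?ltr0n ?fact_gt0 //.
  by rewrite ler1n fact_gt0.
rewrite expn_sum (bigD1 r) //= [in X in (_ <= X)%N](bigD1 r) //= !mulnA; apply: leq_mul; last first.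
  apply: leq_prod => q _; apply: leq_trans (bl q) _; exact: leq_expl.
case: (j r) jr (bl r) => // k _ H; apply: leq_trans (_ : n * (a r * n ^ k) <= _)%N.
  rewrite leq_mul2l; apply/orP; right; apply: leq_trans H _.
  by rewrite expnS leq_mul2l; apply/orP; right; exact: leq_expl.
by rewrite mulnCA -expnS.
Qed.

End Bounds.

Section Large.
Variables (l : nat) (m : {set 'I_l} -> nat).
Local Notation sg := (sigma m).

Local Notation C0 := (C0 m).
(* [C0] bounds 2^n n^sigma / prod |F_k| and [C1] the star inequality; [C2 / n]
   bounds p_k(x) off the hot index, [C3 / n] the proportion of sets with an
   atypical trace on a hot set, [C4 / n^2] p_k(x) off the hot and warm indices,
   [c1 / n] the warm p_k(x) from below; [C5 / n] is the relative error of the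
   counting bound, [C6 / n] that of the exchange, [n / gg] a lower bound for the
   nonempty zones and [K8 / n] the relative error of their sizes. *)
Definition C1 : rat := 2 ^+ (l.+1 * sg) * C0.
Definition C2 : rat := 2 * l%:R ^+ 2 * C1.
Definition C3 : rat := l%:R ^+ 2 * (2 ^+ sg * (2 * C2)) + C0 * l.+1%:R ^+ sg.
Definition C4 : rat := 128 * l%:R * C1.
Definition C5 : rat := l%:R ^+ 2 * C3 + l%:R * C4.
Definition c1 : rat := (32 * l%:R)^-1.
Definition C6 : rat := 12 * C4 * sg%:R + 1 + 8 * C4 +
  C1 * 2 ^+ (sg + 2) ^+ l / c1 * (2 ^ (sg + 2) * 3 ^ sg.+1)%:R * (2 ^ sg)%:R.
Definition gg : nat := (2 * (2 * scale m))%N.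
Definition C9 : rat := sg%:R * gg%:R.
Definition K8 : rat := l%:R * C4 + 2 * (C9 + l%:R * C4) ^+ 2 + 4 +
  (C9 ^+ 2 + C4 * C9 + (2 * C2 + 2 * C9) * C9).
(** The summands meet separate demands: [4 * C3] for [many_addable], [16 * sg * C2] so that a set
    [V] is rarely met in [zone_empty], [8 * sg ^ 2 * gg] so that zones dominate such a [V], and
    [2 * gg] so that a zone minus a small set is still linearly large. *)
Definition dd : nat := (Num.bound (4 * C3) + Num.bound (16 * sg%:R * C2) + 8 * sg ^ 2 * gg + 2 * gg).+1.
Definition qq n : nat := (n %/ dd).+1.

Record large (n : nat) : Prop := Large {
  large_sigma : (4 * sg ^ 2 <= n)%N;
  large_two : (2 ^ (sg + 3) <= n)%N;
  large_eps : n%:R^-1 <= 1/10 :> rat;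
  large_delta : 2 ^+ sg.+1 * (2 * C2) * n%:R^-1 <= 1/2;
  large_C2 : 16 * sg%:R * C2 * n%:R^-1 <= 1;
  large_C2' : C2 * n%:R^-1 <= 1/8;
  large_C3 : C3 * n%:R^-1 <= 1/8;
  large_C4 : C4 * n%:R^-1 <= 1/2;
  large_lC4 : l%:R * C4 * n%:R^-1 <= 1/4;
  large_C5 : C5 * n%:R^-1 <= 1/2;
  large_lC6 : l%:R * C6 * n%:R^-1 <= 1/4;
  large_gap : (C5 + 2 * sg%:R ^+ 2) * n%:R^-1 <= (sg ^ sg)%N%:R^-1 / 2;
  large_C9 : (2 * C2 + 2 * C9) * n%:R^-1 <= 1;
  large_C9' : (C9 + l%:R * C4) * n%:R^-1 <= 1/2;
  large_c1 : (64 * l <= n)%N;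
  large_zone : (8 * sg * gg * (1 + sg) < n)%N;
  large_expo : forall q w, (w <= sg)%N -> (n <= dd * q)%N ->
    C0 * n.+1%:R ^+ (sg * l.+1) * (1 - 2 ^- w) ^+ q <= (n%:R^-1) ^+ (sg + 4)
}.

Hypothesis s0 : (0 < sg)%N.
Hypothesis l0 : (0 < l)%N.

Lemma C0_ge0 : 0 <= C0. Proof. exact: ler0n. Qed.
Lemma C1_ge0 : 0 <= C1. Proof. by rewrite mulr_ge0 ?exprn_ge0 // C0_ge0. Qed.
Lemma C2_ge0 : 0 <= C2. Proof. by rewrite mulr_ge0 ?C1_ge0 // mulr_ge0 ?exprn_ge0. Qed.
Lemma C3_ge0 : 0 <= C3.
Proof.
apply: addr_ge0; last by apply: mulr_ge0; [exact: C0_ge0 | exact: exprn_ge0].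
apply: mulr_ge0; first exact: exprn_ge0.
by apply: mulr_ge0; [exact: exprn_ge0 | apply: mulr_ge0 => //; exact: C2_ge0].
Qed.
Lemma C4_ge0 : 0 <= C4.
Proof. by apply: mulr_ge0; [apply: mulr_ge0; exact: ler0n | exact: C1_ge0]. Qed.
Lemma c1_gt0 : 0 < c1.
Proof. by rewrite invr_gt0; apply: mulr_gt0; rewrite ltr0n. Qed.

Lemma eventually_large : eventually_nat large.
Proof.
have p1 : 0 < 1/10 :> rat by rewrite divr_gt0 // ltr0n.
have p2 : 0 < 1/2 :> rat by [].
have p4 : 0 < 1/4 :> rat by [].
have p8 : 0 < 1/8 :> rat by [].
have pg : 0 < (sg ^ sg)%N%:R^-1 / 2 :> rat.
  by apply: divr_gt0; [rewrite invr_gt0 ltr0n expn_gt0 s0 | exact: ltr0n].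
have [N0 H0] := ev_expo (sg * l.+1) (sg + 4) sg C0_ge0 (ltn0Sn _ : (0 < dd)%N).
have [N1 H1] := ev_small 1 p1.
have [N2 H2] := ev_small (2 ^+ sg.+1 * (2 * C2)) p2.
have [N3 H3] := ev_small (16 * sg%:R * C2) (ltr01 : 0 < 1 :> rat).
have [N4 H4] := ev_small C2 p8.
have [N5 H5] := ev_small C3 p8.
have [N6 H6] := ev_small C4 p2.
have [N7 H7] := ev_small (l%:R * C4) p4.
have [N8 H8] := ev_small C5 p2.
have [N9 H9] := ev_small (l%:R * C6) p4.
have [N10 H10] := ev_small (C5 + 2 * sg%:R ^+ 2) pg.
have [N11 H11] := ev_small (2 * C2 + 2 * C9) (ltr01 : 0 < 1 :> rat).
have [N12 H12] := ev_small (C9 + l%:R * C4) p2.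
exists (\max_(i <- [:: N0; N1; N2; N3; N4; N5; N6; N7; N8; N9; N10; N11; N12;
  4 * sg ^ 2; 2 ^ (sg + 3); 64 * l; (8 * sg * gg * (1 + sg)).+1]) i)%N => n.
rewrite !big_cons big_nil !geq_max.
case/and5P=> h0 h1 h2 h3 /and5P[h4 h5 h6 h7 /and5P[h8 h9 h10 h11 /and5P[h12 hs h2s hl /andP[hz _]]]].
split; [exact: hs | exact: h2s | | exact: H2 | exact: H3 | exact: H4 | exact: H5 | exact: H6
  | exact: H7 | exact: H8 | exact: H9 | exact: H10 | exact: H11 | exact: H12 | exact: hl | exact: hz
  | exact: H0].
by rewrite -[X in X <= _]mul1r; exact: H1.
Qed.
End Large.

Section LargeFacts.
Variables (l : nat) (m : {set 'I_l} -> nat) (n : nat).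
Local Notation sg := (sigma m).
Local Notation eps := (n%:R^-1 : rat).
Hypothesis s0 : (0 < sg)%N.
Hypothesis l0 : (0 < l)%N.
Hypothesis lg : large m n.

Lemma large_gt0 : (0 < n)%N.
Proof. by apply: leq_trans (large_two lg); rewrite expn_gt0. Qed.
Local Notation n0 := large_gt0.

Let e0 : 0 < eps. Proof. by rewrite invr_gt0 ltr0n n0. Qed.
Let en : n%:R * eps = 1. Proof. by rewrite mulfV // pnatr_eq0 -lt0n n0. Qed.

Lemma large_ge k : (k <= 2 ^ (sg + 3))%N -> (k <= n)%N.
Proof. by move=> h; exact: leq_trans h (large_two lg). Qed.

Lemma large_ge2 : (2 <= n)%N.
Proof. by apply: large_ge; rewrite addnC expnS leq_pmulr // expn_gt0. Qed.

Lemma large_tiny : n.+1%:R ^+ sg * eps ^+ (sg + 4) <= eps ^+ 3.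
Proof.
have h : n.+1%:R <= 2 * n%:R :> rat.
  rewrite -natrM ler_nat; have := n0; clear; lia.
have h1 : n.+1%:R ^+ sg * eps ^+ sg <= 2 ^+ sg.
  rewrite -exprMn lerXn2r ?nnegrE ?mulr_ge0 ?(ltW e0) //.
  by have := ler_wpM2r (ltW e0) h; rewrite -mulrA en mulr1.
have h2 : 2 ^+ sg * eps <= 1.
  rewrite -[X in _ <= X]en; apply: ler_wpM2r; first exact: ltW.
  rewrite -natrX ler_nat; by apply: large_ge; rewrite leq_exp2l // leq_addr.
have e3 : 0 <= eps ^+ 3 by rewrite exprn_ge0 // ltW.
have -> : n.+1%:R ^+ sg * eps ^+ (sg + 4) = n.+1%:R ^+ sg * eps ^+ sg * eps * eps ^+ 3.
  by rewrite exprD [eps ^+ 4]exprS !mulrA.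
rewrite -[X in _ <= X]mul1r; apply: ler_wpM2r => //; apply: le_trans h2.
by apply: ler_wpM2r => //; exact: ltW.
Qed.

Lemma large_tiny_ge0 : 0 <= n.+1%:R ^+ sg * eps ^+ (sg + 4).
Proof. by apply: mulr_ge0; apply: exprn_ge0; [exact: ler0n | exact: ltW]. Qed.

Lemma large_tiny_sq : n.+1%:R ^+ sg * eps ^+ (sg + 4) <= eps ^+ 2.
Proof.
apply: le_trans large_tiny _; rewrite exprS ler_piMl ?exprn_ge0 ?(ltW e0) //.
by rewrite invf_le1 ?ltr0n ?ler1n n0.
Qed.

Lemma large_tiny_half : n.+1%:R ^+ sg * eps ^+ (sg + 4) <= 1/2.
Proof.
apply: le_trans large_tiny_sq _; have e1 := large_eps lg.
have e0' := ltW e0; rewrite expr2; move: e0' e1; move: eps => e e0' e1.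
have := ler_pM e0' e0' e1 e1; lra.
Qed.

Lemma dd_C3 : 4 * C3 m <= (dd m)%:R.
Proof.
have h : 0 <= 4 * C3 m by rewrite mulr_ge0 ?C3_ge0.
apply: le_trans (ltW (archi_boundP h)) _; rewrite ler_nat /dd; clear; lia.
Qed.

Lemma dd_C2 : 16 * sg%:R * C2 m <= (dd m)%:R.
Proof.
have h : 0 <= 16 * sg%:R * C2 m by apply: mulr_ge0; [apply: mulr_ge0; exact: ler0n | exact: C2_ge0].
apply: le_trans (ltW (archi_boundP h)) _; rewrite ler_nat /dd; clear; lia.
Qed.

Lemma qq_ge : (n <= dd m * qq m n)%N.
Proof. by rewrite /qq mulnC ltnW // ltn_ceil. Qed.

Lemma qq_le : (dd m * (qq m n).-1 <= n)%N.
Proof. by rewrite /qq /= mulnC leq_divM. Qed.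

Lemma large_qq : (sg * qq m n)%:R * (C2 m * eps) <= 1/8.
Proof.
have h1 := large_C2 lg; have h2 := dd_C2; have h3 := qq_le.
have [k kE] : exists k, qq m n = k.+1 by exists (n %/ dd m)%N.
rewrite kE /= in h3 *; rewrite -(ler_nat rat) natrM in h3.
have k0 : 0 <= k%:R :> rat by [].
have h4 := le_trans (ler_wpM2r k0 h2) h3.
have h5 := ler_wpM2r (ltW e0) h4; rewrite en in h5.
rewrite natrM -natr1.
move: h5 h1; move: (sg%:R : rat) (C2 m) (k%:R : rat) eps => S C k' e h5 h1.
have : 16 * (S * (k' + 1) * (C * e)) = 16 * S * C * k' * e + 16 * S * C * e by ring.
move: (S * (k' + 1) * (C * e)) h5 h1 => X; lra.
Qed.

Lemma large_zones a : (n <= gg m * a)%N -> (4 * sg * (1 + sg * qq m n) < a)%N.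
Proof.
move=> na; have h1 := large_zone lg; have h3 := qq_le.
have [k kE] : exists k, qq m n = k.+1 by exists (n %/ dd m)%N.
rewrite kE /= in h3 *.
have h2 : (8 * sg ^ 2 * gg m * k <= n)%N.
  apply: leq_trans h3; rewrite leq_mul2r; apply/orP; right; rewrite /dd; clear; lia.
rewrite ltnNge; apply/negP => H.
have := leq_trans na (leq_mul (leqnn (gg m)) H).
rewrite leqNgt => /negP; apply.
move: h1 h2; rewrite -mulnn; clear; move: (gg m) (sigma m) => g s; nia.
Qed.

Lemma large_poly : (2 * n.+2 ^ sg.+1 <= n ^ (sg + 2))%N.
Proof.
have h : (n.+2 <= 2 * n)%N by have := large_ge2; clear; lia.
apply: leq_trans (_ : 2 * (2 * n) ^ sg.+1 <= _)%N.
  by rewrite leq_mul2l; apply/orP; right; exact: leq_expl.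
rewrite expnMn mulnA -expnS addnS addn1 [X in (_ <= X)%N]expnS leq_mul2r; apply/orP; right.
by apply: large_ge; rewrite leq_exp2l // addnC.
Qed.

Lemma large_tiny2 : eps ^+ (sg + 4) < c1 l * eps.
Proof.
have e1 : eps <= 1 by rewrite invf_le1 ?ltr0n ?n0 // ler1n n0.
have le2 : eps ^+ (sg + 4) <= eps * eps.
  rewrite -expr2; apply: ler_wiXn2l => //; first exact: ltW.
  by rewrite addnC.
have l32 : 0 < (32 * l)%N%:R :> rat by rewrite ltr0n muln_gt0.
have np : 0 < n%:R :> rat by rewrite ltr0n n0.
apply: le_lt_trans le2 _; rewrite (ltr_pM2r e0) /c1 -natrM (ltf_pV2 np l32) ltr_nat.
by apply: leq_trans (large_c1 lg); move: l0; clear; lia.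
Qed.

End LargeFacts.

(** * Structure of extremal tuples *)

Lemma D3_arith (A B c D e : rat) : A * (B * (c * e)) + D * e = (A * (B * c) + D) * e.
Proof. ring. Qed.

Lemma eighth_lt (x : rat) : x <= 1/8 -> 3 * x < 1. Proof. lra. Qed.

Lemma eighth_le (x : rat) : x <= 1/8 -> x <= 1/4. Proof. lra. Qed.

Lemma half_le_1sub (x : rat) : x <= 1/2 -> 1/2 <= 1 - x. Proof. lra. Qed.

Lemma zone_ge_arith (t N c P X A k : rat) : 0 <= k -> 0 <= t -> 0 <= c ->
  t * N <= c * P -> 1/2 * P <= t * X -> k * X <= A * N -> k * (t * N) <= 2 * c * A * (t * N).
Proof.
move=> k0 t0 c0 h1 h2 h3.
have h4 := ler_wpM2l k0 h1; have h5 := ler_wpM2l k0 (ler_wpM2l c0 h2).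
have h6 := ler_wpM2l c0 (ler_wpM2l t0 h3).
have e3 : k * (c * (1/2 * P)) = 1/2 * (k * (c * P)) by ring.
have e4 : k * (c * (t * X)) = c * (t * (k * X)) by ring.
have e5 : 2 * c * A * (t * N) = 2 * (c * (t * (A * N))) by ring.
rewrite e5; rewrite e3 e4 in h5; lra.
Qed.

Lemma gap_arith (x y g : rat) : 0 <= x -> 0 <= y -> 0 < g -> x + y <= g / 2 ->
  (1 - x) * (1 - y) <= 1 - g -> False.
Proof.
move=> x0 y0 g0 h; have := mulr_ge0 x0 y0.
have -> : (1 - x) * (1 - y) = 1 - x - y + x * y by ring.
by move: (x * y) => z; lra.
Qed.

Lemma card_bound_arith (x y M P : rat) : 0 <= x -> x <= 1/2 -> 0 <= y -> 0 < M ->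
  (1 - x) * P <= M -> (1 - y) * M <= P -> `|P - M| <= (2 * x + y) * M.
Proof.
move=> x1 x2 y1 M0 up low.
have MP : P <= (1 + 2 * x) * M.
  have h : 0 < 1 - x by lra.
  rewrite -(ler_pM2l h); apply: le_trans up _; rewrite mulrA; apply: ler_peMl; first exact: ltW.
  have : 0 <= x * (1/2 - x) by apply: mulr_ge0; lra.
  have -> : (1 - x) * (1 + 2 * x) = 1 + 2 * (x * (1/2 - x)) by field.
  lra.
have yM : 0 <= y * M by rewrite mulr_ge0 // ltW.
have xM : 0 <= x * M by rewrite mulr_ge0 // ltW.
by rewrite ler_norml; apply/andP; split; lra.
Qed.

Section Structure.
Variables (l : nat) (m : {set 'I_l} -> nat) (n : nat) (F : fam l n).
Local Notation sg := (sigma m).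
Local Notation eps := (n%:R^-1 : rat).
Hypothesis s0 : (0 < sg)%N.
Hypothesis l0 : (0 < l)%N.
Hypothesis lg : large m n.
Hypothesis ext : extremal m F.
Local Notation n0 := (large_gt0 lg).
Local Notation PF := ((\prod_(k < l) #|F k|)%:R : rat).

Let e0 : 0 < eps. Proof. by rewrite invr_gt0 ltr0n n0. Qed.
Let en : n%:R * eps = 1. Proof. by rewrite mulfV // pnatr_eq0 -lt0n n0. Qed.

Let card_low : 2 ^+ n * n%:R ^+ sg <= C0 m * (\prod_(k < l) #|F k|)%:R.
Proof. move: (extremal_card_ge s0 ext (large_sigma lg)) => H. exact H. Qed.

Let star_bound (Y : 'I_l -> {set 'I_n}) e : (e <= \sum_x 'C(#|cover_at Y x|, 2))%N ->
  \prod_(k < l) pr (F k) (fun B => Y k \subset B) <= C1 m * eps ^+ e.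
Proof. rewrite /C1; exact: extremal_star_bound ext n0 card_low Y e. Qed.

Let expo q w : (0 < w)%N -> (w <= sg)%N -> (n <= dd m * q)%N ->
  C0 m * n.+1%:R ^+ (sg * l.+1) * (1 - 2 ^- w) ^+ q <= eps ^+ (sg + 4).
Proof. by move=> _; exact: large_expo. Qed.

Let delta_small : 2 ^+ sg.+1 * (2 * C2 m / n%:R) <= 1/2.
Proof. by rewrite mulrA; exact: large_delta. Qed.

Let P_gt0 : 0 < PF.
Proof. by rewrite ltr0n prodn_gt0 // => k; exact: (ext_card_gt0 ext). Qed.

Let C5e_ge0 : 0 <= C5 m * eps.
Proof.
apply: mulr_ge0; last exact: (ltW e0).
apply: addr_ge0; apply: mulr_ge0; [exact: exprn_ge0 | exact: C3_ge0 | exact: ler0n | exact: C4_ge0].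
Qed.

Let sg2_ge0 : 0 <= 2 * sg%:R ^+ 2 * eps.
Proof. by apply: mulr_ge0; [rewrite mulr_ge0 // exprn_ge0 | exact: (ltW e0)]. Qed.

Lemma zone_size_ge (a j : 'I_l * 'I_l -> nat) r : (\sum_q a q <= n)%N -> (\sum_q j q = sg)%N ->
  (1 - C5 m * eps) * PF <= 2 ^+ n * (\prod_q 'C(a q, j q))%:R ->
  (0 < j r)%N -> (n <= gg m * a r)%N.
Proof.
move=> an js count jr; have := prod_bin_zone_le an jr; rewrite js.
rewrite -(ler_nat rat) 2!natrM natrX => bin_le.
have N0 : 0 < 2 ^+ n * n%:R ^+ sg :> rat by rewrite mulr_gt0 ?exprn_gt0 // ltr0n n0.
have h1 : 1/2 * PF <= 2 ^+ n * (\prod_q 'C(a q, j q))%:R.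
  by apply: le_trans count; apply: ler_wpM2r; [exact: (ltW P_gt0) | exact: half_le_1sub (large_C5 lg)].
rewrite -(ler_nat rat) natrM -(ler_pM2r N0) /gg natrM -/(C0 m).
exact: zone_ge_arith (ler0n _ _) (exprn_ge0 _ (ler0n _ _)) (C0_ge0 m) card_low h1 bin_le.
Qed.

Lemma type_oriented (j : 'I_l * 'I_l -> nat) (a : 'I_l * 'I_l -> nat) :
  (forall k, j (k, k) = 0%N) ->
  (forall k k', k != k' -> (j (k, k') + j (k', k) = m [set k; k'])%N) ->
  (\sum_q a q <= n)%N ->
  (1 - C5 m * eps) * PF <= 2 ^+ n * (\prod_q 'C(a q, j q))%:R ->
  forall k k', k != k' -> j (k, k') = 0%N \/ j (k', k) = 0%N.
Proof.
move=> j_diag j_sum an count k k' kk'.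
have [|j1] := posnP (j (k, k')); first by left.
have [|j2] := posnP (j (k', k)); first by right.
have gap := prod_weight_gap n s0 j_diag j_sum kk' j1 j2.
have bin := prod_bin_le s0 j_diag j_sum an.
have two : 0 <= 2 ^+ n :> rat by rewrite exprn_ge0.
have M0 := main_term_gt0 s0 n0.
have up := le_trans count (ler_wpM2l two (le_trans bin gap)).
have ns2 : (2 * sg <= n)%N.
  apply: leq_trans (large_sigma lg); rewrite -mulnn; move: s0; clear; move=> *; nia.
have low := s_star_ge s0 ns2; rewrite -ext.2 in low.
have c5 := large_C5 lg; have gapn := large_gap lg.
rewrite mulrCA -main_termE in up.
have x0 : 0 <= 1 - C5 m * eps by apply: le_trans (half_le_1sub c5); rewrite divr_ge0 // ler0n.
have := le_trans (ler_wpM2l x0 low) up; rewrite mulrA (ler_pM2r M0) => H.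
have g0 : 0 < (sg ^ sg)%N%:R^-1 :> rat by rewrite invr_gt0 ltr0n expn_gt0 s0.
rewrite mulrDl in gapn.
by case: (gap_arith C5e_ge0 sg2_ge0 g0 gapn H).
Qed.

Lemma extremal_structure : exists (warm kappa : 'I_n -> 'I_l) (j : 'I_l * 'I_l -> nat),
  [/\ (forall k, j (k, k) = 0%N) /\
      (forall k k', k != k' -> (j (k, k') + j (k', k) = m [set k; k'])%N),
      (1 - C5 m * eps) * PF <= 2 ^+ n * (\prod_q 'C(#|zone warm kappa q|, j q))%:R,
      (forall k k', k != k' -> j (k, k') = 0%N \/ j (k', k) = 0%N) /\
      (forall k k', j (k, k') = 0%N -> zone warm kappa (k, k') = set0),
      (forall k, zfam m warm kappa k \subset F k) &
      forall r, (0 < j r)%N ->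
        `|#|zone warm kappa r|%:R - (j r * n)%N%:R / sg%:R| <= K8 m * eps * ((j r * n)%N%:R / sg%:R)].
Proof.
have C00 := C0_ge0 m; have C10 := C1_ge0 m; have C20 := C2_ge0 m; have C30 := C3_ge0 m.
have C40 := C4_ge0 m; have c10 := c1_gt0 l0.
have c3 := large_C3 lg; have c2 := large_C2' lg.
have [kappa hot_both] := exists_hot ext l0 C10 star_bound.
have hot_ge x : 1/2 - C2 m / n%:R <= p F (kappa x) x by rewrite /C2; exact: (hot_both x).1.
have hot_le x k : k != kappa x -> p F k x <= C2 m / n%:R by rewrite /C2; exact: (hot_both x).2.
have D3E : l%:R ^+ 2 * (2 ^+ sg * (2 * C2 m / n%:R)) + C0 m * l.+1%:R ^+ sg / n%:R = C3 m * eps.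
  rewrite /C3; exact: D3_arith.
have D3_small : 3 * (l%:R ^+ 2 * (2 ^+ sg * (2 * C2 m / n%:R)) + C0 m * l.+1%:R ^+ sg / n%:R) < 1.
  by rewrite D3E; exact: eighth_lt c3.
have [j [j_diag j_sum j_pr]] :=
  exists_type ext n0 C20 hot_ge card_low delta_small D3_small s0.
rewrite D3E in j_pr.
have c3' : C3 m * eps <= 1/4 := eighth_le c3.
have c2' : C2 m * eps <= 1/4 := eighth_le c2.
have tiny3 := large_tiny lg.
have [warm warm_all] := exists_col ext n0 C00 C20 hot_ge card_low delta_small expo
  tiny3 (large_eps lg) s0 j_sum j_pr c3' (dd_C3 m) (ltn0Sn _) star_bound c2'.
have warm_hot x : warm x != kappa x by case: (warm_all x).
have warm_ge x : c1 l / n%:R <= p F (warm x) x.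
  by case: (warm_all x) => _; rewrite /c1 mulrC.
have p_off k x : off warm kappa k x -> p F k x <= C4 m * eps ^+ 2.
  by case/andP => kw kk; rewrite /C4; case: (warm_all x) => _ _; apply.
have count : (1 - C5 m * eps) * PF <= 2 ^+ n * (\prod_q 'C(#|zone warm kappa q|, j q))%:R.
  have := prod_card_zone_le ext n0 C30 warm_hot p_off C40 j_diag j_pr.
  rewrite -/(C5 m) => H; exact H.
have zn : (\sum_q #|zone warm kappa q| <= n)%N by rewrite sum_zone.
have j_orient := type_oriented j_diag j_sum zn count.
have qn := qq_ge m n.
have zone_e := zone_empty ext n0 C00 C20 hot_ge hot_le card_low delta_small expo qn j_sum j_pr
  warm_hot warm_ge c10 (large_qq lg) c2 c3 (large_tiny2 l0 lg).
have zone_ge r : (0 < j r)%N -> (n <= gg m * #|zone warm kappa r|)%N.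
  exact: zone_size_ge zn (sum_type j_diag j_sum) count.
have zone_big r : (0 < j r)%N -> (4 * sg * (1 + sg * qq m n) < #|zone warm kappa r|)%N.
  move=> jr; have H := large_zones lg (zone_ge r jr); exact H.
have tiny_or := p_tiny_or ext n0 C00 C20 hot_ge card_low delta_small expo qn.
have p_hot := p_hot_gt0 hot_ge c2.
have lC4 : l%:R * (C4 m * eps) <= 1/4 by rewrite mulrA; exact: large_lC4.
have lC6 : l%:R * (C6 m * eps) <= 1/4 by rewrite mulrA; exact: large_lC6.
have zsub k : zfam m warm kappa k \subset F k.
  have := zfam_sub ext n0 C10 C20 C40 c10 hot_ge delta_small p_off j_sum j_orient zone_e
    warm_hot warm_ge p_hot star_bound tiny_or zone_big (large_C4 lg) (large_poly lg)
    k (large_ge2 lg) lC4 lC6.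
  by move=> H; exact H.
have zone_ge2 r : (0 < j r)%N -> (2 * sg <= #|zone warm kappa r|)%N.
  move=> jr; apply: leq_trans (ltnW (zone_big r jr)); clear; nia.
have dgg : (2 * gg m <= dd m)%N by rewrite /dd; clear; lia.
have size := zone_size ext n0 C00 C20 C40 hot_ge card_low delta_small p_off j_diag j_sum j_orient zone_e
  warm_hot (large_C4 lg) expo erefl (large_tiny_ge0 lg) (large_tiny_sq lg) (large_tiny_half lg)
  zone_ge zone_ge2 dgg zsub s0 (large_C9 lg) (large_C9' lg).
exists warm, kappa, j.
split; [exact (conj j_diag j_sum) | exact count | exact (conj j_orient zone_e) | exact zsub | exact size].
Qed.

Lemma extremal_card_bound : `|PF - main_term m n| <= (2 * C5 m + 2 * sg%:R ^+ 2) * eps * main_term m n.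
Proof.
have [warm [kappa [j [[j_diag j_sum] count _ _ _]]]] := extremal_structure.
have zn : (\sum_q #|zone warm kappa q| <= n)%N by rewrite sum_zone.
have bin := prod_bin_le s0 j_diag j_sum zn.
have two : 0 <= 2 ^+ n :> rat by rewrite exprn_ge0.
have M0 := main_term_gt0 s0 n0.
have := le_trans count (ler_wpM2l two (le_trans bin (prod_weight_le n j_diag j_sum))).
rewrite -main_termE => up.
have ns2 : (2 * sg <= n)%N.
  apply: leq_trans (large_sigma lg); rewrite -mulnn; move: s0; clear; move=> *; nia.
have low := s_star_ge s0 ns2; rewrite -ext.2 in low.
have c5 := large_C5 lg.
rewrite mulrDl -mulrA; exact: card_bound_arith C5e_ge0 c5 sg2_ge0 M0 up low.
Qed.

End Structure.

Lemma extremal_exists l (m : {set 'I_l} -> nat) n : exists F : fam l n, extremal m F.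
Proof.
have ov0 : overlapping m ([ffun=> set0] : fam l n).
  by apply/overlapP => k k' _ A B; rewrite ffunE in_set0.
have c0 : (0 < #|[pred F : fam l n | overlapping m F]|)%N by apply/card_gt0P; exists [ffun=> set0].
have [F ovF E] := eq_bigmax_cond (fun F : fam l n => (\prod_(k < l) #|F k|)%N) c0.
by exists F; split; [exact: ovF | rewrite -E].
Qed.

Lemma zfam_union l n (m : {set 'I_l} -> nat) (warm kappa : 'I_n -> 'I_l) (j : 'I_l * 'I_l -> nat)
    k (X : {set 'I_n}) (D : 'I_l -> {set 'I_n}) :
  (forall k', j (k, k') = 0%N -> zone warm kappa (k, k') = set0) ->
  (forall x, warm x != kappa x) ->
  X \subset \bigcup_(k' | (0 < j (k', k))%N) zone warm kappa (k', k) ->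
  (forall k', (0 < j (k, k'))%N -> D k' \subset zone warm kappa (k, k') /\ (#|D k'| <= m [set k; k'])%N) ->
  X :|: \bigcup_(k' | (0 < j (k, k'))%N) D k' \in zfam m warm kappa k.
Proof.
move=> zone_e warm_hot XA DA.
have XE x : x \in X -> kappa x = k.
  by move/(subsetP XA)/bigcupP => [k' _]; rewrite inE => /eqP[_ ->].
have DE k' x : (0 < j (k, k'))%N -> x \in D k' -> warm x = k /\ kappa x = k'.
  by move=> jk /(subsetP (DA _ jk).1); rewrite inE => /eqP[-> ->].
apply/zfamP; split=> [x|k'].
  rewrite /off negb_and !negbK in_setU => /orP[/XE -> |/bigcupP[k' jk /(DE _ _ jk)[-> _]]].
    by rewrite eqxx orbT.
  by rewrite eqxx.
have [j0|j1] := posnP (j (k, k')); first by rewrite zone_e // setI0 cards0.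
apply: leq_trans (DA _ j1).2; apply: subset_leq_card; apply/subsetP => x.
rewrite in_setI in_setU inE => /andP[/orP[/XE xk | /bigcupP[k'' jk xD]] /eqP[wx hx]].
  by have := warm_hot x; rewrite wx xk eqxx.
by have [_ hx'] := DE _ _ jk xD; rewrite -hx hx'.
Qed.

Local Close Scope ring_scope.

Theorem mainTheorem1 (l : nat) (m : {set 'I_l} -> nat) :
  (2 <= l)%N -> (0 < sigma m)%N ->
  (exists (C : rat) (N : nat), (0 < C)%R /\
     forall n : nat, (N <= n)%N ->
       (`|(s_star n m)%:R - main_term m n| <= C / n%:R * main_term m n)%R)
  /\
  (exists (C : rat) (N : nat), (0 < C)%R /\
     forall n : nat, (N <= n)%N ->
     forall F : {ffun 'I_l -> {set {set 'I_n}}}, extremal m F ->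
     exists (E : rel 'I_l) (A : 'I_l -> 'I_l -> {set 'I_n}),
       (* T = ([l], E) is an oriented graph: no loops *)
       (forall k, ~~ E k k) /\
       (* (1) *)
       (forall k1 k2 : 'I_l, k1 != k2 ->
          ((E k1 k2 || E k2 k1) = (0 < m [set k1; k2])%N) /\ ~~ (E k1 k2 && E k2 k1)) /\
       (* (2) partition of [n] *)
       (forall x : 'I_n, exists k k', E k k' /\ x \in A k k') /\
       (forall k1 k1' k2 k2', E k1 k1' -> E k2 k2' -> (k1, k1') != (k2, k2') ->
          A k1 k1' :&: A k2 k2' = set0) /\
       (forall k k', E k k' ->
          (`| (#|A k k'|)%:R - ((m [set k; k'] * n)%N)%:R / (sigma m)%:R |
             <= C / n%:R * (((m [set k; k'] * n)%N)%:R / (sigma m)%:R) :> rat)%R) /\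
       (* (3) *)
       (forall k : 'I_l, forall (X : {set 'I_n}) (D : 'I_l -> {set 'I_n}),
          X \subset \bigcup_(k' | E k' k) A k' k ->
          (forall k', E k k' -> D k' \subset A k k' /\ (#|D k'| <= m [set k; k'])%N) ->
          X :|: \bigcup_(k' | E k k') D k' \in F k)).
Proof.
move=> l2 s0; have l0 : 0 < l by exact: ltnW.
have [N largeN] := eventually_large s0.
have C_pos (C : rat) : (0 < `|C| + 1)%R by rewrite ltr_wpDl.
have C_le (C : rat) : (C <= `|C| + 1)%R.
  by apply: le_trans (ler_norm C) _; rewrite lerDl.
split.
  exists (`|2 * C5 m + 2 * (sigma m)%:R ^+ 2| + 1)%R, N; split=> // n /largeN lg.
  have [F extF] := extremal_exists m n.
  have := extremal_card_bound s0 l0 lg extF; rewrite extF.2 => H.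
  apply: le_trans H _; apply: ler_wpM2r; first exact: ltW (main_term_gt0 s0 (large_gt0 lg)).
  by apply: ler_wpM2r; [rewrite invr_ge0 ler0n | exact: C_le].
exists (`|K8 m| + 1)%R, N; split=> // n /largeN lg F extF.
have [warm [kappa [j [[j_diag j_sum] _ [j_orient zone_e] zsub size]]]] := extremal_structure s0 l0 lg extF.
have warm_hot x : warm x != kappa x.
  apply/eqP => wk; have := zone_e _ _ (j_diag (kappa x)).
  by move/setP/(_ x); rewrite inE wk eqxx in_set0.
have jE k k' : 0 < j (k, k') -> j (k, k') = m [set k; k'].
  have [->|kk'] := eqVneq k k'; first by rewrite j_diag.
  rewrite -(j_sum k k' kk'); case: (j_orient k k' kk') => -> //; by rewrite addn0.
(* An edge from [k] to [k'] means that the elements of the zone are warm for [k], which bears the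
   size constraint, and hot for [k'], where they are free. *)
exists (fun k k' => 0 < j (k, k')), (fun k k' => zone warm kappa (k, k')).
split; first by move=> k; rewrite j_diag.
split.
  move=> k k' kk'; rewrite -(j_sum k k' kk') addn_gt0; split=> //.
  by case: (j_orient k k' kk') => ->; rewrite ?andbF.
split.
  move=> x; exists (warm x), (kappa x); rewrite inE eqxx; split=> //.
  rewrite lt0n; apply/eqP => /zone_e/setP/(_ x); by rewrite inE eqxx in_set0.
split.
  move=> k1 k1' k2 k2' _ _ ne; apply/setP => x; rewrite in_setI in_set0 !inE.
  by apply/negP => /andP[/eqP -> /eqP E]; rewrite E eqxx in ne.
split.
  move=> k k' jk; rewrite -(jE _ _ jk); apply: le_trans (size _ jk) _.
  apply: ler_wpM2r; first by rewrite divr_ge0 ?ler0n.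
  by apply: ler_wpM2r; [rewrite invr_ge0 ler0n | exact: C_le].
move=> k X D XA DA; apply: (subsetP (zsub k)).
by apply: zfam_union => // k'; exact: zone_e.
Qed.
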